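(* Let $n\ge2$ and let $\Omega$ be a bounded $s$-John domain in $\mathbb{R}^n$ with $1\le s<n/(n-1)$. Let $\delta\in(0,n]$, $p\in(\delta/n,\ \delta/(n+s(1-n)))$ and $\kappa\in[0,\ n+s(1-n))$, and put $q=\frac{(\delta-\kappa p)p}{\delta-p(n+s(1-n))}$. Then there is a constant $c$ depending only on $n,\delta,\kappa,p,\Omega$ such that \[ \inf_{b\in\mathbb{R}}\Big(\int_\Omega|u(x)-b|^q\,d\mathcal{H}^{\delta-\kappa p}_\infty\Big)^{1/q}\le c\Big(\int_\Omega|\nabla u(x)|^p\,d\mathcal{H}^{\delta}_\infty\Big)^{1/p} \] for all $u\in C^1(\Omega)$.
   Context: Let $s\ge1$. A bounded domain (open connected set) $\Omega\subset\mathbb{R}^n$ is an $s$-John domain if there are finite positive constants $c_J,C_J$ and a point $x_0\in\Omega$ such that every $x\in\Omega$ can be joined to $x_0$ by a rectifiable curve $\gamma_x:[0,\ell(\gamma_x)]\to\Omega$ parametrised by arc length with $\gamma_x(0)=x$, $\gamma_x(\ell(\gamma_x))=x_0$, $\ell(\gamma_x)\le C_J$, and $\operatorname{dist}(\gamma_x(t),\partial\Omega)\ge c_J t^s$ for all $t\in[0,\ell(\gamma_x)]$. For $E\subset\mathbb{R}^n$ and $\beta\in(0,n]$, $\mathcal{H}^{\beta}_\infty(E)=\inf\{\sum_i r_i^{\beta}: E\subset\bigcup_i B(x_i,r_i)\}$ over countable or finite coverings by open balls. For $f:\Omega\to[0,\infty]$, $\int_\Omega f\,d\mathcal{H}^{\beta}_\infty:=\int_0^\infty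 \mathcal{H}^{\beta}_\infty(\{x\in\Omega: f(x)>t\})\,dt$. *)

(* Defs.v *)
From HB Require Import structures.
From mathcomp Require Import all_boot all_order all_algebra.
From mathcomp Require Import all_classical all_reals all_analysis.
Set Implicit Arguments. Unset Strict Implicit. Unset Printing Implicit Defensive.
Import Order.TTheory GRing.Theory Num.Theory.
Local Open Scope classical_set_scope.
Local Open Scope ring_scope.

Section Defs.
Context {R : realType} {n : nat}.
Local Notation V := 'rV[R]_n.

Definition enorm (x : V) : R := Num.sqrt (\sum_(i < n) (x ord0 i) ^+ 2).

Definition eball (c : V) (r : R) : set V := [set y | enorm (y - c) < r].

(* Hausdorff content H^beta_infty(E): infimum over countable coverings by
   open balls (radius 0 balls are empty, so finite coverings are included). *)
Definition hcontent (beta : R) (E : set V) : \bar R :=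
  ereal_inf [set S | exists (c : nat -> V) (r : nat -> R),
     (forall i, 0 <= r i) /\ E `<=` \bigcup_i eball (c i) (r i) /\
     S = (\sum_(0 <= i <oo) ((r i) `^ beta)%:E)%E].

Definition choquet (beta : R) (Omega : set V) (f : V -> \bar R) : \bar R :=
  (\int[@lebesgue_measure R]_(t in `[0%R, +oo[%classic)
      hcontent beta [set x | Omega x /\ (t%:E < f x)%E])%E.

Definition eboundary (Omega : set V) : set V :=
  [set x | forall e : R, 0 < e ->
     (exists y, Omega y /\ enorm (y - x) < e) /\
     (exists z, ~ Omega z /\ enorm (z - x) < e)].

Definition edist (x : V) (A : set V) : \bar R :=
  ereal_inf [set (enorm (x - y))%:E | y in A].

Definition curve_length (gamma : R -> V) (a b : R) : \bar R :=
  ereal_sup [set S | exists (k : nat) (t : nat -> R),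
     t 0%N = a /\ t k = b /\ (forall i, (i < k)%N -> t i <= t i.+1) /\
     S = (\sum_(i < k) enorm (gamma (t i.+1) - gamma (t i)))%:E].

Definition eopen (Omega : set V) : Prop :=
  forall x, Omega x -> exists2 r : R, 0 < r & eball x r `<=` Omega.

Definition econnected (Omega : set V) : Prop :=
  ~ exists A B : set V, eopen A /\ eopen B /\ Omega `<=` A `|` B /\
      (A `&` Omega) !=set0 /\ (B `&` Omega) !=set0 /\ A `&` B `&` Omega = set0.

Definition bounded_domain (Omega : set V) : Prop :=
  eopen Omega /\ econnected Omega /\ Omega !=set0 /\
  exists M : R, forall x, Omega x -> enorm x <= M.

Definition s_john (s : R) (Omega : set V) : Prop :=
  bounded_domain Omega /\
  exists (cJ CJ : R) (x0 : V), 0 < cJ /\ 0 < CJ /\ Omega x0 /\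
    forall x, Omega x -> exists (gamma : R -> V) (L : R),
      0 <= L /\ L <= CJ /\ gamma 0 = x /\ gamma L = x0 /\
      (forall t, 0 <= t <= L -> forall e : R, 0 < e -> exists2 d : R, 0 < d &
         forall t', 0 <= t' <= L -> `|t' - t| < d -> enorm (gamma t' - gamma t) < e) /\
      (forall t, 0 <= t <= L -> curve_length gamma 0 t = t%:E) /\
      (forall t, 0 <= t <= L -> Omega (gamma t)) /\
      (forall t, 0 <= t <= L ->
         ((cJ * t `^ s)%:E <= edist (gamma t) (eboundary Omega))%E).

Definition ebasis (i : 'I_n) : V := delta_mx ord0 i.

Definition partial_derivable (u : V -> R) (i : 'I_n) (x : V) : Prop :=
  derivable (fun h : R => u (x + h *: ebasis i)) 0 1.

Definition partial (u : V -> R) (i : 'I_n) (x : V) : R :=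
  derive1 (fun h : R => u (x + h *: ebasis i)) 0.

Definition C1_on (Omega : set V) (u : V -> R) : Prop :=
  forall x, Omega x -> forall i : 'I_n,
    partial_derivable u i x /\
    (forall e : R, 0 < e -> exists2 d : R, 0 < d &
       forall y, Omega y -> enorm (y - x) < d -> `|partial u i y - partial u i x| < e).

Definition grad_norm (u : V -> R) (x : V) : R :=
  Num.sqrt (\sum_(i < n) (partial u i x) ^+ 2).

End Defs.

(* Main.v *)
(* Put alpha = n - s(n-1).  Following a John curve from x through dyadic cubes whose side
   is comparable to the s-th power of the distance travelled, and using the Poincare
   inequality on neighbouring cubes, one gets |u(x) - b| <= C sum_j r_j^alpha a_j(x), where
   r_j = D/2^j and a_j(x) is the average of |grad u| over the part of Omega within C r_j of
   x.  Lebesgue measure on R^n is avoided: averages are limits of averages over dyadic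
   grids.  If the level sets {|grad u| > 2^k} are covered by balls of radii r_{k,i}, then
   a_j(x) is controlled by sum 2^{k delta/n} r_{k,i}^delta over the nearby balls, because
   sum 2^k r^n <= (sum 2^{k delta/n} r^delta)^{n/delta}.  This gives on the one hand
   a_j <= C r_j^{-delta/p} F^{1/p}, where F = sum 2^{kp} r_{k,i}^delta is comparable to the
   Choquet integral of |grad u|^p.  On the other hand, a stopping time argument over maximal
   dyadic cubes, in which p > delta/n yields convergent geometric sums, shows that
   sup_j r_j^kappa a_j is bounded from L^p(H^delta) to L^p(H^{delta - kappa p}).  As in
   Hedberg's proof of Sobolev's inequality the two bounds are balanced in the sum over j. *)
Require Import Defs.
From HB Require Import structures.
From mathcomp Require Import all_boot all_order all_algebra.
From mathcomp Require Import all_classical all_reals all_analysis.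
From mathcomp Require Import ring lra zify measurable_realfun.
Import Order.TTheory GRing.Theory Num.Theory.
Import numFieldNormedType.Exports.
Local Open Scope classical_set_scope.
Local Open Scope ring_scope.
Set Implicit Arguments. Unset Strict Implicit. Unset Printing Implicit Defensive.

(** * Dyadic grids *)

Section Grid.
Context {R : realType} {n : nat}.
Local Notation V := 'rV[R]_n.
Local Notation Z := 'rV[int]_n.

(** Hausdorff content is not additive, so neither the charging of cubes nor the stopping time can be
    run on it directly. Once near-optimal coverings of all level sets of [u] are fixed, it is
    replaced by a genuine discrete measure: each covering ball becomes a point mass at its centre.
    Heaviness of a cube, disjointness and the exchange of sums then refer to these masses only. The
    exponent delta/n is critical: (2^(k delta/n) r^delta)^(n/delta) = 2^k r^n is height times
    volume. The surplus p - delta/n pays for the sums over levels. The value of q comes from the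
    balance. Put a1 = alpha - kappa and a2 = delta/p - alpha, positive because kappa < alpha and p
    alpha < delta, and let M = sup_j r_j^kappa a_j. Hedberg's argument gives |u - b| <= C
    M^(a2/(a1+a2)) F^(a1/(p(a1+a2))), and q is the exponent with q a2/(a1+a2) = p. Hence |u - b|^q
    <= C M^p F^((q-p)/p), and the bound for M^p supplies the remaining factor F. *)

Definition side (D : R) (m : nat) : R := D / 2 ^+ m.
Definition grid_pt (h : R) (k : Z) : V := \row_i (h * (k ord0 i)%:~R).
(** Closed, so that cubes are compact; unique addresses come from the half-open [idx] and [box]
    instead. *)
Definition cube (D : R) (m : nat) (a : Z) : set V :=
  [set x | forall i, side D m * (a ord0 i)%:~R <= x ord0 i <= side D m * (a ord0 i + 1)%:~R].
Definition idx (D : R) (m : nat) (x : V) : Z := \row_i Num.floor (x ord0 i / side D m).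
(** Half-open, so that the boxes [box (M *: c) M] tile the lattice. With [M = 2 ^ N] such a box
    lists the descendants, [N] levels down, of the cube with index [c], and equally the grid points
    that sample it. *)
Definition box (a : Z) (M : nat) : seq Z :=
  [seq \row_i (a ord0 i + (j i : nat)%:Z) | j : {ffun 'I_n -> 'I_M}].

Lemma mem_box (a k : Z) M :
  (k \in box a M) = [forall i, (a ord0 i <= k ord0 i) && (k ord0 i < a ord0 i + M%:Z)].
Proof.
apply/mapP/forallP => [[j _ ->] i|H].
  rewrite mxE; have : (j i < M)%N by []. by move: (nat_of_ord (j i)) => x H; lia.
have P i : (`|k ord0 i - a ord0 i| < M)%N by have := H i; lia.
exists [ffun i => Ordinal (P i)]; first by rewrite mem_enum.
by apply/rowP => i; rewrite mxE ffunE /=; have := H i; move: (k ord0 i) (a ord0 i) => x y /andP[]; clear; lia.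
Qed.

Lemma uniq_box (a : Z) M : uniq (box a M).
Proof.
rewrite map_inj_uniq ?enum_uniq// => j j' /rowP E; apply/ffunP => i.
by have := E i; rewrite !mxE => /addrI [] /val_inj.
Qed.

Lemma size_box (a : Z) M : size (box a M) = (M ^ n)%N.
Proof. by rewrite size_map -cardE card_ffun !card_ord. Qed.

Lemma size_sub_box (s : seq Z) (a : Z) M : uniq s ->
  (forall k, k \in s -> forall i, a ord0 i <= k ord0 i < a ord0 i + M%:Z) ->
  (size s <= M ^ n)%N.
Proof.
move=> us H; rewrite -(size_box a M); apply: uniq_leq_size => // k ks.
by rewrite mem_box; apply/forallP => i; exact: H.
Qed.

(** Euclidean division by [M] in every coordinate: the quotient is the coarse index, the remainder
    the position inside the coarse box. *)
Lemma box_split (a : Z) (P M : nat) : (0 < M)%N ->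
  perm_eq (box (M%:Z *: a) (P * M)%N)
          (flatten [seq box (M%:Z *: c) M | c <- box a P]).
Proof.
move=> M0.
have -> : flatten [seq box (M%:Z *: c) M | c <- box a P] =
    [seq y | c <- box a P, y <- box (M%:Z *: c) M].
  by congr flatten; apply: eq_map => c; rewrite map_id.
apply: uniq_perm; first exact: uniq_box.
  apply: allpairs_uniq_dep; [exact: uniq_box|by move=> c _; exact: uniq_box|].
  move=> [c k] [c' k'] /allpairsPdep[c1 [k1 [_ + [-> ->]]]] /allpairsPdep[c2 [k2 [_ + [-> ->]]]] /= E.
  rewrite E !mem_box => /forallP H1 /forallP H2.
  suff -> : c1 = c2 by [].
  apply/rowP => i; have := H1 i; have := H2 i; rewrite !mxE.
  move: (k2 ord0 i) (c1 ord0 i) (c2 ord0 i) => x y z /andP[A B] /andP[C E'].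
  by clear -M0 A B C E'; nia.
move=> k; rewrite mem_box; apply/forallP/allpairsPdep => [H|[c [k' [+ + ->]]]].
  exists (\row_i (k ord0 i %/ M%:Z)%Z), k; split => //; rewrite mem_box; apply/forallP => i.
    have := H i; rewrite !mxE; have M0' : (0 < M%:Z)%R by [].
    rewrite lez_divRL// ltz_divLR//.
    move: (k ord0 i) (a ord0 i) => x y /andP[A B]; clear -A B M0.
    by apply/andP; split; lia.
  have := divz_eq (k ord0 i) M%:Z; have := @modz_ge0 (k ord0 i) M%:Z; have := @ltz_pmod (k ord0 i) M%:Z.
  rewrite !mxE; move: (k ord0 i) => x; move: (x %/ M)%Z (x %% M)%Z => u v A B C.
  by clear -A B C M0; apply/andP; split; lia.
rewrite !mem_box => /forallP H /forallP H' i; have := H i; have := H' i; rewrite !mxE.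
move: (c ord0 i) (k' ord0 i) (a ord0 i) => x y z /andP[A B] /andP[C E]; clear -A B C E M0.
by apply/andP; split; nia.
Qed.

Lemma sum_box_split (T : nmodType) (F : Z -> T) (a : Z) (P M : nat) : (0 < M)%N ->
  \sum_(k <- box (M%:Z *: a) (P * M)%N) F k = \sum_(c <- box a P) \sum_(k <- box (M%:Z *: c) M) F k.
Proof. by move=> M0; rewrite (perm_big _ (box_split a P M0))/= big_flatten/= big_map. Qed.

Lemma side_gt0 D m : 0 < D -> 0 < side D m.
Proof. by move=> D0; rewrite divr_gt0 ?exprn_gt0. Qed.

Lemma sideD D m N : side D m = side D (m + N) * 2 ^+ N.
Proof. by rewrite /side exprD invfM mulrA divfK// expf_neq0. Qed.

Lemma side_le D m N : 0 < D -> (m <= N)%N -> side D N <= side D m.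
Proof.
move=> D0 /subnKC <-; rewrite (sideD D m (N - m)); apply: ler_peMr.
  exact/ltW/side_gt0.
by apply: exprn_ege1; rewrite ler1n.
Qed.

Lemma idxP D m x (a : Z) : 0 < D ->
  (idx D m x = a) <-> (forall i, side D m * (a ord0 i)%:~R <= x ord0 i < side D m * (a ord0 i + 1)%:~R).
Proof.
move=> D0; have s0 := side_gt0 m D0; split => [<- i|H].
  rewrite mxE mulrC -ler_pdivlMr// [side D m * _]mulrC -ltr_pdivrMr//.
  exact: floor_itv.
apply/rowP => i; rewrite mxE; apply: floor_def.
by rewrite ler_pdivlMr// ltr_pdivrMr// mulrC [X in _ && (_ < X)]mulrC.
Qed.

End Grid.

(** * Cube averages *)

Section Avg.
Context {R : realType} {n : nat}.
Local Notation V := 'rV[R]_n.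
Local Notation Z := 'rV[int]_n.
Variable D : R.
Hypothesis D0 : 0 < D.

(* Averages over finer and finer dyadic grids: their limit [cube_avg] replaces the
   Lebesgue average over the cube. *)
Definition grid_avg (g : V -> R) (m : nat) (a : Z) (N : nat) : R :=
  ((2 ^ N) ^ n)%:R^-1 * \sum_(k <- box ((2 ^ N)%:Z *: a) (2 ^ N)) g (grid_pt (side D (m + N)) k).

Definition cube_avg (g : V -> R) (m : nat) (a : Z) : R := limn (grid_avg g m a).

Definition unif_cont_on (g : V -> R) (A : set V) : Prop := forall e : R, 0 < e ->
  exists2 d : R, 0 < d & forall x y, A x -> A y -> (forall i, `|x ord0 i - y ord0 i| <= d) -> `|g x - g y| <= e.

Lemma card2_gt0 N : 0 < ((2 ^ N) ^ n)%:R :> R.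
Proof. by rewrite ltr0n !expn_gt0. Qed.

Lemma grid_pt_cube m a N (k : Z) : k \in box ((2 ^ N)%:Z *: a) (2 ^ N) ->
  cube D m a (grid_pt (side D (m + N)) k).
Proof.
rewrite mem_box => /forallP H i; have := H i; rewrite !mxE (sideD D m N).
have s0 := side_gt0 (m + N) D0.
have -> : 2 ^+ N = ((2 ^ N)%:Z)%:~R :> R by rewrite -natrX.
rewrite -!mulrA !ler_pM2l// -!intrM !ler_int.
move: (k ord0 i) (a ord0 i) => x y /andP[A B]; clear -A B.
by apply/andP; split; lia.
Qed.

Lemma grid_avg_near (g : V -> R) m a N (v e : R) :
  (forall x, cube D m a x -> `|g x - v| <= e) -> `|grid_avg g m a N - v| <= e.
Proof.
move=> H; have c0 := card2_gt0 N.
have -> : grid_avg g m a N - v = ((2 ^ N) ^ n)%:R^-1 * \sum_(k <- box ((2 ^ N)%:Z *: a) (2 ^ N))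
   (g (grid_pt (side D (m + N)) k) - v).
  rewrite sumrB big_const_seq count_predT size_box iter_addr_0 mulrBr -[v *+ _]mulr_natl mulKf ?(lt0r_neq0 c0)//.
rewrite normrM gtr0_norm ?invr_gt0// ler_pdivrMl//.
apply: le_trans (ler_norm_sum _ _ _) _.
rewrite mulr_natl -(size_box ((2 ^ N)%:Z *: a)) -iter_addr_0 -count_predT -big_const_seq.
rewrite !big_seq; apply: ler_sum => k kb; exact/H/grid_pt_cube.
Qed.

(** Consistency across scales: it yields both the Cauchy property of the grid averages and, in the
    limit, the fact that an average is the mean of those over the children. *)
Lemma grid_avg_split g m a K N :
  grid_avg g m a (K + N) = ((2 ^ K) ^ n)%:R^-1 *
    \sum_(c <- box ((2 ^ K)%:Z *: a) (2 ^ K)) grid_avg g (m + K) c N.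
Proof.
rewrite /grid_avg -mulr_sumr mulrA -invfM -natrM -expnMn -expnD; congr (_ * _).
have -> : (2 ^ (K + N))%:Z *: a = (2 ^ N)%:Z *: ((2 ^ K)%:Z *: a).
  by rewrite scalerA -PoszM -expnD addnC.
by rewrite expnD sum_box_split ?expn_gt0// addnA.
Qed.

Lemma sub_cube m a N (c : Z) : c \in box ((2 ^ N)%:Z *: a) (2 ^ N) ->
  cube D (m + N) c `<=` cube D m a.
Proof.
rewrite mem_box => /forallP H x Hx i; have := H i; have := Hx i; rewrite !mxE (sideD D m N).
have s0 := side_gt0 (m + N) D0.
have -> : 2 ^+ N = ((2 ^ N)%:Z)%:~R :> R by rewrite -natrX.
move=> /andP[A B] /andP[C E]; apply/andP; split.
  by apply: le_trans A; rewrite -mulrA ler_pM2l// -intrM ler_int.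
apply: (le_trans B); rewrite -mulrA ler_pM2l// -intrM ler_int.
by move: (c ord0 i) (a ord0 i) C E => u v C E; clear -C E; lia.
Qed.

Lemma cube_dist m (a : Z) x y : cube D m a x -> cube D m a y ->
  forall i, `|x ord0 i - y ord0 i| <= side D m.
Proof.
move=> Hx Hy i; have := Hx i; have := Hy i; rewrite intrD mulrDr mulr1 ler_norml; lra.
Qed.

Lemma side_small d : 0 < d -> exists m, side D m <= d.
Proof.
move=> d0; exists (Num.trunc (D / d)).+1; rewrite ler_pdivrMr ?exprn_gt0// mulrC -ler_pdivrMr//.
apply: (le_trans (ltW (truncnS_gt _))).
by rewrite -natrX ler_nat ltnW// ltn_expl.
Qed.

Lemma grid_avg_cvg g m a : unif_cont_on g (cube D m a) -> grid_avg g m a @ \oo --> cube_avg g m a.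
Proof.
move=> H; apply: (@cauchy_cvg R^o (grid_avg g m a @ \oo) _); apply/cauchy_exP => e e0.
have [d d0 Hd] := H (e / 2) (divr_gt0 e0 (ltr0Sn _ 1)).
have [K sK] := side_small d0.
exists (grid_avg g m a K).
suff : \forall N \near \oo, `|grid_avg g m a K - grid_avg g m a N| < e by [].
near=> N.
have KN : (K <= N)%N by near: N; exact: nbhs_infty_ge.
(* With no further refinement each subcube of level [m + K] is sampled at its lower corner only, so
   the coarse and the fine average are compared subcube by subcube. *)
have := grid_avg_split g m a K 0; rewrite addn0 => ->.
rewrite distrC -(subnKC KN) grid_avg_split -mulrBr -sumrB.
have c0 := card2_gt0 K.
apply: (@le_lt_trans _ _ (e / 2)); last by lra.
rewrite normrM gtr0_norm ?invr_gt0// ler_pdivrMl//.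
apply: le_trans (ler_norm_sum _ _ _) _.
rewrite mulr_natl -(size_box ((2 ^ K)%:Z *: a)) -iter_addr_0 -count_predT -big_const_seq.
rewrite !big_seq; apply: ler_sum => c cb; apply: grid_avg_near => x cx.
rewrite distrC; apply: grid_avg_near => y cy; apply: Hd; [exact: sub_cube cy|exact: sub_cube cx|].
move=> i; apply: le_trans (cube_dist cy cx i) _; apply: le_trans sK.
by rewrite side_le// leq_addl.
Unshelve. all: by end_near. Qed.

Lemma cube_avg_near g m a v e : unif_cont_on g (cube D m a) ->
  (forall x, cube D m a x -> `|g x - v| <= e) -> `|cube_avg g m a - v| <= e.
Proof.
move=> uc H.
have C : `|grid_avg g m a N - v| @[N --> \oo] --> `|cube_avg g m a - v|.
  by apply: cvg_norm; apply: cvgB; [exact: grid_avg_cvg|exact: cvg_cst].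
rewrite -(cvg_lim _ C)//; apply: limr_le; first exact: cvgP C.
by apply: nearW => N; exact: grid_avg_near.
Qed.

End Avg.

(** * A Poincare inequality for neighbouring cubes *)

Section Poincare.
Context {R : realType} {n : nat}.
Local Notation V := 'rV[R]_n.
Local Notation Z := 'rV[int]_n.
Variable D : R.
Hypothesis D0 : 0 < D.

Lemma cvg_rsum (T : eqType) (s : seq T) (f : T -> nat -> R) (l : T -> R) :
  (forall c, c \in s -> f c @ \oo --> l c) ->
  (\sum_(c <- s) f c N) @[N --> \oo] --> \sum_(c <- s) l c.
Proof.
elim: s => [|c s IH] H.
  by under eq_fun do rewrite big_nil; rewrite big_nil; exact: cvg_cst.
rewrite big_cons; under eq_fun do rewrite big_cons.
apply: cvgD; first by apply: H; rewrite mem_head.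
by apply: IH => c' cs; apply: H; rewrite in_cons cs orbT.
Qed.

Lemma cube_avg_split g m (a : Z) : unif_cont_on g (cube D m a) ->
  cube_avg D g m a = (2 ^ n)%:R^-1 * \sum_(c <- box (2%:Z *: a) 2) cube_avg D g m.+1 c.
Proof.
move=> uc; have C := grid_avg_cvg D0 uc.
have C1 : grid_avg D g m a (1 + N)%N @[N --> \oo] --> cube_avg D g m a.
  by rewrite -(cvg_shiftn 1) in C; under eq_fun do rewrite addnC.
apply: (cvg_unique _ C1) => //.
have -> : (fun N => grid_avg D g m a (1 + N)) =
    (fun N => (2 ^ n)%:R^-1 * \sum_(c <- box (2%:Z *: a) 2) grid_avg D g m.+1 c N).
  by apply/funext => N; rewrite grid_avg_split expn1 addn1.
apply: cvgM; first exact: cvg_cst.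
apply: cvg_rsum => c cb; rewrite -addn1; apply: grid_avg_cvg => // e e0.
have [d d0 Hd] := uc e e0; exists d => // x y Ax Ay.
by apply: Hd; [exact: (@sub_cube _ _ _ D0 m a 1 c cb)|exact: (@sub_cube _ _ _ D0 m a 1 c cb)].
Qed.

Lemma grid_avg_ge0 (g : V -> R) m (a : Z) N : (forall x, 0 <= g x) -> 0 <= grid_avg D g m a N.
Proof. by move=> g0; rewrite mulr_ge0 ?invr_ge0 ?ler0n ?sumr_ge0. Qed.

Lemma cube_avg_ge0 (g : V -> R) m (a : Z) : unif_cont_on g (cube D m a) -> (forall x, 0 <= g x) -> 0 <= cube_avg D g m a.
Proof.
move=> uc g0; apply: limr_ge; first exact: cvgP (grid_avg_cvg D0 uc).
by apply: nearW => N; exact: grid_avg_ge0.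
Qed.

Lemma sum_uniq_sub (T : eqType) (s t : seq T) (F : T -> R) : uniq s -> uniq t ->
  {subset s <= t} -> (forall x, 0 <= F x) -> \sum_(x <- s) F x <= \sum_(x <- t) F x.
Proof.
move=> us ut st F0; have P : perm_eq s [seq x <- t | x \in s].
  apply: uniq_perm => //; first exact: filter_uniq.
  by move=> x; rewrite mem_filter andb_idr//; exact: st.
rewrite (perm_big _ P)/= big_filter big_mkcond/=; apply: ler_sum => x _.
by case: ifP.
Qed.

Lemma sum_uniq_cat (T : eqType) (s t1 t2 : seq T) (F : T -> R) : uniq s -> uniq t1 -> uniq t2 ->
  {subset s <= t1 ++ t2} -> (forall x, 0 <= F x) ->
  \sum_(x <- s) F x <= \sum_(x <- t1) F x + \sum_(x <- t2) F x.
Proof.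
move=> us u1 u2 st F0; rewrite (bigID (mem t1))/= -big_filter -[X in _ + X <= _]big_filter; apply: lerD.
  by apply: sum_uniq_sub; rewrite ?filter_uniq// => x; rewrite mem_filter => /andP[].
apply: sum_uniq_sub; rewrite ?filter_uniq// => x; rewrite mem_filter => /andP[xt /st].
by rewrite mem_cat (negbTE xt).
Qed.

(** The mean value theorem along coordinate segments. The value of [g] at an intermediate point,
    rather than its supremum, is kept so that averaging returns an average of [g]. *)
Definition slope_bd (C : R) (u g : V -> R) (A : set V) : Prop :=
  forall x i h, 0 <= h -> (forall t, 0 <= t <= h -> A (x + t *: ebasis i)) ->
  exists2 t, 0 <= t <= h & `|u (x + h *: ebasis i) - u x| <= C * h * g (x + t *: ebasis i).

Definition unit_vec (i : 'I_n) : Z := \row_j (j == i)%:Z.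

Lemma box_shift (i : 'I_n) (a : Z) M :
  perm_eq (box (M%:Z *: (a + unit_vec i)) M) [seq k + M%:Z *: unit_vec i | k <- box (M%:Z *: a) M].
Proof.
apply: uniq_perm; [exact: uniq_box|by rewrite map_inj_uniq ?uniq_box//; exact: addIr|].
move=> k; apply/idP/mapP => [|[k' + ->]]; rewrite !mem_box.
  move=> /forallP H; exists (k - M%:Z *: unit_vec i); last by rewrite subrK.
  rewrite mem_box; apply/forallP => j; have := H j; rewrite !mxE.
  by move: (k ord0 j) (a ord0 j) (j == i) => x y b /andP[A B]; clear -A B; lia.
move=> /forallP H; apply/forallP => j; have := H j; rewrite !mxE.
by move: (k' ord0 j) (a ord0 j) (j == i) => x y b /andP[A B]; clear -A B; lia.
Qed.

Lemma box_shift_sub (i : 'I_n) (a : Z) (M t : nat) : (t <= M)%N ->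
  {subset [seq k + t%:Z *: unit_vec i | k <- box (M%:Z *: a) M] <=
     box (M%:Z *: a) M ++ box (M%:Z *: (a + unit_vec i)) M}.
Proof.
move=> tM k /mapP[k' + ->]; rewrite mem_cat !mem_box => /forallP H.
have [L|L] := ltP (k' ord0 i + t%:Z) (M%:Z * a ord0 i + M%:Z); apply/orP; [left|right];
  apply/forallP => j; have := H j; rewrite !mxE; have [->|ji] := eqVneq j i.
- by move: (k' ord0 i) (a ord0 i) L => x y L /andP[A B]; clear -A B L; lia.
- by move: (k' ord0 j) (a ord0 j) => x y /andP[A B]; clear -A B; lia.
- by move: (k' ord0 i) (a ord0 i) L => x y L /andP[A B]; clear -A B L tM; lia.
- by move: (k' ord0 j) (a ord0 j) => x y /andP[A B]; clear -A B; lia.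
Qed.

Lemma grid_pt_shift (h : R) (k : Z) i (t : nat) :
  grid_pt h (k + t.+1%:Z *: unit_vec i) = grid_pt h (k + t%:Z *: unit_vec i) + h *: ebasis i.
Proof.
apply/rowP => j; rewrite !mxE eqxx/=; case: (j == i); rewrite ?mulr1 ?mulr0 ?addr0//.
by rewrite -[t.+1]addn1 PoszD !intrD; lra.
Qed.

Lemma seg_cube (i : 'I_n) m (a k : Z) (N t : nat) (r : R) :
  k \in box ((2 ^ N)%:Z *: a) (2 ^ N) -> (t < 2 ^ N)%N -> 0 <= r <= side D (m + N) ->
  (cube D m a `|` cube D m (a + unit_vec i)) (grid_pt (side D (m + N)) (k + t%:Z *: unit_vec i) + r *: ebasis i).
Proof.
rewrite mem_box => /forallP H tM /andP[r0 rh]; have s0 := side_gt0 (m + N) D0.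
have E2 : 2 ^+ N = ((2 ^ N)%:Z)%:~R :> R by rewrite -natrX.
have key (x y : int) : x <= y -> side D (m + N) * x%:~R <= side D (m + N) * y%:~R.
  by move=> xy; rewrite ler_pM2l// ler_int.
have side_m (x : int) : side D m * x%:~R = side D (m + N) * ((2 ^ N)%:Z * x)%:~R.
  by rewrite (sideD D m N) E2 -mulrA intrM.
have other j b (c : int) : j != i -> (c = a ord0 j) -> side D m * c%:~R <= (grid_pt (side D (m + N)) (k + t%:Z *: unit_vec i) + b *: ebasis i) ord0 j <= side D m * (c + 1)%:~R.
  move=> /negbTE ji ->; rewrite !mxE ji eqxx/= mulr0 addr0 !side_m mulr0 addr0.
  have := H j; rewrite !mxE; move: (k ord0 j) (a ord0 j) => x y /andP[A B].
  by apply/andP; split; apply: key; clear -A B; lia.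
(* The comparison is between integers, so a mesh segment never straddles the common face: it lies
   entirely in one of the two closed cubes. *)
have [L|L] := ltP (k ord0 i + t%:Z) ((2 ^ N)%:Z * a ord0 i + (2 ^ N)%:Z); [left|right] => j.
- have [->|ji] := eqVneq j i; last by apply: other.
  have := H i; rewrite !mxE !eqxx/= !mulr1 !side_m; move: (k ord0 i) (a ord0 i) L => x y L /andP[A B].
  have K1 : (2 ^ N)%:Z * y <= x + t by clear -A B; lia.
  have K2 : x + t + 1 <= (2 ^ N)%:Z * (y + 1) by clear -L; lia.
  have := key _ _ K1; have := key _ _ K2; rewrite (intrD _ _ 1) mulrDr mulr1 => K3 K4.
  by apply/andP; split; lra.
- have [->|ji] := eqVneq j i; last first.
    by rewrite [in (a + _) ord0 _]mxE mxE (negbTE ji) addr0; apply: other.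
  have := H i; rewrite !mxE !eqxx/= !mulr1 !side_m; move: (k ord0 i) (a ord0 i) L => x y L /andP[A B].
  have K1 : (2 ^ N)%:Z * (y + 1) <= x + t by clear -L; lia.
  have K2 : x + t + 1 <= (2 ^ N)%:Z * (y + 1 + 1) by clear -B tM; lia.
  have := key _ _ K1; have := key _ _ K2; rewrite (intrD _ _ 1) mulrDr mulr1 => K3 K4.
  by apply/andP; split; lra.
Qed.

(** The mean value point lies off the grid; [e] is the cost of moving it to the start of its mesh
    segment, and it can be made arbitrarily small by refining the grid. *)
Lemma grid_avg_slope C (u g : V -> R) m (a : Z) (i : 'I_n) N e d : 0 <= C -> (forall x, 0 <= g x) ->
  let A := cube D m a `|` cube D m (a + unit_vec i) in
  slope_bd C u g A ->
  (forall x y, A x -> A y -> (forall i, `|x ord0 i - y ord0 i| <= d) -> `|g x - g y| <= e) ->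
  side D (m + N) <= d ->
  `|grid_avg D u m (a + unit_vec i) N - grid_avg D u m a N| <=
     C * side D m * (grid_avg D g m a N + grid_avg D g m (a + unit_vec i) N + e).
Proof.
move=> C0 g0 A sl osc hd; have s0 := side_gt0 (m + N) D0.
set h := side D (m + N) in s0 hd *; set M := (2 ^ N)%N; have c0 : 0 < (M ^ n)%:R :> R := card2_gt0 N.
rewrite /grid_avg -!mulrBr -!mulrDr -/M -/h.
rewrite (perm_big _ (box_shift i a M))/= big_map -sumrB.
set B := box (M%:Z *: a) M; set S1 := \sum_(k <- B) g _; set S2 := \sum_(k <- box (M%:Z *: (a + unit_vec i)) M) g _.
have K k : k \in B -> `|u (grid_pt h (k + M%:Z *: unit_vec i)) - u (grid_pt h k)| <=
    \sum_(t < M) C * h * (g (grid_pt h (k + t%:Z *: unit_vec i)) + e).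
  move=> kB.
  have -> : u (grid_pt h (k + M%:Z *: unit_vec i)) - u (grid_pt h k) =
     \sum_(0 <= t < M) (u (grid_pt h (k + t.+1%:Z *: unit_vec i)) - u (grid_pt h (k + t%:Z *: unit_vec i))).
    by rewrite telescope_sumr// scale0r addr0.
  rewrite big_mkord; apply: le_trans (ler_norm_sum _ _ _) _; apply: ler_sum => t _.
  have Aseg r : 0 <= r <= h -> A (grid_pt h (k + t%:Z *: unit_vec i) + r *: ebasis i).
    by move=> rh; apply: seg_cube => //; exact: ltn_ord.
  rewrite grid_pt_shift; have [r rh] := sl _ i _ (ltW s0) Aseg.
  move=> /le_trans; apply; apply: ler_wpM2l; first by rewrite mulr_ge0// ltW.
  suff : `|g (grid_pt h (k + t%:Z *: unit_vec i) + r *: ebasis i) - g (grid_pt h (k + t%:Z *: unit_vec i))| <= e.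
    by rewrite ler_norml; lra.
  apply: osc; first exact: Aseg.
    by have := Aseg 0; rewrite scale0r addr0; apply; rewrite lexx ltW.
  move=> j; rewrite !mxE eqxx/=; case: eqP => _; rewrite ?mulr1 ?mulr0 ?addr0 ?subrr ?normr0 ?addKr.
    by rewrite [X in X - _]addrC addrK ger0_norm; move: rh => /andP[]// _ /le_trans; apply.
  exact: le_trans (ltW s0) hd.
rewrite normrM gtr0_norm ?invr_gt0// ler_pdivrMl//.
apply: le_trans (ler_norm_sum _ _ _) _; rewrite big_seq.
apply: le_trans (ler_sum _ (fun k kB => K k kB)) _; rewrite -big_seq exchange_big/=.
(* The bound is the same for all [M] translates, and [M * h = side D m] restores the full side of
   the cube. *)
have K2 (t : 'I_M) : \sum_(k <- B) C * h * (g (grid_pt h (k + t%:Z *: unit_vec i)) + e) <= C * h * (S1 + S2 + (M ^ n)%:R * e).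
  rewrite -mulr_sumr; apply: ler_wpM2l; first by rewrite mulr_ge0// ltW.
  rewrite big_split/=; apply: lerD; last first.
    by rewrite big_const_seq count_predT size_box iter_addr_0 mulr_natl.
  rewrite -(big_map (fun k => k + t%:Z *: unit_vec i) xpredT (fun k => g (grid_pt h k))).
  apply: sum_uniq_cat => //; [|exact: uniq_box|exact: uniq_box|by apply: box_shift_sub; exact: ltnW].
  by rewrite map_inj_uniq ?uniq_box//; exact: addIr.
apply: le_trans (ler_sum _ (fun t _ => K2 t)) _.
rewrite sumr_const card_ord -[_ *+ M]mulr_natr -/h (sideD D m N) -/h -natrX -/M.
have c1 := lt0r_neq0 c0.
move: (M%:R) ((M ^ n)%:R) c0 c1 => x y y0 y1.
suff -> : C * h * (S1 + S2 + y * e) * x = y * (C * (h * x) * (y^-1 * (S1 + S2) + e)) by [].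
by field.
Qed.

(* [u] differs from its translate by one cube side by a telescoping sum along grid
   lines; averaging the mean value bound over the grid gives grid averages of [g]. *)
Lemma poincare_step C (u g : V -> R) m (a : Z) (i : 'I_n) : 0 <= C -> (forall x, 0 <= g x) ->
  let A := cube D m a `|` cube D m (a + unit_vec i) in
  unif_cont_on u A -> unif_cont_on g A -> slope_bd C u g A ->
  `|cube_avg D u m (a + unit_vec i) - cube_avg D u m a| <=
     C * side D m * (cube_avg D g m a + cube_avg D g m (a + unit_vec i)).
Proof.
move=> C0 g0 A uu ug sl.
have sub (f : V -> R) B : unif_cont_on f A -> B `<=` A -> unif_cont_on f B.
  move=> uf BA e e0; have [d d0 H] := uf e e0; exists d => // x y Bx By; apply: H; exact: BA.
have s1 : cube D m a `<=` A by move=> x; left.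
have s2 : cube D m (a + unit_vec i) `<=` A by move=> x; right.
have cu1 := grid_avg_cvg D0 (sub _ _ uu s1); have cu2 := grid_avg_cvg D0 (sub _ _ uu s2).
have cg1 := grid_avg_cvg D0 (sub _ _ ug s1); have cg2 := grid_avg_cvg D0 (sub _ _ ug s2).
have s0 := side_gt0 m D0.
apply/ler_addgt0Pr => e e0.
have CS : 0 <= C * side D m by rewrite mulr_ge0// ltW.
(* The summand 1 keeps the denominator positive when [C = 0]. *)
pose e' := e / (C * side D m + 1).
have e'0 : 0 < e' by rewrite divr_gt0// ltr_wpDl.
have [d d0 Hd] := ug e' e'0; have [K sK] := side_small D d0.
have C1 : `|grid_avg D u m (a + unit_vec i) N - grid_avg D u m a N| @[N --> \oo] --> `|cube_avg D u m (a + unit_vec i) - cube_avg D u m a|.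
  by apply: cvg_norm; apply: cvgB.
have C2 : C * side D m * (grid_avg D g m a N + grid_avg D g m (a + unit_vec i) N + e') @[N --> \oo] -->
   C * side D m * (cube_avg D g m a + cube_avg D g m (a + unit_vec i) + e').
  by apply: cvgM; [exact: cvg_cst|apply: cvgD; [exact: cvgD|exact: cvg_cst]].
apply: (@le_trans _ _ (C * side D m * (cube_avg D g m a + cube_avg D g m (a + unit_vec i) + e'))); last first.
  rewrite mulrDr lerD2l /e' mulrCA ler_piMr ?(ltW e0)//.
  by rewrite ler_pdivrMr ?mul1r ?lerDl// ltr_wpDl.
rewrite -(cvg_lim _ C1)// -(cvg_lim _ C2)//; apply: ler_lim; [exact: cvgP C1|exact: cvgP C2|].
near=> N; apply: (grid_avg_slope C0 g0 sl Hd); apply: le_trans sK; apply: side_le => //.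
by rewrite (leq_trans _ (leq_addl _ _))//; near: N; exact: nbhs_infty_ge.
Unshelve. all: by end_near. Qed.

End Poincare.

(** * Chains of cubes *)

Section Chain.
Context {R : realType} {n : nat}.
Local Notation V := 'rV[R]_n.
Local Notation Z := 'rV[int]_n.

Definition neighbor (a b : Z) : bool := [forall i, `|a ord0 i - b ord0 i| <= 1].
Definition offsets : seq Z := box (const_mx (-1)) 3.

Lemma neighbor_offset a b : neighbor a b -> b - a \in offsets.
Proof.
move=> /forallP H; rewrite mem_box; apply/forallP => i; have := H i; rewrite !mxE.
by move: (a ord0 i) (b ord0 i) => x y; clear; lia.
Qed.

Lemma offset_neighbor a v : v \in offsets -> neighbor a (a + v).
Proof.
rewrite mem_box => /forallP H; apply/forallP => i; have := H i; rewrite !mxE.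
by move: (a ord0 i) (v ord0 i) => x y; clear; lia.
Qed.

Lemma neighbor_refl a : neighbor a a.
Proof. by apply/forallP => i; rewrite subrr normr0. Qed.

Variables (A I : Z -> R) (P : Z -> Prop) (K : R).
Hypothesis K0 : 0 <= K.
Hypothesis I0 : forall b, P b -> 0 <= I b.
Hypothesis step : forall a i, P a -> P (a + unit_vec i) ->
  `|A (a + unit_vec i) - A a| <= K * (I a + I (a + unit_vec i)).

(** In the application [A] and [I] are the cube averages of [u] and of its gradient, and [P b] says
    that the cube lies in the domain. A diagonal neighbour is reached by changing one coordinate at
    a time; the intermediate cubes [q t] are all neighbours of [a], hence counted in the sum over
    offsets. *)
Lemma neighbor_step a a' : neighbor a a' -> (forall b, neighbor a b -> P b) ->
  `|A a - A a'| <= 2 * n%:R * K * \sum_(v <- offsets) I (a + v).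
Proof.
move=> /forallP aa Pb; set S := \sum_(v <- offsets) _.
have S_ge b : neighbor a b -> I b <= S.
  move=> ab; rewrite /S (big_rem (b - a)) ?neighbor_offset//= [a + _]addrC subrK lerDl big_seq.
  by apply: sumr_ge0 => v vr; apply/I0/Pb/offset_neighbor; exact: mem_rem vr.
pose q (t : nat) : Z := \row_i (if (i < t)%N then a' ord0 i else a ord0 i).
have nbq t : neighbor a (q t).
  by apply/forallP => i; rewrite mxE; case: ifP => _; [exact: aa|rewrite subrr normr0].
have Q t : (t < n)%N -> `|A (q t) - A (q t.+1)| <= K * (S + S).
  move=> tn; pose i := Ordinal tn.
  have nbS x y : neighbor a x -> neighbor a y -> K * (I x + I y) <= K * (S + S).
    by move=> ? ?; apply: ler_wpM2l => //; apply: lerD; exact: S_ge.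
  have E (e : int) : e = a' ord0 i - a ord0 i -> q t.+1 = q t + e *: unit_vec i.
    move=> ->; apply/rowP => j; rewrite !mxE; have [->|ji] := eqVneq j i.
      by rewrite ltnS leqnn ltnn mulr1 [RHS]addrC subrK.
    have jt : (j : nat) != t by [].
    by rewrite mulr0 addr0 ltnS leq_eqVlt (negbTE jt).
  have : (a' ord0 i - a ord0 i == 0) || (a' ord0 i - a ord0 i == 1) || (a' ord0 i - a ord0 i == -1).
    by have := aa i; move: (a' ord0 i) (a ord0 i) => x y; clear; lia.
  move=> /orP[/orP[]|] /eqP /esym /E E'.
  - rewrite E' scale0r addr0 subrr normr0 mulr_ge0// addr_ge0//.
      by apply: le_trans (S_ge _ (neighbor_refl a)); apply/I0/Pb/neighbor_refl.
    by apply: le_trans (S_ge _ (neighbor_refl a)); apply/I0/Pb/neighbor_refl.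
  - rewrite distrC; move: E'; rewrite scale1r => E'; rewrite E'.
    apply: le_trans (step _ _) _; rewrite -?E'; [exact/Pb/nbq|exact/Pb/nbq|exact: nbS].
  - have E2 : q t = q t.+1 + unit_vec i by rewrite E' scaleN1r subrK.
    rewrite E2; apply: le_trans (step _ _) _; rewrite -?E2; [exact/Pb/nbq|exact/Pb/nbq|exact: nbS].
have -> : A a - A a' = \sum_(0 <= t < n) (A (q t) - A (q t.+1)).
  rewrite (eq_bigr (fun t => - (A (q t.+1) - A (q t)))); last by move=> *; rewrite opprB.
  rewrite sumrN telescope_sumr// opprB; congr (A _ - A _); apply/rowP => i; rewrite mxE//.
  by rewrite ltn_ord.
apply: le_trans (ler_norm_sum _ _ _) _; rewrite big_nat.
apply: le_trans (ler_sum _ (fun t tn => Q t tn)) _; rewrite -big_nat sumr_const_nat subn0 -[_ *+ n]mulr_natl.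
suff -> : n%:R * (K * (S + S)) = 2 * n%:R * K * S by [].
by ring.
Qed.

Lemma path_step a p : path neighbor a p -> (forall x b, x \in a :: p -> neighbor x b -> P b) ->
  `|A a - A (last a p)| <= 2 * n%:R * K * \sum_(x <- a :: p) \sum_(v <- offsets) I (x + v).
Proof.
elim: p a => [|a' p IH] a /=.
  move=> _ Pb; rewrite subrr normr0 !mulr_ge0// big_seq sumr_ge0// => x xa.
  by rewrite big_seq sumr_ge0// => v vo; apply/I0/(Pb x)/offset_neighbor.
move=> /andP[aa' pp] Pb; rewrite big_cons mulrDr.
apply: le_trans (ler_distD (A a') _ _) _; apply: lerD.
  by apply: neighbor_step => // b; apply: Pb; exact: mem_head.
by apply: IH => // x b xp; apply: Pb; rewrite in_cons xp orbT.
Qed.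

(* Loops are removed from the path, so that every cube is counted at most once. *)
Lemma chain_step (s : nat -> Z) H : (forall h, (h < H)%N -> neighbor (s h) (s h.+1)) ->
  (forall h b, (h <= H)%N -> neighbor (s h) b -> P b) ->
  exists l : seq Z, [/\ uniq l, (forall x, x \in l -> exists2 h, (h <= H)%N & x = s h) &
  `|A (s 0%N) - A (s H)| <= 2 * n%:R * K * \sum_(x <- l) \sum_(v <- offsets) I (x + v)].
Proof.
move=> sn sP; pose p := [seq s h | h <- iota 1 H].
have pp : path neighbor (s 0%N) p.
  have : forall k, (k <= H)%N -> path neighbor (s k) [seq s h | h <- iota k.+1 (H - k)].
    move=> k kH; have : (H - k <= H)%N by lia.
    move E : (H - k)%N => d _; elim: d k kH E => //= d IH k kH E.
    by rewrite sn ?IH//; lia.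
  by move=> /(_ 0%N (leq0n _)); rewrite subn0.
have lp : last (s 0%N) p = s H.
  by rewrite /p last_map; congr s; case: (H) => // H'; rewrite -[in LHS](addn1 H') iotaD last_cat/= add1n.
have mp x : x \in s 0%N :: p -> exists2 h, (h <= H)%N & x = s h.
  by rewrite in_cons => /orP[/eqP->|/mapP[h]]; [exists 0%N|rewrite mem_iota => hh ->; exists h => //; lia].
rewrite -lp; case/shortenP: pp => p' pp' up' sp'.
have mp' x : x \in s 0%N :: p' -> exists2 h, (h <= H)%N & x = s h.
  rewrite in_cons => /orP[/eqP->|/sp' xp]; first by exists 0%N.
  by apply: mp; rewrite in_cons xp orbT.
exists (s 0%N :: p'); split => //.
by apply: path_step => // x b /mp'[h hH ->]; exact: sP.
Qed.

End Chain.

(** * Functions of class C1 *)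

Section C1.
Context {R : realType} {n : nat}.
Local Notation V := 'rV[R]_n.
Local Notation Z := 'rV[int]_n.

Lemma sum_sqr_le (I : Type) (s : seq I) (F : I -> R) : (forall i, 0 <= F i) ->
  \sum_(i <- s) F i ^+ 2 <= (\sum_(i <- s) F i) ^+ 2.
Proof.
move=> F0; elim: s => [|i s IH]; first by rewrite !big_nil expr0n.
rewrite !big_cons; have := F0 i; have : 0 <= \sum_(j <- s) F j by apply: sumr_ge0.
by move: (\sum_(j <- s) F j) (\sum_(j <- s) F j ^+ 2) IH => x y IH x0 y0; nra.
Qed.

Lemma enorm_le_sum (v : V) : enorm v <= \sum_(i < n) `|v ord0 i|.
Proof.
have S0 : 0 <= \sum_(i < n) `|v ord0 i| by apply: sumr_ge0.
rewrite -[leRHS]ger0_norm// -sqrtr_sqr; apply: ler_wsqrtr.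
rewrite (eq_bigr (fun i => `|v ord0 i| ^+ 2)); last by move=> i _; rewrite -normrX ger0_norm// sqr_ge0.
exact: sum_sqr_le.
Qed.

Lemma sum_le_card (F : 'I_n -> R) r : (forall i, F i <= r) -> \sum_i F i <= n%:R * r.
Proof.
move=> H; apply: (@le_trans _ _ (\sum_(i < n) r)); first exact: ler_sum.
by rewrite sumr_const card_ord mulr_natl.
Qed.

Lemma enorm_le (v : V) r : (forall i, `|v ord0 i| <= r) -> enorm v <= n%:R * r.
Proof.
move=> H; apply: le_trans (enorm_le_sum v) _; rewrite mulr_natl -[n in leRHS]card_ord -sumr_const.
exact: ler_sum.
Qed.

Lemma enorm_coord (v : V) i : `|v ord0 i| <= enorm v.
Proof.
rewrite -sqrtr_sqr; apply: ler_wsqrtr; rewrite (bigD1 i)//= lerDl.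
by apply: sumr_ge0 => j _; exact: sqr_ge0.
Qed.

(* Comparable to [grad_norm u], with a continuity that needs no triangle inequality
   for [enorm]. *)
Definition mean_partial (u : V -> R) (x : V) : R := (\sum_(i < n) `|partial u i x|) / n%:R.

Lemma mean_partial_ge0 u x : 0 <= mean_partial u x.
Proof. by rewrite divr_ge0// sumr_ge0. Qed.

Lemma mean_partial_le_grad u x : (0 < n)%N -> mean_partial u x <= grad_norm u x.
Proof.
move=> n0; rewrite ler_pdivrMr ?ltr0n// mulrC; apply: sum_le_card => i.
by have := enorm_coord (\row_j partial u j x) i; rewrite /enorm mxE; under eq_bigr do rewrite mxE.
Qed.

Lemma partial_le u i x : `|partial u i x| <= n%:R * mean_partial u x.
Proof.
have n0 : (0 < n)%N by case: (n) i => [[]|].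
rewrite /mean_partial mulrC divfK ?pnatr_eq0 -?lt0n//.
by rewrite (bigD1 i)//= lerDl sumr_ge0.
Qed.

Definition cont_on (Omega : set V) (f : V -> R) : Prop := forall x, Omega x ->
  forall e : R, 0 < e -> exists2 d : R, 0 < d &
   forall y, Omega y -> (forall i, `|y ord0 i - x ord0 i| < d) -> `|f y - f x| < e.

Lemma near_coord (x : V) d : 0 < d -> \forall y \near x, forall i, `|(y : V) ord0 i - x ord0 i| < d.
Proof.
move=> d0; apply/nbhs_ballP; exists d => // y [_ H] i.
by rewrite distrC; exact: H.
Qed.

(** Heine-Cantor. Taking the moduli among the powers [2 ^- N] turns uniformity into a statement
    valid for all large [N], to which the near-covering form of compactness applies. *)
Lemma cont_on_ucont (A Omega : set V) f : compact A -> A `<=` Omega -> cont_on Omega f -> unif_cont_on f A.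
Proof.
move=> /compact_near_coveringP cA AO cf e e0.
pose P (N : nat) (x : V) := A x -> forall y, A y -> (forall i, `|x ord0 i - y ord0 i| <= (2 ^+ N)^-1) -> `|f x - f y| <= e.
have : \forall N \near \oo, A `<=` P N.
  apply: cA => x Ax; have [d d0 Hd] := cf x (AO _ Ax) (e / 2) (divr_gt0 e0 (ltr0Sn _ 1)).
  have d20 : 0 < d / 2 by rewrite divr_gt0.
  have [N0 HN0] := side_small 1 d20.
  exists ([set y : V | forall i, `|y ord0 i - x ord0 i| < d / 2], [set N | (N0 <= N)%N]).
    by split; [exact: near_coord|exact: nbhs_infty_ge].
  move=> [y N] /= [yx N0N] Ay z Az yz.
  have N1 : (2 ^+ N)^-1 <= d / 2.
    by apply: le_trans HN0; rewrite -div1r; exact: (side_le ltr01 N0N).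
  have fy := Hd y (AO _ Ay); have fz := Hd z (AO _ Az).
  have : `|f y - f x| < e / 2 by apply: fy => i; apply: lt_trans (yx i) _; lra.
  have : `|f z - f x| < e / 2.
    apply: fz => i; have := yx i; have := le_trans (yz i) N1.
    by rewrite ler_norml !ltr_norml; lra.
  by rewrite ler_norml !ltr_norml; lra.
move=> [N _ /(_ N (leqnn N)) H]; exists (2 ^+ N)^-1; first by rewrite invr_gt0 exprn_gt0.
by move=> x y Ax Ay; exact: H.
Qed.

Lemma compact_cube (D : R) m (a : Z) : compact (cube D m a).
Proof.
have -> : cube D m a = [set v : V | forall i, `[side D m * (a ord0 i)%:~R, side D m * (a ord0 i + 1)%:~R]%classic (v ord0 i)].
  by apply/seteqP; split => x H i; have := H i; rewrite /= in_itv.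
by apply: (@rV_compact R n (fun i => `[side D m * (a ord0 i)%:~R, side D m * (a ord0 i + 1)%:~R]%classic)) => i; exact: segment_compact.
Qed.

Section u.
Variables (Omega : set V) (u : V -> R).
Hypothesis Oopen : eopen Omega.
Hypothesis uC1 : C1_on Omega u.

Lemma is_derive_line x i t : Omega (x + t *: ebasis i) ->
  is_derive t 1 (fun r : R => u (x + r *: ebasis i)) (partial u i (x + t *: ebasis i)).
Proof.
move=> Ox; have [] := uC1 Ox i.
rewrite /partial_derivable /derivable => d1 _.
have E : (fun h : R => h^-1 *: ((u (x + (h *: 1 + t) *: ebasis i)) - u (x + t *: ebasis i))) =
  (fun h : R => h^-1 *: (u (x + t *: ebasis i + (h *: 1 + 0) *: ebasis i) - u (x + t *: ebasis i + 0 *: ebasis i))).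
  apply/funext => h; rewrite scale0r !addr0 -addrA -scalerDl [t + _]addrC//.
by split; rewrite /derivable /derive/= /partial ?derive1E /derive E.
Qed.

Lemma C1_slope : slope_bd n%:R u (mean_partial u) Omega.
Proof.
move=> x i h h0 H.
have [||c] := @MVT_segment R (fun r => u (x + r *: ebasis i)) (fun r => partial u i (x + r *: ebasis i)) 0 h h0.
- by move=> t; rewrite in_itv/= => /andP[a b]; apply: is_derive_line; apply: H; rewrite !ltW.
- apply: derivable_within_continuous => t; rewrite in_itv/= => tI.
  by have [] := is_derive_line (H _ tI).
rewrite in_itv/= => ch; rewrite subr0 scale0r addr0 => E; exists c => //.
by rewrite E normrM (ger0_norm h0) mulrAC; apply: ler_wpM2r => //; exact: partial_le.
Qed.

Lemma cont_onP f : cont_on Omega f <-> (forall x, Omega x -> forall e : R, 0 < e ->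
  \forall y \near x, Omega y -> `|f y - f x| < e).
Proof.
split => H x Ox e e0.
  have [d d0 Hd] := H x Ox e e0; near=> y => Oy; apply: Hd => //.
  by near: y; exact: near_coord.
have /nbhs_ballP[d d0 Hd] := H x Ox e e0; exists d => // y Oy yx; apply: Hd => //.
by split => // i j; rewrite ord1 /ball/= distrC.
Unshelve. all: by end_near. Qed.

Lemma near_open x : Omega x -> \forall y \near x, Omega y.
Proof.
move=> /Oopen[r r0 H]; have n1 : 0 < n%:R + 1 :> R by rewrite ltr_wpDl.
have d0 : 0 < r / (n%:R + 1) by rewrite divr_gt0.
near=> y; apply: H; rewrite /eball/=.
have yx : forall i, `|y ord0 i - x ord0 i| < r / (n%:R + 1) by near: y; exact: near_coord.
apply: (@le_lt_trans _ _ (n%:R * (r / (n%:R + 1)))).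
  by apply: enorm_le => i; rewrite !mxE ltW.
by rewrite mulrCA gtr_pMr// ltr_pdivrMr// mul1r ltrDl.
Unshelve. all: by end_near. Qed.

Lemma cont_mean_partial : cont_on Omega (mean_partial u).
Proof.
apply/cont_onP => x Ox e e0.
have : \forall y \near x, forall i, Omega y -> `|partial u i y - partial u i x| < e.
  apply: (@filter_forall V _ (fun i (y : V) => Omega y -> `|partial u i y - partial u i x| < e) (nbhs x) _) => i; have [_ H] := uC1 Ox i; have [d d0 Hd] := H e e0.
  have n1 : 0 < n%:R + 1 :> R by rewrite ltr_wpDl.
  have dn0 : 0 < d / (n%:R + 1) by rewrite divr_gt0.
  near=> y => Oy; apply: Hd => //.
  have yx : forall i, `|y ord0 i - x ord0 i| < d / (n%:R + 1) by near: y; exact: near_coord.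
  apply: (@le_lt_trans _ _ (n%:R * (d / (n%:R + 1)))).
    by apply: enorm_le => j; rewrite !mxE ltW.
  by rewrite mulrCA gtr_pMr// ltr_pdivrMr// mul1r ltrDl.
apply: filterS => y H Oy; rewrite /mean_partial -mulrBl -sumrB normrM.
have [n0|n0] := posnP n.
  by rewrite [_^-1](_ : _ = 0) ?normr0 ?mulr0// [n%:R](_ : _ = 0) ?invr0//; move/(congr1 (fun k => k%:R : R)): n0.
rewrite (@ger0_norm _ n%:R^-1) ?invr_ge0// ltr_pdivrMr ?ltr0n//.
apply: le_lt_trans (ler_norm_sum _ _ _) _.
apply: (@lt_le_trans _ _ (\sum_(i < n) e)); last by rewrite sumr_const card_ord mulr_natr.
apply: ltr_sum => [|i _].
  by apply/hasP; exists (Ordinal n0); rewrite ?mem_index_enum.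
apply: le_lt_trans (ler_dist_dist _ _) _; exact: H.
Unshelve. all: by end_near. Qed.

(** [C1_on] speaks of partial derivatives only, so continuity of [u] has to be derived: near [x] the
    partials are bounded, and [y] is reached from [x] along coordinate segments that stay in a small
    box. *)
Lemma cont_C1 : cont_on Omega u.
Proof.
apply/cont_onP => x Ox e e0.
have /cont_onP/(_ x Ox 1 ltr01) N1 := cont_mean_partial.
have : \forall y \near x, Omega y /\ (Omega y -> `|mean_partial u y - mean_partial u x| < 1).
  by apply: filterI => //; exact: near_open.
move=> /nbhs_ballP[r /= r0 Hr].
set B := mean_partial u x + 1; have B0 : 0 < B by rewrite ltr_wpDl// mean_partial_ge0.
(* One factor [n] counts the coordinates, the other is the slope constant of [C1_slope]; the summand
   1 makes the final inequality strict. *)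
pose c : R := n%:R * n%:R * B + 1.
have c0 : 0 < c by rewrite ltr_wpDl// !mulr_ge0// ltW.
near=> y => Oy; set d := Num.min r (e / c).
have yx : forall i, `|y ord0 i - x ord0 i| < d.
  by near: y; apply: near_coord; rewrite lt_min r0 divr_gt0.
have d0 : 0 < d by rewrite lt_min r0 divr_gt0.
pose A : set V := [set z | forall i, `|z ord0 i - x ord0 i| < d].
have AP z : A z -> Omega z /\ mean_partial u z <= B.
  move=> Az; have [|Oz] := Hr z.
    by split => // i j; rewrite ord1 /ball/= distrC (lt_le_trans (Az j))// ge_min lexx.
  by move=> /(_ Oz); rewrite ltr_norml /B => /andP[_ h]; split => //; lra.
have st z i h : 0 <= h -> A z -> A (z + h *: ebasis i) -> `|u (z + h *: ebasis i) - u z| <= n%:R * h * B.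
  move=> h0 Az Az'; have seg t : 0 <= t <= h -> A (z + t *: ebasis i).
    move=> th j; have := Az j; have := Az' j; rewrite !mxE eqxx/=; case: (j == i) => /=; rewrite ?mulr1 ?mulr0 ?addr0//.
    by rewrite !ltr_norml; lra.
  have [|t th] := @C1_slope z i h h0; first by move=> t /seg/AP[].
  move=> /le_trans; apply; apply: ler_wpM2l; first by rewrite mulr_ge0.
  by have [] := AP _ (seg t th).
pose q (t : nat) : V := \row_i (if (i < t)%N then y ord0 i else x ord0 i).
have Aq t : A (q t) by move=> i; rewrite mxE; case: ifP => _ //; rewrite subrr normr0.
have Q t : (t < n)%N -> `|u (q t.+1) - u (q t)| <= n%:R * d * B.
  move=> tn; pose i := Ordinal tn.
  have E : q t.+1 = q t + (y ord0 i - x ord0 i) *: ebasis i.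
    apply/rowP => j; rewrite !mxE eqxx/=; have [->|ji] := eqVneq j i.
      by rewrite ltnS leqnn ltnn mulr1 [RHS]addrC subrK.
    have jt : (j : nat) != t by [].
    by rewrite mulr0 addr0 ltnS leq_eqVlt (negbTE jt).
  have [h0|h0] := leP 0 (y ord0 i - x ord0 i).
    rewrite E; apply: le_trans (st _ _ _ h0 (Aq _) _) _; first by rewrite -E.
    rewrite ler_wpM2r ?(ltW B0)// ler_wpM2l//; apply: le_trans (ler_norm _) _; exact: ltW.
  (* [C1_slope] only moves in the positive direction, so a decreasing coordinate is traversed
     backwards. *)
  have E' : q t = q t.+1 + (x ord0 i - y ord0 i) *: ebasis i.
    by rewrite E -addrA -scalerDl -[x ord0 i - _]opprB subrr scale0r addr0.
  have h0' : 0 <= x ord0 i - y ord0 i by lra.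
  rewrite distrC E'; apply: le_trans (st _ _ _ h0' (Aq _) _) _; first by rewrite -E'.
  rewrite ler_wpM2r ?(ltW B0)// ler_wpM2l//; apply: le_trans (ler_norm _) _.
  by rewrite distrC; exact: ltW.
have -> : u y - u x = \sum_(0 <= t < n) (u (q t.+1) - u (q t)).
  rewrite telescope_sumr//; congr (u _ - u _); apply/rowP => i; rewrite mxE//.
  by rewrite ltn_ord.
apply: le_lt_trans (ler_norm_sum _ _ _) _; rewrite big_mkord.
apply: (@le_lt_trans _ _ (n%:R * (n%:R * d * B))).
  by apply: sum_le_card => i; exact: Q.
apply: (@lt_le_trans _ _ (c * d)).
  rewrite /c mulrDl mul1r; apply: ltr_pwDr => //.
  by rewrite !mulrA [X in X <= _]mulrAC.
by rewrite mulrC -ler_pdivlMr// ge_min lexx orbT.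
Unshelve. all: by end_near. Qed.

End u.
End C1.

(** * John curves *)

Section John.
Context {R : realType} {n : nat}.
Local Notation V := 'rV[R]_n.

Lemma enormZ (a : R) (v : V) : enorm (a *: v) = `|a| * enorm v.
Proof.
rewrite /enorm -sqrtr_sqr -sqrtrM ?sqr_ge0//; congr Num.sqrt.
by rewrite mulr_sumr; apply: eq_bigr => i _; rewrite mxE exprMn.
Qed.

Lemma enorm_ge0 (v : V) : 0 <= enorm v. Proof. exact: sqrtr_ge0. Qed.

(** Appending [t'] to any partition of the interval up to [t] gives a partition up to [t']. As the
    lengths up to [t] and [t'] are exactly [t] and [t'], the added chord is at most the
    difference. *)
Lemma curve_lip (gamma : R -> V) (L t t' : R) :
  (forall t, 0 <= t <= L -> curve_length gamma 0 t = t%:E) ->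
  0 <= t -> t <= t' -> t' <= L -> enorm (gamma t' - gamma t) <= t' - t.
Proof.
move=> H t0 tt' tL.
have E : (curve_length gamma 0 t <= (t' - enorm (gamma t' - gamma t))%:E)%E.
  apply: ge_ereal_sup => _ [k [p [p0 [pk [pm ->]]]]]; rewrite lee_fin lerBrDr -lee_fin.
  rewrite -[X in (_ <= X)%E]H ?tL ?(le_trans t0)//; apply: ereal_sup_ubound.
  exists k.+1, (fun i => if (i <= k)%N then p i else t').
  split; first by rewrite leq0n.
  split; first by rewrite ltnn.
  split.
    move=> i ik1; have : (i == k) || (i < k)%N by rewrite -leq_eqVlt -ltnS.
    move=> /orP[/eqP->|ik]; first by rewrite /= leqnn ltnn pk.
    by rewrite /= ik (ltnW ik); exact: pm.
  congr EFin; rewrite big_ord_recr/= leqnn ltnn pk; congr (_ + _).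
  by apply: eq_bigr => i _; rewrite ltn_ord ltnW.
by move: E; rewrite H ?t0 ?(le_trans tt')// lee_fin; lra.
Qed.

(** If the ball contained a point [y] outside the domain, the first exit point of the segment from
    [x] to [y] would be a boundary point at distance less than [r]. Openness puts the infimum [T]
    itself outside the domain. *)
Lemma dist_boundary (Omega : set V) x (r : R) : eopen Omega -> Omega x ->
  (r%:E <= Defs.edist x (eboundary Omega))%E -> eball x r `<=` Omega.
Proof.
move=> Oo Ox rx y yr; apply: contrapT => Oy.
pose z (t : R) := x + t *: (y - x).
pose S := [set t : R | 0 <= t <= 1 /\ ~ Omega (z t)].
have S1 : S 1 by split; rewrite ?ler01 ?lexx// /z scale1r addrC subrK.
have Slb : lbound S 0 by move=> t [/andP[]].
have iS : has_inf S by split; [exists 1|exists 0].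
pose T := inf S.
have T0 : 0 <= T by apply: lb_le_inf => //; exists 1.
have T1 : T <= 1 by apply: ge_inf => //; exists 0.
have ST t : 0 <= t -> t < T -> Omega (z t).
  move=> t0 tT; apply: contrapT => Oz; suff : T <= t by lra.
  apply: ge_inf; first by exists 0.
  by split=> //; rewrite t0/=; lra.
have zz t t' : enorm (z t' - z t) = `|t' - t| * enorm (y - x).
  by rewrite -enormZ /z opprD addrACA subrr add0r -scalerBl.
have e1 : 0 < enorm (y - x) + 1 by rewrite ltr_wpDl// enorm_ge0.
have far e : 0 < e -> e / (enorm (y - x) + 1) * enorm (y - x) < e.
  move=> e0; rewrite mulrAC ltr_pdivrMr// ltr_pM2l//; lra.
have OzT : ~ Omega (z T).
  move=> /Oo[e e0 He].
  have [t [[/andP[t0 t1] Ot] tT]] := inf_adherent (divr_gt0 e0 e1) iS.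
  have Tt : T <= t by apply: ge_inf; [exists 0|split => //; apply/andP].
  apply: Ot; apply: He; rewrite /eball/= zz.
  rewrite ger0_norm ?subr_ge0//; apply: le_lt_trans (far _ e0).
  by apply: ler_wpM2r; rewrite ?enorm_ge0//; rewrite -/T in tT; lra.
have Tp : 0 < T.
  rewrite lt_neqAle T0 andbT; apply/eqP => T0'; apply: OzT.
  by rewrite -T0' /z scale0r addr0.
have bT : eboundary Omega (z T).
  move=> e e0; split; last by exists (z T); rewrite zz subrr normr0 mul0r.
  pose d := Num.min (T / 2) (e / (enorm (y - x) + 1)).
  have d0 : 0 < d by rewrite lt_min !divr_gt0.
  have dT : d <= T / 2 by rewrite ge_min lexx.
  exists (z (T - d)); split; first by apply: ST; lra.
  rewrite zz addrAC subrr add0r normrN gtr0_norm//.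
  apply: le_lt_trans (far _ e0); apply: ler_wpM2r; first exact: enorm_ge0.
  by rewrite ge_min lexx orbT.
have rz : (r%:E <= (enorm (x - z T))%:E)%E.
  by apply: (le_trans rx); apply: ereal_inf_lbound; exists (z T).
move: rz; rewrite lee_fin leNgt => /negP; apply.
have E : x - z T = (- T) *: (y - x).
  by apply/rowP => i; rewrite /z !mxE; ring.
rewrite E.
rewrite enormZ normrN ger0_norm//; apply: le_lt_trans yr.
by rewrite ler_piMl// enorm_ge0.
Qed.

(* The curve from [x] is prolonged by the constant [x0], so that all curves are
   defined on the same interval; the constant [c] absorbs the distance of [x0] to the
   boundary. *)
Lemma john_curve (s : R) (Omega : set V) : 0 <= s -> s_john s Omega ->
  exists (D c : R) (x0 : V), [/\ 0 < D, 0 < c, Omega x0 &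
   forall x, Omega x -> exists gamma : R -> V, [/\ gamma 0 = x, gamma D = x0,
     (forall t t', 0 <= t -> t <= t' -> t' <= D -> enorm (gamma t' - gamma t) <= t' - t) &
     (forall t, 0 <= t <= D -> Omega (gamma t) /\ eball (gamma t) (c * t `^ s) `<=` Omega)]].
Proof.
move=> s0 [[Oo _] [cJ [CJ [x0 [cJ0 [CJ0 [Ox0 H]]]]]]].
have [r r0 Hr] := Oo _ Ox0.
have Ds : 0 < CJ `^ s by rewrite powR_gt0.
pose c := Num.min cJ (r / CJ `^ s).
have c0 : 0 < c by rewrite lt_min cJ0 divr_gt0.
exists CJ, c, x0; split => // x /H[g [L [L0 [LC [g0 [gL [_ [len [gO gd]]]]]]]]].
have gO' t : 0 <= t <= L -> Omega (g t) by exact: gO.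
exists (fun t => g (Num.min t L)); split.
- by rewrite min_l.
- by rewrite min_r.
- move=> t t' t0 tt' tC; apply: (@le_trans _ _ (Num.min t' L - Num.min t L)).
    apply: (curve_lip len); first by rewrite le_min t0.
      by rewrite le_min ge_min tt' ge_min lexx orbT.
    by rewrite ge_min lexx orbT.
  by rewrite /Num.min; case: ltP => ?; case: ltP => ?; lra.
move=> t /andP[t0 tC]; have [tL|tL] := leP t L.
  have tl : 0 <= t <= L by rewrite t0.
  split; first exact: gO.
  apply: dist_boundary => //; first exact: gO.
  apply: le_trans (gd t tl); rewrite lee_fin ler_wpM2r ?powR_ge0// ge_min lexx//.
(* On the constant part the radius [c * t ^ s] is at most [r], because [c <= r / CJ ^ s] and
   [t <= CJ]. *)
rewrite gL; split => // y; rewrite /eball/= => yx; apply: Hr; apply: lt_le_trans yx _.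
apply: (@le_trans _ _ (r / CJ `^ s * CJ `^ s)); last by rewrite divfK// gt_eqF.
apply: ler_pM; rewrite ?powR_ge0 ?(ltW c0)//; first by rewrite ge_min lexx orbT.
by rewrite ge0_ler_powR// nnegrE// ltW.
Qed.

End John.

(** * The pointwise estimate *)

Section Pointwise.
Context {R : realType} {n : nat}.
Local Notation V := 'rV[R]_n.
Local Notation Z := 'rV[int]_n.
Variable D : R.
Hypothesis D0 : 0 < D.
Hypothesis n0 : (0 < n)%N.

Lemma sideS m : side D m = 2 * side D m.+1.
Proof. by rewrite (sideD D m 1) addn1 expr1 mulrC. Qed.

Lemma idx_bounds m (y : V) i :
  side D m * (idx D m y ord0 i)%:~R <= y ord0 i < side D m * (idx D m y ord0 i + 1)%:~R.
Proof. by have [H _] := idxP m y (idx D m y) D0; exact: H. Qed.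

Lemma idx_child m (y : V) : idx D m.+1 y \in box (2%:Z *: idx D m y) 2.
Proof.
rewrite mem_box; apply/forallP => i; have s0 := side_gt0 m.+1 D0.
have := idx_bounds m y i.
have := idx_bounds m.+1 y i.
rewrite (sideS m) [fun_of_matrix (_ *: _) _ _]mxE.
move: (idx D m y ord0 i) (idx D m.+1 y ord0 i) => a c /andP[C E0] /andP[A B].
have K (x z : int) : side D m.+1 * x%:~R < side D m.+1 * z%:~R -> x < z by rewrite ltr_pM2l// ltr_int.
have : 2%:Z * a < c + 1.
  by apply: K; apply: le_lt_trans E0; rewrite intrM mulrA [side _ _ * _]mulrC.
have : c < 2%:Z * (a + 1).
  by apply: K; apply: (le_lt_trans C); rewrite intrM mulrA [side _ _ * _%:~R]mulrC.
by clear; lia.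
Qed.

Lemma intrD1 (x : R) (p : int) : x * (p + 1)%:~R = x * p%:~R + x.
Proof. by rewrite intrD mulrDr mulr1. Qed.

Lemma intrD2 (x : R) (p : int) : x * (p + 2%:Z)%:~R = x * p%:~R + 2 * x.
Proof. by rewrite intrD mulrDr [x * 2%:~R]mulrC. Qed.

Lemma neighbor_cube m (y z : V) (b : Z) : neighbor (idx D m y) b -> cube D m b z ->
  forall i, `|z ord0 i - y ord0 i| <= 2 * side D m.
Proof.
move=> /forallP H unit_vec i; have := idx_bounds m y i.
have s0 := side_gt0 m D0.
have := unit_vec i; have := H i; move: (idx D m y ord0 i) (b ord0 i) => x t xt /andP[A B] /andP[C E].
have K (p q : int) : p <= q -> side D m * p%:~R <= side D m * q%:~R by rewrite ler_pM2l// ler_int.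
have K1 : t + 1 <= x + 2%:Z by move: xt; clear; lia.
have K2 : x + 1 <= t + 2%:Z by move: xt; clear; lia.
have := K _ _ K1; have := K _ _ K2; rewrite ler_norml.
rewrite !intrD2 !intrD1 in A B C E * => K3 K4.
by apply/andP; split; lra.
Qed.

Lemma idx_near m (y z : V) : (forall i, `|y ord0 i - z ord0 i| <= side D m) ->
  neighbor (idx D m y) (idx D m z).
Proof.
move=> H; apply/forallP => i; have s0 := side_gt0 m D0.
have := idx_bounds m y i.
have := idx_bounds m z i.
have := H i; move: (idx D m y ord0 i) (idx D m z ord0 i) => a b.
rewrite ler_norml !intrD1 => /andP[h1 h2] /andP[C E] /andP[A B].
have K (x t : int) : side D m * x%:~R < side D m * t%:~R -> x < t by rewrite ltr_pM2l// ltr_int.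
have : a < b + 2%:Z.
  by apply: K; rewrite intrD2; lra.
have : b < a + 2%:Z.
  by apply: K; rewrite intrD2; lra.
by clear; lia.
Qed.

Section u.
Variables (Omega : set V) (u : V -> R).
Hypothesis Oopen : eopen Omega.
Hypothesis uC1 : C1_on Omega u.

Lemma ucont_cube f m (b : Z) : cont_on Omega f -> cube D m b `<=` Omega -> unif_cont_on f (cube D m b).
Proof. by move=> cf bO; apply: cont_on_ucont bO cf; exact: compact_cube. Qed.

Lemma avg_mean_partial_ge0 m (b : Z) : cube D m b `<=` Omega -> 0 <= cube_avg D (mean_partial u) m b.
Proof.
by move=> bO; apply: cube_avg_ge0 => //; [exact: ucont_cube (cont_mean_partial uC1) bO|exact: mean_partial_ge0].
Qed.

Lemma avg_step m (a : Z) i : cube D m a `<=` Omega -> cube D m (a + unit_vec i) `<=` Omega ->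
  `|cube_avg D u m (a + unit_vec i) - cube_avg D u m a| <=
    (n%:R * side D m) * (cube_avg D (mean_partial u) m a + cube_avg D (mean_partial u) m (a + unit_vec i)).
Proof.
move=> aO aO'.
have cA : compact (cube D m a `|` cube D m (a + unit_vec i)) by apply: compactU; exact: compact_cube.
have AO : cube D m a `|` cube D m (a + unit_vec i) `<=` Omega by move=> x [/aO|/aO'].
apply: poincare_step => //; first exact: mean_partial_ge0.
- exact: cont_on_ucont cA AO (cont_C1 Oopen uC1).
- exact: cont_on_ucont cA AO (cont_mean_partial uC1).
by move=> x j h h0 H; apply: (C1_slope uC1) => // t /H; exact: AO.
Qed.

(** The parent's average is the mean over its [2 ^ n] children, and any two children are neighbours,
    so [neighbor_step] bounds each difference. *)
Lemma avg_parent m (y : V) : cube D m (idx D m y) `<=` Omega ->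
  (forall b, neighbor (idx D m.+1 y) b -> cube D m.+1 b `<=` Omega) ->
  `|cube_avg D u m.+1 (idx D m.+1 y) - cube_avg D u m (idx D m y)| <=
    2 * n%:R * (n%:R * side D m.+1) * \sum_(v <- offsets) cube_avg D (mean_partial u) m.+1 (idx D m.+1 y + v).
Proof.
move=> aO bO; set c := idx D m.+1 y; set a := idx D m y; set X := leRHS.
rewrite (cube_avg_split D0 (ucont_cube (cont_C1 Oopen uC1) aO)) -/a.
have cb : c \in box (2%:Z *: a) 2 by exact: idx_child.
have p0 : 0 < (2 ^ n)%:R :> R by rewrite ltr0n expn_gt0.
have -> : cube_avg D u m.+1 c - (2 ^ n)%:R^-1 * \sum_(c0 <- box (2%:Z *: a) 2) cube_avg D u m.+1 c0 =
  (2 ^ n)%:R^-1 * \sum_(c0 <- box (2%:Z *: a) 2) (cube_avg D u m.+1 c - cube_avg D u m.+1 c0).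
  rewrite sumrB big_const_seq count_predT size_box iter_addr_0 mulrBr -[cube_avg D u m.+1 c *+ _]mulr_natl.
  by rewrite mulKf// lt0r_neq0.
rewrite normrM gtr0_norm ?invr_gt0// ler_pdivrMl//.
apply: le_trans (ler_norm_sum _ _ _) _.
rewrite [leRHS]mulr_natl -(size_box (2%:Z *: a)) -iter_addr_0 -count_predT -big_const_seq.
rewrite !big_seq; apply: ler_sum => c' cb'.
apply: (@neighbor_step _ _ _ _ (fun b => cube D m.+1 b `<=` Omega)) => //.
- by rewrite mulr_ge0// ltW// side_gt0.
- exact: avg_mean_partial_ge0.
- by move=> *; exact: avg_step.
move: cb cb'; rewrite !mem_box => /forallP H /forallP H'; apply/forallP => i.
by have := H i; have := H' i; rewrite !mxE; move: (c ord0 i) (c' ord0 i) (Num.floor _) => p q r; clear; lia.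
Qed.

End u.
End Pointwise.

(** * Choice of cube levels along a John curve *)

Section Scales.
Context {R : realType}.
Variables (n : nat) (D c s : R).
Hypotheses (D0 : 0 < D) (n0 : (0 < n)%N) (c0 : 0 < c) (s1 : 1 <= s).

Lemma side_powRS m a : side D m.+1 `^ a = 2 `^ (- a) * side D m `^ a.
Proof.
have s0 := side_gt0 m.+1 D0.
rewrite (sideS D m) powRM ?(ltW s0)// mulrA -powRD ?addNr ?powRr0 ?mul1r//.
by apply/implyP => _; rewrite pnatr_eq0.
Qed.

(* [mj j] is the coarsest admissible level of cubes along the part of a curve whose
   distance to its starting point is about [side D j]; their side is comparable to
   [side D j `^ s]. *)
Lemma john_scales : exists (mj : nat -> nat) (k : R) (B : nat), [/\ 0 < k,
  forall j, (j < mj j)%N, forall j, 2 * n%:R * side D (mj j) < c * side D j.+1 `^ s,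
  forall j, k * side D j `^ s <= side D (mj j.+1) &
  forall j, (mj j <= mj j.+1)%N /\ (mj j.+1 - mj j <= B)%N].
Proof.
have n0' : 0 < n%:R :> R by rewrite ltr0n.
pose P j m := (j < m)%N && (2 * n%:R * side D m < c * side D j.+1 `^ s).
have exP j : exists m, P j m.
  have d0 : 0 < c * side D j.+1 `^ s / (2 * n%:R) / 2.
    by rewrite !divr_gt0// ?mulr_gt0// powR_gt0// side_gt0.
  have [m Hm] := side_small D d0; exists (maxn m j.+1); rewrite /P leq_maxr/=.
  rewrite mulrC -ltr_pdivlMr ?mulr_gt0//; apply: (@le_lt_trans _ _ (side D m)).
    by apply: side_le => //; exact: leq_maxl.
  apply: (le_lt_trans Hm); rewrite ltr_pdivrMr// ltr_pMr ?ltr1n// divr_gt0// ?mulr_gt0//.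
  by rewrite powR_gt0// side_gt0.
pose mj j := ex_minn (exP j).
have mjP j : P j (mj j) by rewrite /mj; case: ex_minnP.
have mj_min j m : P j m -> (mj j <= m)%N by rewrite /mj; case: ex_minnP => m' _; exact.
have side_s j : 0 < side D j `^ s by rewrite powR_gt0// side_gt0.
(* One constant for each reason why [mj j] cannot be coarser. If [mj j = j + 1], then
   [side D j ^ s <= D ^ (s - 1) * side D j] is used; otherwise level [mj j - 1] violates the
   smallness condition, and [2 ^ (- s)] converts scale [j + 1] into scale [j]. *)
pose k0 := Num.min ((2 * D `^ (s - 1))^-1) (c * 2 `^ (- s) / (4 * n%:R)).
have k00 : 0 < k0.
  by rewrite lt_min invr_gt0 mulr_gt0 ?powR_gt0//= divr_gt0 ?mulr_gt0 ?powR_gt0.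
have low j : k0 * side D j `^ s <= side D (mj j).
  have /andP[jm H] := mjP j.
  case E : (mj j) jm H => [//|m]; rewrite ltnS leq_eqVlt => /orP[/eqP <-|jm] H.
    apply: (@le_trans _ _ ((2 * D `^ (s - 1))^-1 * side D j `^ s)).
      by rewrite ler_wpM2r ?powR_ge0// ge_min lexx.
    have sj := side_gt0 j D0.
    have -> : side D j `^ s = side D j * side D j `^ (s - 1).
      by rewrite -{2}[side D j]powRr1 ?(ltW sj)// -powRD ?[1 + _]addrC ?subrK//; apply/implyP => _; rewrite gt_eqF.
    have : side D j `^ (s - 1) <= D `^ (s - 1).
      apply: ge0_ler_powR; rewrite ?subr_ge0// ?nnegrE ?(ltW sj) ?(ltW D0)//.
      by have := side_le D0 (leq0n j); rewrite {2}/side expr0 divr1.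
    have : 0 < D `^ (s - 1) by rewrite powR_gt0.
    have := sideS D j; move: (side D j) sj (side D j.+1) (side D j `^ (s - 1)) (D `^ (s - 1)) => x x0 y z w xE w0 zw.
    rewrite ler_pdivrMl ?mulr_gt0//.
    have y0 : 0 < y by lra.
    have : y * z <= y * w by rewrite ler_pM2l.
    by rewrite xE; lra.
  have nP : ~ P j m by move=> /mj_min; rewrite E ltnn.
  have : c * side D j.+1 `^ s <= 2 * n%:R * side D m.
    by rewrite leNgt; apply/negP => h; apply: nP; rewrite /P jm h.
  rewrite side_powRS (sideS D m) => h.
  apply: (@le_trans _ _ (c * 2 `^ (- s) / (4 * n%:R) * side D j `^ s)).
    by rewrite ler_wpM2r ?powR_ge0// ge_min lexx orbT.
  rewrite mulrAC ler_pdivrMr ?mulr_gt0//; move: h; rewrite mulrA; lra.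
have k1 j : (k0 * 2 `^ (- s)) * side D j `^ s <= side D (mj j.+1).
  by rewrite -mulrA -side_powRS; exact: low.
(* The quotient of the upper bound for [side D (mj j)] by the lower bound for [side D (mj j.+1)]. It
   bounds [2 ^ d] for the level difference [d], and [d < 2 ^ d]. *)
pose K := c / (2 * n%:R) / (k0 * 2 `^ (- s)).
exists mj, (k0 * 2 `^ (- s)), (Num.trunc K).+1; split => //.
- by rewrite mulr_gt0// powR_gt0.
- by move=> j; have /andP[] := mjP j.
- by move=> j; have /andP[] := mjP j.
move=> j; have mono : (mj j <= mj j.+1)%N.
  apply: mj_min; have /andP[jm H] := mjP j.+1; rewrite /P (ltn_trans _ jm)//=.
  apply: (lt_le_trans H); rewrite ler_pM2l//; apply: ge0_ler_powR; rewrite ?nnegrE ?(ltW (side_gt0 _ D0))//.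
    by apply: le_trans s1.
  exact: side_le.
split => //; set d := (_ - _)%N.
have Ed : side D (mj j) = side D (mj j.+1) * 2 ^+ d by rewrite (sideD D _ d) /d subnKC.
have /andP[_ H] := mjP j.
have : 2 ^+ d <= K.
  have := k1 j; have := side_s j; move: H; rewrite Ed /K.
  have : side D j.+1 `^ s <= side D j `^ s.
    apply: ge0_ler_powR; rewrite ?nnegrE ?(ltW (side_gt0 _ D0))//.
      by apply: le_trans s1.
    exact: side_le.
  have : 0 < k0 * 2 `^ (- s) by rewrite mulr_gt0// powR_gt0.
  have := side_gt0 (mj j.+1) D0.
  have : 0 < 2 ^+ d :> R by rewrite exprn_gt0.
  move: (2 ^+ d) (side D (mj j.+1)) (k0 * _) (side D j.+1 `^ s) (side D j `^ s) => e S k x y e0 S0 kk xy H1 y0 H2.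
  rewrite ler_pdivlMr// ler_pdivlMr ?mulr_gt0//.
  have h1 : 2 * n%:R * (S * e) < c * y by apply: lt_le_trans H1 _; rewrite ler_pM2l.
  rewrite -(ler_pM2r y0); apply: le_trans (ltW h1).
  have -> : e * k * (2 * n%:R) * y = 2 * n%:R * ((k * y) * e) by ring.
  by rewrite ler_pM2l ?mulr_gt0// ler_pM2r.
move=> dK; have : (d%:R < 2 ^+ d :> R) by rewrite -natrX ltr_nat ltn_expl.
move=> /lt_le_trans /(_ dK) dK'; have := lt_trans dK' (truncnS_gt K).
by rewrite ltr_nat; exact: ltnW.
Qed.

End Scales.

(** * Differences of averages along one John curve *)

Section JohnChain.
Context {R : realType} {n : nat}.
Local Notation V := 'rV[R]_n.
Local Notation Z := 'rV[int]_n.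

(** The factor 3 is 1 for the distance travelled along the curve plus 2 for a neighbour of the
    current cube, whose level is at least [j]. *)
Definition admissible (D : R) (Omega : set V) (j : nat) (x : V) (m : nat) (b : Z) : Prop :=
  cube D m b `<=` Omega /\
  (forall y, cube D m b y -> forall i, `|y ord0 i - x ord0 i| <= 3 * side D j).

(* The average of [mean_partial u] over the part of [Omega] near [x] at scale
   [side D j] is at most [X]; that integral is replaced by sums over families of
   distinct cubes contained in [Omega]. *)
Definition avg_bound (D : R) (Omega : set V) (u : V -> R) (j : nat) (x : V) (X : R) : Prop :=
  forall m (l : seq Z), uniq l -> (forall b, b \in l -> admissible D Omega j x m b) ->
    side D m ^+ n * \sum_(b <- l) cube_avg D (mean_partial u) m b <= side D j ^+ n * X.

Variables (D c s : R) (Omega : set V).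
Hypotheses (D0 : 0 < D) (n0 : (0 < n)%N) (c0 : 0 < c) (s1 : 1 <= s).
Hypothesis Oopen : eopen Omega.
Let alpha := n%:R + s * (1 - n%:R).

(** The origin of [alpha]: the Poincare estimate carries one power of the cube side, whereas
    [avg_bound] controls [n] powers. Dividing by the missing [n - 1] powers, each at least
    [k * side D j ^ s], leaves [side D j] to the power n - s(n-1). *)
Lemma avg_bound_cost u k m j x X (l : seq Z) : 0 < k -> avg_bound D Omega u j x X ->
  k * side D j `^ s <= side D m -> uniq l -> (forall b, b \in l -> admissible D Omega j x m b) -> 0 <= X ->
  side D m * \sum_(b <- l) cube_avg D (mean_partial u) m b <= (k ^+ n.-1)^-1 * (side D j `^ alpha * X).
Proof.
move=> k0 H kj ul al X0; have := H m l ul al.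
have sj := side_gt0 j D0; have sm := side_gt0 m D0.
have E : side D j ^+ n = side D j `^ alpha * (side D j `^ s) ^+ n.-1.
  rewrite -[(side D j `^ s) ^+ _]powR_mulrn ?powR_ge0// -powRrM -powRD; last by apply/implyP => _; rewrite gt_eqF.
  rewrite -powR_mulrn ?(ltW sj)//; congr (_ `^ _).
  have -> : n.-1%:R = n%:R - 1 :> R by rewrite -subn1 natrB.
  by rewrite /alpha; ring.
rewrite E -[in X in side D m ^+ X * _](prednK n0) exprSr.
move: (\sum_(b <- l) _) => S HS.
have kn : 0 < k ^+ n.-1 by rewrite exprn_gt0.
have smn : 0 < side D m ^+ n.-1 by rewrite exprn_gt0.
have le1 : k ^+ n.-1 * (side D j `^ s) ^+ n.-1 <= side D m ^+ n.-1.
  rewrite -exprMn; apply: lerXn2r; rewrite ?nnegrE ?(ltW sm)//.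
  by rewrite mulr_ge0 ?powR_ge0 ?ltW.
rewrite ler_pdivlMl// -(ler_pM2r smn).
have -> : k ^+ n.-1 * (side D m * S) * side D m ^+ n.-1 = k ^+ n.-1 * (side D m ^+ n.-1 * side D m * S) by ring.
apply: (@le_trans _ _ (k ^+ n.-1 * (side D j `^ alpha * (side D j `^ s) ^+ n.-1 * X))).
  by rewrite ler_pM2l.
have -> : k ^+ n.-1 * (side D j `^ alpha * (side D j `^ s) ^+ n.-1 * X) =
  side D j `^ alpha * X * (k ^+ n.-1 * (side D j `^ s) ^+ n.-1) by ring.
by apply: ler_wpM2l => //; rewrite mulr_ge0 ?powR_ge0.
Qed.

Variables (x : V) (g : R -> V).
Hypothesis g0 : g 0 = x.
Hypothesis glip : forall t t', 0 <= t -> t <= t' -> t' <= D -> enorm (g t' - g t) <= t' - t.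
Hypothesis gball : forall t, 0 <= t <= D -> Omega (g t) /\ eball (g t) (c * t `^ s) `<=` Omega.

Lemma side_leD j : side D j <= D.
Proof. by have := side_le D0 (leq0n j); rewrite {2}/side expr0 divr1. Qed.

Lemma g_coord t t' i : 0 <= t -> t <= t' -> t' <= D -> `|g t' ord0 i - g t ord0 i| <= t' - t.
Proof.
move=> a b d; apply: le_trans (glip a b d).
by have := enorm_coord (g t' - g t) i; rewrite !mxE.
Qed.

Lemma neighbor_admissible j m t b : (j <= m)%N -> 0 <= t <= side D j -> 2 * n%:R * side D m < c * t `^ s ->
  neighbor (idx D m (g t)) b -> admissible D Omega j x m b.
Proof.
move=> jm /andP[t0 tj] H nbb.
have tD : t <= D := le_trans tj (side_leD j).
split => [z unit_vec|z unit_vec i].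
  have [_] := gball (introT andP (conj t0 tD)); apply; rewrite /eball/=; apply: le_lt_trans H.
  rewrite -mulrA mulrCA; apply: enorm_le => i; rewrite !mxE.
  exact: (neighbor_cube D0 nbb unit_vec i).
have h1 := neighbor_cube D0 nbb unit_vec i; have h2 := g_coord i (lexx 0) t0 tD.
have h3 := side_le D0 jm; rewrite g0 subr0 in h2.
rewrite -(subrKA (g t ord0 i)); apply: le_trans (ler_normD _ _) _; lra.
Qed.

Variable u : V -> R.
Hypothesis uC1 : C1_on Omega u.

Let CC : R := 2 * n%:R * n%:R * (3 ^ n)%:R.

(** For a fixed offset the translated cubes are still distinct, so [avg_bound] applies once per
    offset; this is the factor [3 ^ n]. *)
Lemma offset_cost k m j X (l : seq Z) : 0 < k -> avg_bound D Omega u j x X -> 0 <= X ->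
  k * side D j `^ s <= side D m -> uniq l ->
  (forall a b, a \in l -> neighbor a b -> admissible D Omega j x m b) ->
  2 * n%:R * (n%:R * side D m) * \sum_(a <- l) \sum_(v <- offsets) cube_avg D (mean_partial u) m (a + v) <=
    CC * (k ^+ n.-1)^-1 * (side D j `^ alpha * X).
Proof.
move=> k0 H X0 kj ul al; rewrite exchange_big/=.
have K v : v \in offsets -> side D m * \sum_(a <- l) cube_avg D (mean_partial u) m (a + v) <=
    (k ^+ n.-1)^-1 * (side D j `^ alpha * X).
  move=> vo; rewrite -(big_map (fun a => a + v) xpredT (fun b => cube_avg D (mean_partial u) m b)).
  apply: (avg_bound_cost k0 H kj _ _ X0); first by rewrite map_inj_uniq//; exact: addIr.
  by move=> b /mapP[a la ->]; apply: (al a) => //; exact: offset_neighbor.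
have -> : 2 * n%:R * (n%:R * side D m) * \sum_(v <- offsets) \sum_(a <- l) cube_avg D (mean_partial u) m (a + v) =
  2 * n%:R * n%:R * \sum_(v <- offsets) (side D m * \sum_(a <- l) cube_avg D (mean_partial u) m (a + v)).
  by rewrite -mulr_sumr; ring.
rewrite /CC -!mulrA; do 3! (apply: ler_wpM2l; first by []).
rewrite [leRHS]mulr_natl -(size_box (const_mx (-1) : Z) 3) -iter_addr_0 -count_predT -big_const_seq.
by rewrite -/offsets !big_seq; apply: ler_sum.
Qed.

(** The curve is sampled at parameter steps equal to the cube side; being 1-Lipschitz, it visits
    neighbouring cubes at consecutive samples. *)
Lemma john_piece k m j X : 0 < k -> avg_bound D Omega u j x X -> 0 <= X ->
  k * side D j `^ s <= side D m -> (j < m)%N -> 2 * n%:R * side D m < c * side D j.+1 `^ s ->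
  `|cube_avg D u m (idx D m (g (side D j.+1))) - cube_avg D u m (idx D m (g (side D j)))| <=
  CC * (k ^+ n.-1)^-1 * (side D j `^ alpha * X).
Proof.
move=> k0 HX X0 kj jm H; set h := side D m; pose N := (2 ^ (m - j.+1))%N.
have hN : side D j.+1 = h * N%:R by rewrite natrX (sideD D j.+1 (m - j.+1)) subnKC.
have h0 : 0 < h := side_gt0 m D0.
have s0 : 0 <= s by apply: le_trans s1.
pose sq (i : nat) := idx D m (g (side D j.+1 + i%:R * h)).
have tb i : (i <= N)%N -> side D j.+1 <= side D j.+1 + i%:R * h <= side D j.
  move=> iN; have ih : 0 <= i%:R * h by apply: mulr_ge0 => //; exact: ltW.
  have hS := sideS D j; have ihN : i%:R * h <= h * N%:R by rewrite mulrC ler_pM2l// ler_nat.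
  by apply/andP; split; lra.
have sj1 := side_gt0 j.+1 D0.
have Hadm i b : (i <= N)%N -> neighbor (sq i) b -> admissible D Omega j x m b.
  move=> /tb /andP[t1 t2]; apply: neighbor_admissible; [exact: ltnW|by rewrite t2 andbT; lra|].
  apply: (lt_le_trans H); rewrite ler_pM2l//; apply: ge0_ler_powR; rewrite ?nnegrE//; lra.
have K0 : 0 <= n%:R * h by apply: mulr_ge0 => //; exact: ltW.
have I0 b : cube D m b `<=` Omega -> 0 <= cube_avg D (mean_partial u) m b by exact: avg_mean_partial_ge0.
have st a i : cube D m a `<=` Omega -> cube D m (a + unit_vec i) `<=` Omega ->
    `|cube_avg D u m (a + unit_vec i) - cube_avg D u m a| <= (n%:R * h) * (cube_avg D (mean_partial u) m a + cube_avg D (mean_partial u) m (a + unit_vec i)).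
  by move=> aO aO'; exact: (avg_step D0 Oopen uC1 aO aO').
have sn i : (i < N)%N -> neighbor (sq i) (sq i.+1).
  move=> iN; apply: idx_near => // i'; rewrite distrC.
  have /andP[a1 a2] := tb _ (ltnW iN); have /andP[b1 b2] := tb _ iN.
  have b3 := le_trans b2 (side_leD j).
  apply: le_trans (g_coord i' _ _ _) _ => //; first by lra.
    by rewrite lerD2l ler_pM2r// ler_nat.
  by rewrite opprD addrACA subrr add0r -mulrBl -natrB// subSnn mul1r.
have sP i b : (i <= N)%N -> neighbor (sq i) b -> cube D m b `<=` Omega.
  by move=> iN ib; have [] := Hadm i b iN ib.
have [l [ul lN hl]] := chain_step K0 I0 st sn sP.
have -> : g (side D j.+1) = g (side D j.+1 + 0%:R * h) by rewrite mul0r addr0.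
have -> : g (side D j) = g (side D j.+1 + N%:R * h).
  by rewrite [N%:R * h]mulrC -hN (sideS D j); congr g; ring.
apply: (le_trans hl); apply: offset_cost => // a b /lN[i iN ->]; exact: Hadm.
Qed.

(** The walks on two consecutive scales use cubes of different levels; this is the cost of refining
    by one level at the point of the curve where they meet. *)
Lemma scale_transfer k m j X : 0 < k -> avg_bound D Omega u j x X -> 0 <= X -> (j <= m)%N ->
  k * side D j `^ s <= side D m.+1 -> 2 * n%:R * side D m < c * side D j.+1 `^ s ->
  `|cube_avg D u m.+1 (idx D m.+1 (g (side D j.+1))) - cube_avg D u m (idx D m (g (side D j.+1)))| <=
  CC * (k ^+ n.-1)^-1 * (side D j `^ alpha * X).
Proof.
move=> k0 HX X0 jm kj H; set y := g _.
have tj : 0 <= side D j.+1 <= side D j by rewrite ltW ?side_gt0//= side_le.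
have a0 b : neighbor (idx D m y) b -> admissible D Omega j x m b by exact: neighbor_admissible.
have H' : 2 * n%:R * side D m.+1 < c * side D j.+1 `^ s.
  by apply: le_lt_trans H; rewrite ler_wpM2l// side_le.
have a1 b : neighbor (idx D m.+1 y) b -> admissible D Omega j x m.+1 b by apply: neighbor_admissible => //; exact: leqW.
apply: le_trans (avg_parent D0 Oopen uC1 _ _) _ => //.
- by have [] := a0 _ (neighbor_refl _).
- by move=> b /a1[].
rewrite -(big_seq1 (GRing.add) (idx D m.+1 y) (fun a => \sum_(v <- offsets) cube_avg D (mean_partial u) m.+1 (a + v))).
by apply: offset_cost => // a b; rewrite mem_seq1 => /eqP ->; exact: a1.
Qed.

End JohnChain.

(** * Summation over the scales *)

Section PointwiseMain.
Context {R : realType} {n : nat}.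
Local Notation V := 'rV[R]_n.
Local Notation Z := 'rV[int]_n.

(** [b u] is the average over the cube at the common endpoint of all curves, hence independent of
    [x]. The sequence [X] is left free so that the minimum of two bounds can be inserted later; [e]
    accounts for stopping at a finite scale. *)
Lemma pointwise (s : R) (Omega : set V) : (0 < n)%N -> 1 <= s -> s_john s Omega ->
  exists (D K : R) (b : (V -> R) -> R), [/\ 0 < D, 0 < K &
   forall u, C1_on Omega u -> forall x (X : nat -> R), Omega x -> (forall j, 0 <= X j) ->
     (forall j, avg_bound D Omega u j x (X j)) -> forall e, 0 < e -> exists J,
     `|u x - b u| <= e + K * \sum_(j < J) side D j `^ (n%:R + s * (1 - n%:R)) * X j].
Proof.
move=> n0 s1 HJ; have s0 : 0 <= s by apply: le_trans s1.
have Oopen : eopen Omega by case: HJ => -[].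
have [D [c [x0 [D0 c0 Ox0 H]]]] := john_curve s0 HJ.
have [mj [k [B [k0 mj1 mj2 mj3 mj4]]]] := john_scales D0 n0 c0 s1.
pose CC : R := 2 * n%:R * n%:R * (3 ^ n)%:R * (k ^+ n.-1)^-1.
have CC0 : 0 < CC.
  by rewrite /CC !mulr_gt0 ?invr_gt0 ?exprn_gt0 ?ltr0n ?expn_gt0.
(* Per scale: at most [B] refinements and one walk along the curve. *)
pose K := B.+1%:R * CC.
exists D, K, (fun u => cube_avg D u (mj 0%N) (idx D (mj 0%N) x0)); split => //.
  by rewrite mulr_gt0.
move=> u uC1 x X Ox X0 HX e e0.
have [g [g0 gD glip gball]] := H x Ox.
pose A j := cube_avg D u (mj j) (idx D (mj j) (g (side D j))).
have side_pos j := side_gt0 j D0.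
have stepj j : `|A j.+1 - A j| <= K * (side D j `^ (n%:R + s * (1 - n%:R)) * X j).
  have [mm mB] := mj4 j.
  pose Y := CC * (side D j `^ (n%:R + s * (1 - n%:R)) * X j).
  have Y0 : 0 <= Y by apply: mulr_ge0; [exact: ltW|apply: mulr_ge0; rewrite ?powR_ge0].
  pose T m := cube_avg D u m (idx D m (g (side D j.+1))).
  have k1 m : (m <= mj j.+1)%N -> k * side D j `^ s <= side D m.
    by move=> mle; apply: (le_trans (mj3 j)); exact: side_le.
  have tr m : (mj j <= m < mj j.+1)%N -> `|T m.+1 - T m| <= Y.
    move=> /andP[ma mb]; apply: (scale_transfer D0 n0 Oopen g0 glip gball uC1 k0 (HX j) (X0 j)).
    - exact: leq_trans (ltnW (mj1 j)) ma.
    - exact: k1.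
    - by apply: le_lt_trans (mj2 j); rewrite ler_wpM2l// side_le.
  have E1 : `|T (mj j.+1) - T (mj j)| <= B%:R * Y.
    rewrite -(telescope_sumr _ mm); apply: le_trans (ler_norm_sum _ _ _) _.
    rewrite big_nat; apply: le_trans (ler_sum _ (fun m h => tr m h)) _.
    rewrite -big_nat sumr_const_nat -[_ *+ _]mulr_natl ler_wpM2r// ler_nat//.
  have E2 : `|T (mj j) - A j| <= Y.
    apply: (john_piece D0 n0 c0 s1 Oopen g0 glip gball uC1 k0 (HX j) (X0 j)) => //.
    exact: k1.
  have -> : K * (side D j `^ (n%:R + s * (1 - n%:R)) * X j) = B%:R * Y + Y.
    by rewrite /K /Y -natr1; ring.
  by apply: le_trans (ler_distD (T (mj j)) _ _) _; exact: lerD.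
have [d d0 Hd] := cont_C1 Oopen uC1 Ox e0.
have [J HJd] := side_small D (divr_gt0 d0 (ltr0Sn R 3)).
have sA : `|A J - A 0%N| <= K * \sum_(j < J) side D j `^ (n%:R + s * (1 - n%:R)) * X j.
  elim: J {HJd} => [|J IH]; first by rewrite subrr normr0 big_ord0 mulr0.
  rewrite big_ord_recr/= mulrDr [leRHS]addrC; apply: le_trans (ler_distD (A J) _ _) _.
  exact: lerD.
have lim : `|A J - u x| <= e.
  have HH : 2 * n%:R * side D (mj J) < c * side D J `^ s.
    apply: lt_le_trans (mj2 J) _; rewrite ler_pM2l//; apply: ge0_ler_powR; rewrite ?nnegrE ?(ltW (side_pos _))//.
    exact: side_le.
  have [|cO cx] := @neighbor_admissible _ _ D c s Omega D0 x g g0 glip gball J (mj J) (side D J) (idx D (mj J) (g (side D J))) (ltnW (mj1 J)) _ HH (neighbor_refl _).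
    by rewrite lexx ltW.
  apply: cube_avg_near => //; first exact: ucont_cube (cont_C1 Oopen uC1) cO.
  move=> y yc; apply/ltW/Hd; first exact: cO.
  move=> i; apply: le_lt_trans (cx y yc i) _; move: HJd; have := side_pos J; lra.
exists J.
have -> : cube_avg D u (mj 0%N) (idx D (mj 0%N) x0) = A 0%N.
  by rewrite /A /side expr0 divr1 gD.
apply: le_trans (ler_distD (A J) _ _) _; apply: lerD => //.
by rewrite distrC.
Qed.

End PointwiseMain.

(** * Averages controlled by coverings of level sets *)

Section LevelSets.
Context {R : realType} {n : nat}.
Local Notation V := 'rV[R]_n.
Local Notation Z := 'rV[int]_n.
Local Notation W := (int * nat)%type.

(** A discrete volume bound: each direction has at most [2 * rho / h + 2] points, and [h <= rho]
    absorbs the 2, giving [4 * rho / h]. *)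
Lemma count_pts (h rho : R) (y : V) (s : seq Z) : 0 < h -> h <= rho -> uniq s ->
  (forall k, k \in s -> forall i, `|grid_pt h k ord0 i - y ord0 i| <= rho) ->
  h ^+ n * (size s)%:R <= (4 * rho) ^+ n.
Proof.
move=> h0 hr us H; pose M := (Num.trunc (2 * rho / h)).+2.
pose lo : Z := \row_i Num.floor ((y ord0 i - rho) / h).
have rh : 0 <= 2 * rho / h by rewrite divr_ge0 ?(ltW h0)//; lra.
have T1 : 2 * rho / h < (Num.trunc (2 * rho / h)).+1%:R by exact: truncnS_gt.
have sM : (size s <= M ^ n)%N.
  apply: (size_sub_box (a := lo)) => // k ks i.
  have := H k ks i; rewrite !mxE ler_norml.
  have := floor_itv ((y ord0 i - rho) / h).
  move: (Num.floor _) (k ord0 i) => f q; rewrite intrD => /andP[f1 f2] /andP[q1 q2].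
  have f1' : h * f%:~R <= y ord0 i - rho by rewrite mulrC -ler_pdivlMr.
  have f2' : y ord0 i - rho < h * (f%:~R + 1) by rewrite mulrC -ltr_pdivrMr.
  apply/andP; split.
    by rewrite -(ler_int R) -(ler_pM2l h0); lra.
  rewrite -(ltr_int R) -(ltr_pM2l h0) intrD /M.
  move: T1; rewrite ltr_pdivrMr//; move: (Num.trunc _) => T T1.
  by have -> : T.+2%:Z%:~R = T.+1%:R + 1 :> R; [rewrite -[T.+2]addn1 PoszD intrD|lra].
apply: (@le_trans _ _ (h ^+ n * (M ^ n)%:R)); first by rewrite ler_pM2l ?exprn_gt0// ler_nat.
rewrite natrX -exprMn; apply: lerXn2r; rewrite ?nnegrE; [by rewrite mulr_ge0// ltW|lra|].
have : (Num.trunc (2 * rho / h))%:R <= 2 * rho / h by rewrite truncn_le.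
rewrite ler_pdivlMr// /M; move: (Num.trunc _) => T h3.
by have -> : T.+2%:R = T%:R + 2 :> R; [rewrite -addn2 natrD|lra].
Qed.

Lemma near_all_seq (T : eqType) (s : seq T) (Q : T -> nat -> Prop) :
  (forall b, b \in s -> \forall N \near \oo, Q b N) -> \forall N \near \oo, forall b, b \in s -> Q b N.
Proof.
elim: s => [|b s IH] H; first by apply: nearW.
have h1 := H b (mem_head _ _).
have h2 : \forall N \near \oo, forall b, b \in s -> Q b N.
  by apply: IH => b' bs; apply: H; rewrite in_cons bs orbT.
apply: filterS2 h1 h2 => N h1 h2 b'; rewrite in_cons => /orP[/eqP -> //|]; exact: h2.
Qed.

Definition zpow (a : R) (k : int) : R := a `^ k%:~R.

(** The level is lowered by one so that [zpow 2 k < y] is strict, with room: the covering of level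
    [k] then catches the point, and the value is still below [4 * zpow 2 k]. *)
Lemma dyadic_between (y : R) : 0 < y -> exists k : int, 2 * zpow 2 k <= y < 4 * zpow 2 k.
Proof.
move=> y0; exists (Num.floor (ln y / ln 2) - 1).
have l2 : 0 < ln 2 :> R by rewrite ln_gt0// ltr1n.
have E (z : R) : 2 `^ z = expR (z * ln 2) by rewrite /powR pnatr_eq0.
have E2 (z : R) : 2 * 2 `^ z = expR ((z + 1) * ln 2).
  by have -> : (z + 1) * ln 2 = z * ln 2 + ln 2 :> R; [ring|rewrite expRD lnK ?posrE// -E mulrC].
have E4 (z : R) : 4 * 2 `^ z = expR ((z + 2) * ln 2).
  have -> : 4 * 2 `^ z = 2 * (2 * 2 `^ z) :> R by rewrite mulrA; congr (_ * _); ring.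
  rewrite E2 -E E2; congr expR; ring.
rewrite /zpow E2 E4 intrD mulrN1z -{2 3}(lnK y0) ler_expR ltr_expR -ler_pdivlMr// -ltr_pdivrMr//.
have := floor_itv (ln y / ln 2); rewrite intrD.
by move: (Num.floor _)%:~R => f /andP[h1 h2]; apply/andP; split; lra.
Qed.

Lemma near_eball (y x : V) (rho : R) : eball y rho x -> \forall z \near x, eball y rho z.
Proof.
rewrite /eball/= => xr; have r0 : 0 < rho by apply: le_lt_trans xr; exact: sqrtr_ge0.
pose f (z : V) := \sum_(i < n) (z ord0 i - y ord0 i) ^+ 2.
have fE z : enorm (z - y) = Num.sqrt (f z).
  by congr Num.sqrt; apply: eq_bigr => i _; rewrite !mxE.
have f0 z : 0 <= f z by apply: sumr_ge0 => i _; exact: sqr_ge0.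
have key z : (enorm (z - y) < rho) = (f z < rho ^+ 2).
  rewrite fE -{1}(ger0_norm (ltW r0)) -sqrtr_sqr ltr_sqrt//.
  by rewrite exprn_gt0.
have cf : f z @[z --> x] --> f x.
  apply: cvg_big; [exact: add_continuous|exact: nbhs_filter|move=> i _].
  have c1 : (fun z : V => z ord0 i - y ord0 i) z @[z --> x] --> x ord0 i - y ord0 i.
    apply: (@cvgB R R^o V (nbhs x) _ (fun z : V => z ord0 i) (fun=> y ord0 i)); last exact: cvg_cst.
    exact: coord_continuous.
  exact: (@cvgM R V (nbhs x) _ _ _ _ _ c1 c1).
have : \forall z \near x, f z < rho ^+ 2 by apply: (cvgr_lt _ cf); rewrite -key.
by apply: filterS => z; rewrite -key.
Qed.

Lemma uniq_grid (N : nat) (l : seq Z) : uniq l ->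
  uniq [seq y | b <- l, y <- box ((2 ^ N)%:Z *: b) (2 ^ N)].
Proof.
move=> ul; apply: allpairs_uniq_dep => //; first by move=> b _; exact: uniq_box.
have M0 : (0 < 2 ^ N)%N by rewrite expn_gt0.
move=> [b k] [b' k'] /allpairsPdep[c1 [k1 [_ + [-> ->]]]] /allpairsPdep[c2 [k2 [_ + [-> ->]]]] /= E.
rewrite E !mem_box => /forallP H1 /forallP H2.
suff -> : c1 = c2 by [].
apply/rowP => i; have := H1 i; have := H2 i; rewrite !mxE.
move: (2 ^ N)%N M0 (k2 ord0 i) (c1 ord0 i) (c2 ord0 i) => M M0 x y z /andP[A B] /andP[C E'].
by clear -M0 A B C E'; nia.
Qed.

Variables (D : R) (Omega : set V) (u : V -> R) (c : W -> V) (r : W -> R).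
Hypotheses (D0 : 0 < D) (n0 : (0 < n)%N).
Hypothesis Oopen : eopen Omega.
Hypothesis uC1 : C1_on Omega u.
Hypothesis cov : forall k x, Omega x -> zpow 2 k < mean_partial u x -> exists i, eball (c (k, i)) (r (k, i)) x.

(* By compactness finitely many balls suffice, hence they are all larger than the mesh
   of a fine grid, which makes counting grid points in balls legitimate. *)
Lemma finite_cover m (b : Z) (theta : R) : 0 < theta -> cube D m b `<=` Omega ->
  \forall N \near \oo, forall z, cube D m b z -> mean_partial u z <= theta \/
    exists w : W, [/\ (pickle w < N)%N, theta < 4 * zpow 2 w.1, mean_partial u z <= 4 * zpow 2 w.1 & eball (c w) (r w) z].
Proof.
move=> t0 bO; have /compact_near_coveringP cA := @compact_cube R n D m b.
apply: cA => x Ax; have Ox := bO _ Ax.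
have cg := cont_mean_partial uC1.
have near_lt (M : R) : mean_partial u x < M -> \forall y \near x, mean_partial u y < M.
  move=> xM; have e0 : 0 < M - mean_partial u x by rewrite subr_gt0.
  have [d d0 Hd] := cg x Ox _ e0.
  apply: filterS2 (near_coord x d0) (near_open Oopen Ox) => y Hy Oy; have := Hd y Oy Hy.
  by move/ltr_normlW; lra.
have [lt|ge] := ltP (mean_partial u x) theta.
  exists ([set y | mean_partial u y < theta], setT); first by split; [exact: near_lt|exact: filterT].
  by move=> [y N] /= [Hy _]; left; exact/ltW.
have [k /andP[k1 k2]] := dyadic_between (lt_le_trans t0 ge).
have p0 : 0 < zpow 2 k by exact: powR_gt0.
have [|i xi] := cov (k := k) Ox; first by lra.
have ball_near := near_eball xi.
exists ([set y | (mean_partial u y < 4 * zpow 2 k) /\ eball (c (k, i)) (r (k, i)) y],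
    [set N | (pickle (k, i) < N)%N]).
  split; last exact: nbhs_infty_gt.
  by apply: filterI => //; exact: near_lt.
move=> [y N] /= [[Hy By] HN]; right; exists (k, i); split => //.
  by apply: le_lt_trans ge _.
exact/ltW.
Qed.

Definition ball_meets (j : nat) (x : V) (w : W) : Prop := exists y : V,
  (forall i, `|y ord0 i - x ord0 i| <= 3 * side D j) /\ (forall i, `|y ord0 i - c w ord0 i| < r w).

Lemma grid_sum (g : V -> R) m N (l : seq Z) :
  side D m ^+ n * \sum_(b <- l) grid_avg D g m b N =
  side D (m + N) ^+ n * \sum_(k <- [seq y | b <- l, y <- box ((2 ^ N)%:Z *: b) (2 ^ N)]) g (grid_pt (side D (m + N)) k).
Proof.
rewrite big_allpairs_dep/= /grid_avg -mulr_sumr mulrA; congr (_ * _).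
rewrite (sideD D m N) exprMn natrX -exprM natrX -exprM mulfK// expf_neq0//.
Qed.

(** At a grid point [mean_partial] is at most [theta] plus [4 * zpow 2 k] for each selected ball
    containing it. Summation counts grid points within [3 * side D j] of [x], whence 12 = 4 * 3, and
    within each ball. *)
Lemma level_sum j x m (l : seq Z) (theta : R) : 0 < theta -> uniq l ->
  (forall b, b \in l -> admissible D Omega j x m b) ->
  exists S : seq W, [/\ uniq S,
    forall w, w \in S -> [/\ theta < 4 * zpow 2 w.1, 0 < r w & ball_meets j x w] &
    side D m ^+ n * \sum_(b <- l) cube_avg D (mean_partial u) m b <=
      (12 * side D j) ^+ n * theta + \sum_(w <- S) 4 * zpow 2 w.1 * (4 * r w) ^+ n].
Proof.
move=> t0 ul al.
have [N0 _ /(_ N0 (leqnn N0)) HN0] := near_all_seq (fun b bl => finite_cover t0 (proj1 (al b bl))).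
(* [N0] serves all cubes of [l] at once, so this finite family is fixed before the grid is
   refined. *)
pose S := undup [seq w <- pmap unpickle (iota 0 N0) | `[< [/\ theta < 4 * zpow 2 w.1, 0 < r w & ball_meets j x w] >]].
have SP w : w \in S -> [/\ theta < 4 * zpow 2 w.1, 0 < r w & ball_meets j x w].
  by rewrite mem_undup mem_filter => /andP[/asboolP].
exists S; split => //; first exact: undup_uniq.
have C1 : side D m ^+ n * \sum_(b <- l) grid_avg D (mean_partial u) m b N @[N --> \oo] -->
    side D m ^+ n * \sum_(b <- l) cube_avg D (mean_partial u) m b.
  apply: cvgM; first exact: cvg_cst.
  apply: cvg_rsum => b bl; apply: grid_avg_cvg => //.
  by apply: ucont_cube (cont_mean_partial uC1) _; exact: (proj1 (al b bl)).
rewrite -(cvg_lim _ C1)//; apply: limr_le; first exact: cvgP C1.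
have N1 : \forall N \near \oo, forall w, w \in S -> side D (m + N) <= r w.
  apply: near_all_seq => w /SP[_ /(side_small D) [M HM] _].
  near=> N; apply: le_trans HM; apply: side_le => //.
  by rewrite (leq_trans _ (leq_addl _ _))//; near: N; exact: nbhs_infty_ge.
have sj := side_gt0 j D0.
near=> N.
have hr : forall w, w \in S -> side D (m + N) <= r w by near: N.
have jN : (j <= N)%N by near: N; exact: nbhs_infty_ge.
rewrite grid_sum; set h := side D (m + N) in hr *; set ZN := [seq _ | _ <- l, _ <- _].
have h0 : 0 < h := side_gt0 _ D0.
have hj : h <= 3 * side D j.
  apply: (@le_trans _ _ (side D j)); last by lra.
  by apply: side_le => //; rewrite (leq_trans jN)// leq_addl.
have uZ : uniq ZN by exact: uniq_grid.
have Zx k : k \in ZN -> exists2 b, b \in l & cube D m b (grid_pt h k).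
  by move=> /allpairsPdep[b [k' [bl kb ->]]]; exists b => //; exact: grid_pt_cube.
have bnd k : k \in ZN -> mean_partial u (grid_pt h k) <= theta + \sum_(w <- S) 4 * zpow 2 w.1 * (`[< eball (c w) (r w) (grid_pt h k) >])%:R.
  move=> /Zx[b bl bk]; have [_ bx] := al b bl.
  have T0 w : 0 <= 4 * zpow 2 w.1 * (`[< eball (c w) (r w) (grid_pt h k) >])%:R.
    by rewrite !mulr_ge0// powR_ge0.
  have [le|[w [wN tw gw bw]]] := HN0 b bl _ bk.
    by apply: (le_trans le); rewrite lerDl sumr_ge0.
  have wS : w \in S.
    rewrite mem_undup mem_filter; apply/andP; split.
      apply/asboolP; split => //; first by apply: le_lt_trans bw; exact: sqrtr_ge0.
      exists (grid_pt h k); split; first exact: bx.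
      move=> i; apply: le_lt_trans bw; have := enorm_coord (grid_pt h k - c w) i.
      by rewrite [X in `|X| <= _]mxE [X in `|_ + X| <= _]mxE.
    by rewrite mem_pmap; apply/mapP; exists (pickle w); rewrite ?pickleK// mem_iota add0n wN.
  apply: (le_trans gw); apply: (@le_trans _ _ (\sum_(w <- S) 4 * zpow 2 w.1 * (`[< eball (c w) (r w) (grid_pt h k) >])%:R)); last by rewrite lerDr ltW.
  rewrite (big_rem w)//= (_ : `[< eball (c w) (r w) (grid_pt h k) >] = true) ?mulr1 ?lerDl ?sumr_ge0//.
  exact/asboolP.
apply: (@le_trans _ _ (h ^+ n * \sum_(k <- ZN) (theta + \sum_(w <- S) 4 * zpow 2 w.1 * (`[< eball (c w) (r w) (grid_pt h k) >])%:R))).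
  by rewrite ler_pM2l ?exprn_gt0// !big_seq; apply: ler_sum.
rewrite big_split/= mulrDr; apply: lerD.
  rewrite big_const_seq count_predT iter_addr_0 -[theta *+ _]mulr_natr mulrCA mulrC ler_pM2r//.
  have -> : 12 * side D j = 4 * (3 * side D j) by ring.
  apply: (@count_pts _ _ x) => // k /Zx[b bl bk]; exact: (proj2 (al b bl)).
rewrite exchange_big/= mulr_sumr !big_seq; apply: ler_sum => w wS.
rewrite -mulr_sumr mulrCA ler_pM2l ?mulr_gt0 ?powR_gt0//.
have -> : \sum_(k <- ZN) (`[< eball (c w) (r w) (grid_pt h k) >])%:R = (size [seq k <- ZN | `[< eball (c w) (r w) (grid_pt h k) >]])%:R :> R.
  rewrite size_filter -sum1_count natr_sum [RHS]big_mkcond/=.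
  by apply: eq_bigr => k _; case: ifP => // ->.
apply: (@count_pts _ _ (c w)) => //; [exact: hr|exact: filter_uniq|].
move=> k; rewrite mem_filter => /andP[/asboolP bw _] i.
apply: le_trans (ltW bw); have := enorm_coord (grid_pt h k - c w) i.
by rewrite [X in `|X| <= _]mxE [X in `|_ + X| <= _]mxE.
Unshelve. all: by end_near. Qed.

End LevelSets.

(** * Unordered sums and Hausdorff content *)

Section Esum.
Context {R : realType}.
Local Open Scope ereal_scope.

Lemma esum_le_seq (T : choiceType) (S : set T) (a : T -> \bar R) (M : \bar R) :
  (forall s : seq T, uniq s -> (forall x, x \in s -> S x) -> \sum_(x <- s) a x <= M) ->
  \esum_(x in S) a x <= M.
Proof.
move=> H; apply: ge_ereal_sup => _ [A [fA AS] <-].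
rewrite fsbig_finite//; apply: H; first exact: finmap.fset_uniq.
by move=> x; rewrite in_fset_set// inE => /AS.
Qed.

Lemma seq_le_esum (T : choiceType) (S : set T) (a : T -> \bar R) (s : seq T) : uniq s ->
  (forall x, x \in s -> S x) -> \sum_(x <- s) a x <= \esum_(x in S) a x.
Proof.
move=> us sS; apply: esum_ge; exists [set` s].
  by split; [exact: finite_seq|move=> x /= /sS].
by rewrite fsbig_seq.
Qed.

Lemma subset_esum (T : choiceType) (A B : set T) (a : T -> \bar R) : A `<=` B -> (forall x, 0 <= a x) ->
  \esum_(x in A) a x <= \esum_(x in B) a x.
Proof.
move=> AB a0; apply: esum_le_seq => s us sA; apply: seq_le_esum => // x /sA; exact: AB.
Qed.

Lemma esum_swap_le (T1 T2 : choiceType) (a : T1 -> T2 -> \bar R) : (forall x y, 0 <= a x y) ->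
  \esum_(x in setT) \esum_(y in setT) a x y <= \esum_(y in setT) \esum_(x in setT) a x y.
Proof.
move=> a0; apply: esum_le_seq => s us _.
rewrite -esum_sum; last by move=> *; exact: a0.
by apply: le_esum => y _; exact: seq_le_esum.
Qed.

Lemma esumZ_le (T : choiceType) (S : set T) (a : T -> \bar R) (k : R) : (0 <= k)%R ->
  (forall x, 0 <= a x) -> \esum_(x in S) (k%:E * a x) <= k%:E * \esum_(x in S) a x.
Proof.
move=> k0 a0; apply: esum_le_seq => s us sS.
rewrite -ge0_sume_distrr//; apply: lee_wpmul2l; first by rewrite lee_fin.
exact: seq_le_esum.
Qed.

Lemma esumZ (T : choiceType) (S : set T) (a : T -> \bar R) (k : R) : (0 < k)%R ->
  (forall x, 0 <= a x) -> \esum_(x in S) (k%:E * a x) = k%:E * \esum_(x in S) a x.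
Proof.
move=> k0 a0; apply/eqP; rewrite eq_le; apply/andP; split; first by apply: esumZ_le => //; exact: ltW.
have ka0 x : 0 <= k%:E * a x by rewrite mule_ge0// lee_fin ltW.
have ki0 : (0 <= k^-1)%R by rewrite invr_ge0 ltW.
have := esumZ_le S ki0 ka0.
rewrite (eq_esum (b := a)); last first.
  by move=> x _; rewrite muleA -EFinM mulVf ?gt_eqF// mul1e.
have k0' : 0 <= k%:E by rewrite lee_fin ltW.
by move=> /(lee_wpmul2l k0'); rewrite muleA -EFinM mulfV ?gt_eqF// mul1e.
Qed.

Lemma pickle_seq (T : countType) (f : T -> \bar R) (s : seq nat) : uniq s ->
  let t := pmap (@pickle_inv T) s in
  uniq t /\ \sum_(i <- s) (if pickle_inv i is Some x then f x else 0) = \sum_(x <- t) f x.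
Proof.
elim: s => [|i s IH]; first by split => //; rewrite !big_nil.
rewrite cons_uniq => /andP[is_ /IH[ut E]]; rewrite big_cons/=.
have Kinv j : oapp (@pickle T) j (pickle_inv j) = j := pickle_invK j.
have := Kinv i.
case: (pickle_inv i) => [x|] /= xi; last by rewrite add0e.
rewrite big_cons E; split => //; rewrite /= ut andbT mem_pmap.
apply/negP => /mapP[i' i's Ei]; move: is_; rewrite -xi.
by have := Kinv i'; rewrite -Ei /= => ->; rewrite i's.
Qed.

(** Codes that belong to no element of [S] receive radius 0. Such a ball is empty and costs nothing
    because [0 ^ beta = 0], which needs [beta != 0]. *)
Lemma hcontent_cover (n : nat) (T : countType) (S : set T) (beta : R) (E : set 'rV[R]_n)
    (c : T -> 'rV[R]_n) (r : T -> R) : (beta != 0)%R -> (forall t, (0 <= r t)%R) ->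
  (forall x, E x -> exists2 t, S t & eball (c t) (r t) x) ->
  hcontent beta E <= \esum_(t in S) ((r t) `^ beta)%:E.
Proof.
move=> b0 r0 H.
pose f (t : T) : \bar R := if t \in S then ((r t) `^ beta)%:E else 0.
pose c' (i : nat) : 'rV[R]_n := if pickle_inv i is Some t then c t else 0%R.
pose r' (i : nat) : R := if pickle_inv i is Some t then (if t \in S then r t else 0%R) else 0%R.
apply: (@le_trans _ _ (\sum_(0 <= i <oo) ((r' i) `^ beta)%:E)).
  apply: ereal_inf_lbound; exists c', r'; split; [|split => //].
    by move=> i; rewrite /r'; case: (pickle_inv i) => // t; case: ifP.
  move=> x /H[t tS xt]; exists (pickle t) => //=.
  by rewrite /c' /r' pickleK_inv (mem_set tS).
rewrite nneseries_esumT; last by move=> i; rewrite lee_fin powR_ge0.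
apply: esum_le_seq => s us _.
have [ut E'] := pickle_seq f us.
rewrite (eq_bigr (fun i => if pickle_inv i is Some x then f x else 0)); last first.
  move=> i _; rewrite /r' /f; case: (pickle_inv i) => [t|]; last by rewrite powR0.
  by case: ifP => //; rewrite powR0.
rewrite E' esum_mkcond; apply: seq_le_esum => //.
Qed.
End Esum.

(** * Power sums and geometric sums *)

Section Sums.
Context {R : realType}.

(** One factor [a t] is kept, and the remaining power [b - 1] of it is bounded by that of the whole
    sum. *)
Lemma sum_powR_le (T : eqType) (s : seq T) (a : T -> R) (b : R) : 1 <= b -> (forall t, 0 <= a t) ->
  \sum_(t <- s) a t `^ b <= (\sum_(t <- s) a t) `^ b.
Proof.
move=> b1 a0; set A := \sum_(t <- s) a t.
have A0 : 0 <= A by exact: sumr_ge0.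
have split_pow x : 0 <= x -> x `^ b = x * x `^ (b - 1).
  by move=> x0; rewrite mulr_powRB1//; apply: lt_le_trans b1.
apply: (@le_trans _ _ (\sum_(t <- s) a t * A `^ (b - 1))); last by rewrite -mulr_suml -split_pow.
rewrite !big_seq; apply: ler_sum => t ts; rewrite split_pow//; apply: ler_wpM2l => //.
apply: ge0_ler_powR; rewrite ?subr_ge0 ?nnegrE//.
by rewrite /A (big_rem t)//= lerDl sumr_ge0.
Qed.

Lemma seq_max (T : eqType) (s : seq T) (y : T -> R) : s != [::] ->
  exists2 a, a \in s & forall b, b \in s -> y b <= y a.
Proof.
elim: s => [//|a s IH] _; have [->|s0] := eqVneq s [::].
  by exists a; [exact: mem_head|move=> b; rewrite mem_seq1 => /eqP ->].
have [m ms H] := IH s0; have [le|lt] := leP (y m) (y a).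
  exists a; first exact: mem_head.
  by move=> b; rewrite in_cons => /orP[/eqP -> //|/H /le_trans]; exact.
exists m; first by rewrite in_cons ms orbT.
by move=> b; rewrite in_cons => /orP[/eqP ->|/H //]; exact: ltW.
Qed.

Lemma geom_const (e : R) : 0 < e -> 2 `^ (- e) < 1 :> R.
Proof.
move=> e0; have -> : 2 `^ (- e) = (2 `^ e)^-1 :> R by exact: powRN.
by rewrite invf_lt1 ?powR_gt0// /powR pnatr_eq0/= expR_gt1 mulr_gt0// ln_gt0// ltr1n.
Qed.

(** A geometric series without an enumeration: after removal of the largest value all others are at
    most half of it, and the induction continues with [t] replaced by that half. *)
Lemma geom_sep (T : eqType) (s : seq T) (y : T -> R) (e t : R) : 0 < e -> 0 <= t -> uniq s ->
  (forall a, a \in s -> 0 < y a <= t) ->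
  (forall a b, a \in s -> b \in s -> a != b -> y a <= y b / 2 \/ y b <= y a / 2) ->
  \sum_(a <- s) y a `^ e <= (1 - 2 `^ (- e))^-1 * t `^ e.
Proof.
move=> e0; have K1 := geom_const e0; set K := (_ - _)^-1.
have K0 : 0 < K by rewrite invr_gt0 subr_gt0.
move sz : (size s) => N; elim: N s t sz => [|N IH] s t sz t0 us yt sep.
  by rewrite (size0nil sz) big_nil mulr_ge0 ?powR_ge0// ltW.
have [|a sa H] := @seq_max _ s y; first by rewrite -size_eq0 sz.
have /andP[ya0 yat] := yt _ sa.
rewrite (big_rem a)//=.
have srem b : b \in rem a s -> b \in s /\ b != a.
  by rewrite mem_rem_uniq// inE => /andP[].
have /IH : size (rem a s) = N by rewrite size_rem// sz.
move=> /(_ (y a / 2)) h.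
apply: (@le_trans _ _ (y a `^ e + K * (y a / 2) `^ e)).
  rewrite lerD2l; apply: h; rewrite ?rem_uniq ?divr_ge0 ?(ltW ya0)//.
  - move=> b /srem[bs ba]; have /andP[-> yb] := yt _ bs.
    by have [//|h] := sep _ _ bs sa ba; have := H _ bs; lra.
  - by move=> b b' /srem[bs _] /srem[bs' _]; exact: sep.
rewrite powRM ?(ltW ya0) ?invr_ge0//.
have -> : 2^-1 `^ e = 2 `^ (- e) :> R by rewrite -powR_inv1// -powRrM mulN1r.
have -> : y a `^ e + K * (y a `^ e * 2 `^ (- e)) = K * y a `^ e.
  have : 1 - 2 `^ (- e) != 0 :> R by rewrite gt_eqF// subr_gt0.
  by rewrite /K; move: (2 `^ (- e)) => z z0; field.
rewrite ler_pM2l//; apply: ge0_ler_powR; rewrite ?nnegrE ?(ltW e0) ?(ltW ya0)//.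
Qed.

End Sums.

(** * The maximal function estimate *)

Section Maximal.
Context {R : realType} {n : nat}.
Local Notation V := 'rV[R]_n.
Local Notation Z := 'rV[int]_n.
Local Notation W := (int * nat)%type.

Variables (D : R) (Omega : set V) (u : V -> R) (c : W -> V) (r : W -> R).
Hypotheses (D0 : 0 < D) (n0 : (0 < n)%N).
Hypothesis Oopen : eopen Omega.
Hypothesis uC1 : C1_on Omega u.
Hypothesis cov : forall k x, Omega x -> zpow 2 k < mean_partial u x -> exists i, eball (c (k, i)) (r (k, i)) x.
Hypothesis r0 : forall w, 0 <= r w.
Variables (delta p kappa F : R).
Hypotheses (d0 : 0 < delta) (dn : delta <= n%:R) (dp : delta / n%:R < p).
Hypotheses (k0 : 0 <= kappa) (kd : kappa * p < delta) (F0 : 0 < F).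

Let p0 := delta / n%:R.
Definition cover_weight (w : W) : R := zpow 2 w.1 `^ p * r w `^ delta.
(** The weight at the critical exponent: its power n/delta is height times volume of the ball, see
    [weight0_pow]. *)
Definition cover_weight0 (w : W) : R := zpow 2 w.1 `^ p0 * r w `^ delta.
Hypothesis hF : (\esum_(w in [set: W]) (cover_weight w)%:E <= F%:E)%E.

Lemma zpow_gt0 k : 0 < zpow 2 k :> R. Proof. exact: powR_gt0. Qed.
Lemma weight_ge0 w : 0 <= cover_weight w. Proof. by rewrite mulr_ge0 ?powR_ge0. Qed.
Lemma weight0_ge0 w : 0 <= cover_weight0 w. Proof. by rewrite mulr_ge0 ?powR_ge0. Qed.
Lemma natr_dim_gt0 : 0 < n%:R :> R. Proof. by rewrite ltr0n. Qed.
Lemma p0_gt0 : 0 < p0. Proof. by rewrite divr_gt0 ?natr_dim_gt0. Qed.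
Lemma p_gt0 : 0 < p. Proof. exact: lt_trans p0_gt0 dp. Qed.

Lemma seq_weight (S : seq W) : uniq S -> \sum_(w <- S) cover_weight w <= F.
Proof.
move=> uS; rewrite -lee_fin; apply: le_trans hF; rewrite -sumEFin.
exact: seq_le_esum.
Qed.

Lemma powRK (x a : R) : 0 <= x -> a != 0 -> (x `^ a) `^ a^-1 = x.
Proof. by move=> x0 a0; rewrite -powRrM mulfV// powRr1. Qed.

Lemma weight0_pow w : cover_weight0 w `^ (n%:R / delta) = zpow 2 w.1 * r w ^+ n.
Proof.
have nz : delta != 0 by rewrite gt_eqF.
have nz' : n%:R != 0 :> R by rewrite gt_eqF ?natr_dim_gt0.
rewrite /cover_weight0; move: (zpow 2 w.1) (ltW (zpow_gt0 w.1)) => a a0.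
rewrite powRM ?powR_ge0// -!powRrM.
have -> : p0 * (n%:R / delta) = 1 by rewrite /p0; field; rewrite nz nz'.
have -> : delta * (n%:R / delta) = n%:R by field.
by rewrite powRr1 ?powR_mulrn.
Qed.

Lemma sum_S_le (S : seq W) : \sum_(w <- S) 4 * zpow 2 w.1 * (4 * r w) ^+ n <=
  4 * 4 ^+ n * (\sum_(w <- S) cover_weight0 w) `^ (n%:R / delta).
Proof.
have -> : \sum_(w <- S) 4 * zpow 2 w.1 * (4 * r w) ^+ n = 4 * 4 ^+ n * \sum_(w <- S) cover_weight0 w `^ (n%:R / delta).
  by rewrite mulr_sumr; apply: eq_bigr => w _; rewrite weight0_pow exprMn; ring.
rewrite ler_pM2l ?mulr_gt0 ?exprn_gt0//; apply: sum_powR_le; last exact: weight0_ge0.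
by rewrite ler_pdivlMr// mul1r.
Qed.

Definition avg_const : R := 4 * 12 ^+ n + 4 * 4 ^+ n.

(** The threshold in [level_sum] is [4 * y], with [y] chosen so that [y ^ p * side D j ^ delta = F];
    then the low part and the ball part are both of order [y * side D j ^ n]. *)
Lemma avg_bound_global j x : avg_bound D Omega u j x (avg_const * (F / side D j `^ delta) `^ p^-1).
Proof.
move=> m l ul al; have sj := side_gt0 j D0; set y := _ `^ p^-1.
have pp := p_gt0.
have sd : 0 < side D j `^ delta by rewrite powR_gt0.
have y0 : 0 < y by rewrite powR_gt0 ?divr_gt0.
have [S [uS HS le]] := level_sum D0 Oopen uC1 cov (mulr_gt0 (ltr0Sn _ 3) y0) ul al.
apply: (le_trans le); have yp : y `^ p = F / side D j `^ delta.
  by rewrite /y -powRrM mulVf ?gt_eqF// powRr1// divr_ge0 ?ltW.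
clearbody y.
(* Selected balls have [zpow 2 k > y], so passing from exponent [p] down to [p0] gains the factor
   [y ^ (p0 - p)]. *)
have S0 : \sum_(w <- S) cover_weight0 w <= y `^ p0 * side D j `^ delta.
  have -> : y `^ p0 * side D j `^ delta = F * y `^ (p0 - p).
    have -> : F = y `^ p * side D j `^ delta by rewrite yp divfK// gt_eqF.
    have -> : y `^ p0 = y `^ p * y `^ (p0 - p).
      rewrite -powRD; last by apply/implyP => _; rewrite gt_eqF.
      by congr (_ `^ _); ring.
    by ring.
  apply: (@le_trans _ _ (\sum_(w <- S) cover_weight w * y `^ (p0 - p))); last first.
    by rewrite -mulr_suml (ler_pM2r (powR_gt0 _ y0)); exact: seq_weight.
  rewrite !big_seq; apply: ler_sum => w /HS[tw rw _].
  rewrite /cover_weight0 /cover_weight mulrAC ler_wpM2r ?powR_ge0//.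
  have : y < zpow 2 w.1 by move: tw; rewrite ltr_pM2l.
  move: (zpow 2 w.1) (zpow_gt0 w.1) => a a0 yw.
  have -> : a `^ p0 = a `^ p * a `^ (p0 - p).
    rewrite -powRD; last by apply/implyP => _; rewrite gt_eqF.
    by congr (_ `^ _); ring.
  rewrite ler_wpM2l ?powR_ge0//.
  have -> : p0 - p = - (p - p0) by ring.
  rewrite !powRN lef_pV2 ?posrE ?powR_gt0//; apply: ge0_ler_powR; rewrite ?nnegrE ?(ltW y0) ?(ltW a0) ?(ltW yw)//.
  by rewrite subr_ge0 ltW.
have := sum_S_le S; set T := (_ `^ _) => h.
have hT : T <= y * side D j ^+ n.
  have -> : y * side D j ^+ n = (y `^ p0 * side D j `^ delta) `^ (n%:R / delta).
    have nz : delta != 0 by rewrite gt_eqF.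
    have nz' : n%:R != 0 :> R by rewrite gt_eqF ?natr_dim_gt0.
    rewrite powRM ?powR_ge0// -!powRrM.
    have -> : p0 * (n%:R / delta) = 1 by rewrite /p0; field; rewrite nz nz'.
    have -> : delta * (n%:R / delta) = n%:R by field.
    by rewrite powRr1 ?powR_mulrn// ltW.
  apply: ge0_ler_powR; rewrite ?nnegrE//; first by rewrite divr_ge0// ltW.
    by apply: sumr_ge0 => w _; exact: weight0_ge0.
  by rewrite mulr_ge0 ?powR_ge0.
have k4 : 0 < 4 * 4 ^+ n :> R by rewrite mulr_gt0 ?exprn_gt0.
have h2 : 4 * 4 ^+ n * T <= 4 * 4 ^+ n * (y * side D j ^+ n) by rewrite ler_pM2l.
rewrite exprMn /avg_const; move: h h2; move: (4 ^+ n) (12 ^+ n) (side D j ^+ n) => A B E h h2; nra.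
Qed.

End Maximal.

(** * Covering the set where a maximal average is large *)

Section Cover.
Context {R : realType} {n : nat}.
Local Notation V := 'rV[R]_n.
Local Notation Z := 'rV[int]_n.
Local Notation W := (int * nat)%type.

Variables (D : R) (Omega : set V) (u : V -> R) (c : W -> V) (r : W -> R).
Hypotheses (D0 : 0 < D) (n0 : (0 < n)%N).
Hypothesis Oopen : eopen Omega.
Hypothesis uC1 : C1_on Omega u.
Hypothesis cov : forall k x, Omega x -> zpow 2 k < mean_partial u x -> exists i, eball (c (k, i)) (r (k, i)) x.
Hypothesis r0 : forall w, 0 <= r w.
Variables (delta p kappa F : R).
Hypotheses (d0 : 0 < delta) (dn : delta <= n%:R) (dp : delta / n%:R < p).
Hypotheses (k0 : 0 <= kappa) (kd : kappa * p < delta) (F0 : 0 < F).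

Let p0 := delta / n%:R.
Let wt := cover_weight r delta p.
Let wt0 := @cover_weight0 R n r delta.
Hypothesis hF : (\esum_(w in [set: W]) (wt w)%:E <= F%:E)%E.

Lemma idx_parent m (y z : V) : idx D m.+1 y = idx D m.+1 z -> idx D m y = idx D m z.
Proof.
move=> E; have := idx_child D0 m y; have := idx_child D0 m z; rewrite E !mem_box => /forallP H /forallP H'.
apply/rowP => i; have := H i; have := H' i; rewrite ![fun_of_matrix (_ *: _) _ _]mxE.
move: (idx D m y ord0 i) (idx D m z ord0 i) (idx D m.+1 z ord0 i) => a b d; clear; lia.
Qed.

Lemma idx_anc i j (y z : V) : (i <= j)%N -> idx D j y = idx D j z -> idx D i y = idx D i z.
Proof.
move=> /subnK <-; elim: (j - i)%N => [//|k IH] /idx_parent; exact: IH.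
Qed.

(** [c4] makes the low part in [level_sum] exactly half of [side D j ^ n * y]. The other half forces
    a lower bound on the mass of the balls, and [c3] is the share of one among [11 ^ n] cubes. *)
Let c4 : R := (2 * 12 ^+ n)^-1 / 4.
Let c3 : R := (8 * 4 ^+ n)^-1 `^ p0 / 11 ^+ n.

(* A cube carrying enough of the measure [cover_weight0] to make a maximal average
   exceed the level [l] nearby. *)
Definition heavy (l : R) (j : nat) (a : Z) : Prop :=
  ((c3 * (l * side D j `^ (- kappa)) `^ p0 * side D j `^ delta)%:E <
   \esum_(w in [set w | idx D j (c w) = a /\ (c4 * (l * side D j `^ (- kappa)) < zpow 2 w.1)%R]) (wt0 w)%:E)%E.

(** The ancestors of a cube are named through its points, as [idx D i y] with [i] below its
    level. *)
Definition max_heavy (l : R) (q : nat * Z) : Prop :=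
  heavy l q.1 q.2 /\ forall y, idx D q.1 y = q.2 -> forall i, (i < q.1)%N -> ~ heavy l i (idx D i y).

Lemma c4_gt0 : 0 < c4. Proof. by rewrite /c4 divr_gt0// invr_gt0 mulr_gt0// exprn_gt0. Qed.
Lemma c3_gt0 : 0 < c3.
Proof. by rewrite divr_gt0 ?exprn_gt0// powR_gt0// invr_gt0 mulr_gt0// exprn_gt0. Qed.

Lemma weight0_ge0_ereal w : (0 <= (wt0 w)%:E)%E. Proof. by rewrite lee_fin; exact: weight0_ge0. Qed.

(** Lowering the level decreases the required mass and admits more balls. *)
Lemma heavy_mono l l' j a : 0 <= l' -> l' <= l -> heavy l j a -> heavy l' j a.
Proof.
move=> l0 ll; rewrite /heavy => h.
have s0 : 0 <= side D j `^ (- kappa) by exact: powR_ge0.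
have ls : l' * side D j `^ (- kappa) <= l * side D j `^ (- kappa) by exact: ler_wpM2r.
apply: le_lt_trans (lt_le_trans h _).
  rewrite lee_fin ler_wpM2r ?powR_ge0// ler_wpM2l ?(ltW c3_gt0)//.
  apply: ge0_ler_powR; rewrite ?nnegrE//; first exact: ltW (p0_gt0 n0 d0).
    exact: mulr_ge0.
  by apply: mulr_ge0 => //; apply: le_trans ll.
apply: subset_esum => [w [/= -> h2]|w]; last exact: weight0_ge0_ereal.
split => //; apply: le_lt_trans h2; apply: ler_wpM2l => //; exact: ltW c4_gt0.
Qed.

(** A coarsest heavy ancestor exists because levels are natural numbers, bounded below by 0. *)
Lemma max_heavy_exists l j (y : V) : heavy l j (idx D j y) -> exists2 i, (i <= j)%N & max_heavy l (i, idx D i y).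
Proof.
move=> b; have ex : exists i, `[< heavy l i (idx D i y) >] by exists j; apply/asboolP.
exists (ex_minn ex); case: ex_minnP => i /asboolP bi mi; first by apply: mi; apply/asboolP.
split => //= z yz k ki; rewrite (idx_anc (ltnW ki) yz) => /asboolP /mi.
by rewrite leqNgt ki.
Qed.

Lemma coord_eball (x y : V) (rho rho' : R) : (forall i, `|x ord0 i - y ord0 i| <= rho) -> n%:R * rho < rho' ->
  eball y rho' x.
Proof.
by move=> H; apply: le_lt_trans; apply: enorm_le => i; rewrite !mxE.
Qed.

Lemma idx_box_near j (x y : V) : (forall i, `|y ord0 i - x ord0 i| <= 4 * side D j) ->
  idx D j y \in box (\row_i (idx D j x ord0 i - 5)) 11.
Proof.
move=> H; rewrite mem_box; apply/forallP => i; have s0 := side_gt0 j D0.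
have := H i; rewrite [fun_of_matrix (\row_ _ _) _ _]mxE ler_norml; have := idx_bounds D0 j x i; have := idx_bounds D0 j y i.
move: (idx D j y ord0 i) (idx D j x ord0 i) => a b.
rewrite !intrD1 => /andP[A B] /andP[C E] /andP[G1 G2].
have K (q t : int) : side D j * q%:~R < side D j * t%:~R -> q < t by rewrite ltr_pM2l// ltr_int.
have E5 (q : int) : side D j * (q + 5%:Z)%:~R = side D j * q%:~R + 5 * side D j.
  by rewrite intrD mulrDr [side D j * 5%:~R]mulrC.
have : a < b + 5%:Z by apply: K; rewrite E5; lra.
have : b < a + 5%:Z by apply: K; rewrite E5; lra.
by clear; lia.
Qed.

(** Used in contrapositive form: a point with a large average lies in a dilate of a ball that is
    large for the level [l], or in a dilate of a maximal heavy cube. *)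
Lemma heavy_cover l j x : 0 < l ->
  (forall w, c4 * l < zpow 2 w.1 * r w `^ kappa -> ~ eball (c w) (5 * n%:R * r w) x) ->
  (forall q, max_heavy l q -> ~ eball (grid_pt (side D q.1) q.2) (6 * n%:R * side D q.1) x) ->
  avg_bound D Omega u j x (l * side D j `^ (- kappa)).
Proof.
move=> l0 HA HB m s us sadm; rewrite leNgt; apply/negP => gt.
have sj := side_gt0 j D0; set y := l * _ in gt.
have sk : 0 < side D j `^ kappa by rewrite powR_gt0.
have y0 : 0 < y by rewrite mulr_gt0// powR_gt0.
have ysk : y * side D j `^ kappa = l by rewrite /y powRN mulfVK// gt_eqF.
have c40 := c4_gt0; have pp := p0_gt0 n0 d0.
have t0 : 0 < 4 * (c4 * y) by apply: mulr_gt0 => //; exact: mulr_gt0.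
have [S [uS HS le]] := level_sum D0 Oopen uC1 cov t0 us sadm.
have nR : 0 < n%:R :> R := natr_dim_gt0 n0.
(* A selected ball of radius at least [side D j] would have [x] in its dilate while
   [zpow 2 k * r ^ kappa > c4 * l], against the first hypothesis. *)
have small w : w \in S -> r w < side D j.
  move=> wS; rewrite ltNge; apply/negP => jr; have [tw rw [z [zx zc]]] := HS w wS.
  apply: (HA w).
    rewrite ltr_pM2l// in tw; rewrite -ysk mulrA.
    apply: (@lt_le_trans _ _ (zpow 2 w.1 * side D j `^ kappa)); first by rewrite ltr_pM2r.
    rewrite ler_pM2l ?powR_gt0//; apply: ge0_ler_powR; rewrite ?nnegrE// ltW//.
  apply: (@coord_eball _ _ (4 * r w)).
    move=> i; have := zx i; have := zc i; rewrite ltr_norml !ler_norml; lra.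
  have : 0 < n%:R * r w by rewrite mulr_gt0.
  lra.
have near_c w : w \in S -> forall i, `|c w ord0 i - x ord0 i| <= 4 * side D j.
  move=> wS i; have := small w wS; have [_ _ [z [zx zc]]] := HS w wS.
  have := zx i; have := zc i; rewrite ltr_norml !ler_norml; lra.
pose B := box (\row_i (idx D j x ord0 i - 5)) 11 : seq Z.
(* The low part accounts for only half of the average, so the balls carry the rest; the power
   delta/n turns this into a bound on their mass. *)
have big : (8 * 4 ^+ n)^-1 `^ p0 * y `^ p0 * side D j `^ delta < \sum_(w <- S) wt0 w.
  have A4 : 0 < 4 ^+ n :> R by rewrite exprn_gt0.
  have A12 : 0 < 12 ^+ n :> R by rewrite exprn_gt0.
  have := sum_S_le n0 r0 d0 dn S; rewrite -/wt0; set T := \sum_(w <- S) wt0 w => h.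
  have h1 : side D j ^+ n * y < (12 * side D j) ^+ n * (4 * (c4 * y)) + 4 * 4 ^+ n * T `^ (n%:R / delta).
    by apply: (lt_le_trans gt); apply: (le_trans le); rewrite lerD2l.
  have E1 : (12 * side D j) ^+ n * (4 * (c4 * y)) = side D j ^+ n * y / 2.
    by rewrite exprMn /c4; move: (12 ^+ n) A12 => A A12; field; rewrite gt_eqF.
  have h2 : side D j ^+ n * ((8 * 4 ^+ n)^-1 * y) < T `^ (n%:R / delta).
    have -> : side D j ^+ n * ((8 * 4 ^+ n)^-1 * y) = (side D j ^+ n * y / 2) / (4 * 4 ^+ n).
      by move: (4 ^+ n) A4 => A A4; field; rewrite gt_eqF.
    rewrite ltr_pdivrMr ?mulr_gt0// mulrC; move: h1; rewrite E1; lra.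
  rewrite -powRM ?invr_ge0 ?(ltW y0) ?mulr_ge0 ?(ltW A4)//.
  rewrite ltNge; apply/negP => h3; move: h2; apply/negP; rewrite -leNgt.
  have -> : side D j ^+ n * ((8 * 4 ^+ n)^-1 * y) = (((8 * 4 ^+ n)^-1 * y) `^ p0 * side D j `^ delta) `^ (n%:R / delta).
    have nz : delta != 0 by rewrite gt_eqF.
    have nz' : n%:R != 0 :> R by rewrite gt_eqF.
    rewrite powRM ?powR_ge0// -!powRrM.
    have -> : p0 * (n%:R / delta) = 1 by rewrite /p0; field; rewrite nz nz'.
    have -> : delta * (n%:R / delta) = n%:R by field.
    have g0 : 0 <= (8 * 4 ^+ n)^-1 * y.
      by apply: mulr_ge0; [rewrite invr_ge0; apply/ltW/mulr_gt0|exact: ltW].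
    by rewrite powRr1// powR_mulrn ?(ltW sj)// mulrC.
  apply: ge0_ler_powR; rewrite ?nnegrE//; first by rewrite divr_ge0// ltW.
    by apply: sumr_ge0 => w _; exact: weight0_ge0.
  by rewrite mulr_ge0 ?powR_ge0.
(* Pigeonhole: all centres lie in the [11 ^ n] cubes of [B]. *)
have [a aB ha] : exists2 a, a \in B & c3 * y `^ p0 * side D j `^ delta < \sum_(w <- S | idx D j (c w) == a) wt0 w.
  apply: contrapT => no; move: big; apply/negP; rewrite -leNgt.
  have -> : \sum_(w <- S) wt0 w = \sum_(a <- B) \sum_(w <- S | idx D j (c w) == a) wt0 w.
    rewrite (exchange_big_dep xpredT)//= !big_seq; apply: eq_bigr => w wS.
    rewrite -big_filter (_ : [seq i <- B | idx D j (c w) == i] = [:: idx D j (c w)]) ?big_seq1//.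
    rewrite (eq_filter (a2 := pred1 (idx D j (c w)))); last by move=> i /=; rewrite eq_sym.
    by rewrite filter_pred1_uniq ?uniq_box//; apply: idx_box_near => i; exact: near_c.
  apply: (@le_trans _ _ (\sum_(a <- B) c3 * y `^ p0 * side D j `^ delta)).
    rewrite !big_seq; apply: ler_sum => a aB; rewrite leNgt; apply/negP => h; apply: no.
    by exists a.
  rewrite big_const_seq count_predT size_box iter_addr_0 -[_ *+ (11 ^ n)%N]mulr_natr natrX /c3.
  have : 11 ^+ n != 0 :> R by rewrite expf_neq0.
  by move: (11 ^+ n) (_ `^ p0) => E X E0; rewrite le_eqVlt; apply/orP; left; apply/eqP; field.
(* The mass in [a] is positive, so some centre lies there; it serves to name the ancestors of the
   cube and to measure their distance to [x]. *)
have [w0 w0S /eqP w0a] : exists2 w, w \in S & idx D j (c w) == a.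
  apply: contrapT => no; move: ha; rewrite big_seq_cond big_pred0.
    by apply/negP; rewrite -leNgt !mulr_ge0 ?powR_ge0// ltW// c3_gt0.
  by move=> w; apply/negP => /andP[wS wa]; apply: no; exists w.
have bj : heavy l j (idx D j (c w0)).
  rewrite /heavy -/y w0a; apply: (@lt_le_trans _ _ (\sum_(w <- S | idx D j (c w) == a) wt0 w)%:E).
    by rewrite lte_fin.
  rewrite -big_filter -sumEFin; apply: seq_le_esum; first exact: filter_uniq.
  move=> w; rewrite mem_filter => /andP[/eqP wa wS]; split => //.
  by have [] := HS w wS; rewrite ltr_pM2l.
(* [x] is within [4 * side D j] of that centre, which is within [side D i] of the corner of the
   ancestor. Since [i <= j], the total is at most [5 * side D i], inside the dilate. *)
have [i ij Mi] := max_heavy_exists bj; apply: (HB _ Mi) => /=.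
have si := side_gt0 i D0; have sij := side_le D0 ij.
apply: (@coord_eball _ _ (5 * side D i)); last first.
  have : 0 < n%:R * side D i by rewrite mulr_gt0.
  lra.
move=> k; have := near_c w0 w0S k; have := idx_bounds D0 i (c w0) k.
by rewrite intrD1 [fun_of_matrix (grid_pt _ _) _ _]mxE => /andP[b1 b2]; rewrite !ler_norml => /andP[b3 b4]; apply/andP; split; lra.
Qed.

End Cover.

(** * Unordered sums over sum types, pairs and separated families *)

Section EsumTools.
Context {R : realType}.
Local Open Scope ereal_scope.

Lemma esum_sumtype_le (T1 T2 : choiceType) (S : set (T1 + T2)) (a : T1 + T2 -> \bar R) :
  \esum_(t in S) a t <= \esum_(x in [set x | S (inl x)]) a (inl x) + \esum_(y in [set y | S (inr y)]) a (inr y).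
Proof.
apply: esum_le_seq => s us sS.
pose fl (t : T1 + T2) := if t is inl x then Some x else None.
pose fr (t : T1 + T2) := if t is inr x then Some x else None.
have -> : \sum_(t <- s) a t = \sum_(x <- pmap fl s) a (inl x) + \sum_(y <- pmap fr s) a (inr y).
  elim: s {us sS} => [|[x|y] s IH]; first by rewrite !big_nil adde0.
    by rewrite /= !big_cons IH addeA.
  by rewrite /= !big_cons IH addeCA.
apply: leeD; apply: seq_le_esum.
- by apply: (pmap_uniq (g := inl)) => //; case.
- by move=> x; rewrite mem_pmap => /mapP[[x'|//] /sS ? [->]].
- by apply: (pmap_uniq (g := inr)) => //; case.
- by move=> x; rewrite mem_pmap => /mapP[[//|x'] /sS ? [->]].
Qed.

Lemma esum_pair (T1 T2 : choiceType) (a : T1 -> T2 -> \bar R) : (forall x y, 0 <= a x y) ->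
  \esum_(x in setT) \esum_(y in setT) a x y = \esum_(k in [set: T1 * T2]) a k.1 k.2.
Proof.
move=> a0; rewrite esum_esum//; congr esum; apply/seteqP; split => // -[x y] _; split => //=.
Qed.

Lemma esum_indic_geom (T : choiceType) (S : set T) (y : T -> R) (e t : R) : (0 < e)%R -> (0 <= t)%R ->
  (forall a, S a -> 0 < y a <= t)%R ->
  (forall a b, S a -> S b -> a != b -> y a <= y b / 2 \/ y b <= y a / 2)%R ->
  \esum_(a in S) (y a `^ e)%:E <= ((1 - 2 `^ (- e))^-1 * t `^ e)%:E.
Proof.
move=> e0 t0 yt sep; apply: esum_le_seq => s us sS; rewrite sumEFin lee_fin.
by apply: geom_sep => // [a /sS|a b /sS Sa /sS Sb]; [exact: yt|exact: sep].
Qed.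

Lemma zpow_half (i j : int) : (i < j)%R -> (zpow 2 i <= zpow 2 j / 2 :> R)%R.
Proof.
move=> ij; rewrite ler_pdivlMr// -[X in (_ * X)%R](@powRr1 R 2)// /zpow -powRD; last by apply/implyP => _; rewrite pnatr_eq0.
by apply: ler_powR; rewrite ?ler1n// -(intrD _ i 1) ler_int -lezD1 in ij *.
Qed.

End EsumTools.

(** * The strong type estimate for the fractional maximal function *)

Section Strong.
Context {R : realType} {n : nat}.
Local Notation V := 'rV[R]_n.
Local Notation Z := 'rV[int]_n.
Local Notation W := (int * nat)%type.

Variables (D : R) (Omega : set V) (u : V -> R) (c : W -> V) (r : W -> R).
Hypotheses (D0 : 0 < D) (n0 : (0 < n)%N).
Hypothesis Oopen : eopen Omega.
Hypothesis uC1 : C1_on Omega u.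
Hypothesis cov : forall k x, Omega x -> zpow 2 k < mean_partial u x -> exists i, eball (c (k, i)) (r (k, i)) x.
Hypothesis r0 : forall w, 0 <= r w.
Variables (delta p kappa F : R).
Hypotheses (d0 : 0 < delta) (dn : delta <= n%:R) (dp : delta / n%:R < p).
Hypotheses (k0 : 0 <= kappa) (kd : kappa * p < delta) (F0 : 0 < F).

Let p0 := delta / n%:R.
Let wt := cover_weight r delta p.
Let wt0 := @cover_weight0 R n r delta.
Hypothesis hF : (\esum_(w in [set: W]) (wt w)%:E <= F%:E)%E.

Let MX := @max_heavy R n D c r delta kappa.
Let c4 : R := (2 * 12 ^+ n)^-1 / 4.
Let c3 : R := (8 * 4 ^+ n)^-1 `^ p0 / 11 ^+ n.
Let delta' := delta - kappa * p.

(** The level set at height 2^i of the fractional maximal function sup_j r_j^kappa a_j, with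
    averages read through [avg_bound]. *)
Definition large_avg_set (i : int) : set V :=
  [set x | Omega x /\ exists j, ~ avg_bound D Omega u j x (zpow 2 i * side D j `^ (- kappa))].

Definition big_balls (i : int) : set W := [set w | c4 * zpow 2 i < zpow 2 w.1 * r w `^ kappa].

Lemma delta'_gt0 : 0 < delta'. Proof. by rewrite subr_gt0. Qed.

Lemma hcontent_large_avg_set i : (hcontent delta' (large_avg_set i) <=
  \esum_(w in big_balls i) ((5 * n%:R * r w) `^ delta')%:E +
  \esum_(q in MX (zpow 2 i)) ((6 * n%:R * side D q.1) `^ delta')%:E)%E.
Proof.
pose S := [set t : W + nat * Z | match t with inl w => big_balls i w | inr q => MX (zpow 2 i) q end].
pose ce (t : W + nat * Z) := match t with inl w => c w | inr q => grid_pt (side D q.1) q.2 end.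
pose re (t : W + nat * Z) := match t with inl w => 5 * n%:R * r w | inr q => 6 * n%:R * side D q.1 end.
apply: (@le_trans _ _ (\esum_(t in S) ((re t) `^ delta')%:E)%E); last exact: esum_sumtype_le.
apply: (@hcontent_cover R n (W + nat * Z)%type S delta' (large_avg_set i) ce re).
- by rewrite gt_eqF// delta'_gt0.
- by move=> [w|q]; rewrite /re !mulr_ge0// ltW// side_gt0.
move=> x [Ox [j nX]]; apply: contrapT => no; apply: nX.
apply: (heavy_cover D0 n0 Oopen uC1 cov r0 d0 dn k0 (zpow_gt0 i)).
  by move=> w Bw wx; apply: no; exists (inl w).
by move=> q Mq qx; apply: no; exists (inr q).
Qed.

Let e := p - p0.
Lemma e_gt0 : 0 < e. Proof. by rewrite subr_gt0. Qed.

(** After exchanging the sums, a ball of level k and radius r is charged only by the levels i with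
    2^i < 2^k r^kappa / c4; their geometric sum is of order (2^k r^kappa)^p. The factor r^(kappa p)
    restores r^delta from r^(delta - kappa p). *)
Lemma sum_big_balls : (\esum_(i in [set: int]) ((zpow 2 i `^ p)%:E * \esum_(w in big_balls i) ((5 * n%:R * r w) `^ delta')%:E) <=
   ((5 * n%:R) `^ delta' * ((1 - 2 `^ (- p))^-1 * c4^-1 `^ p) * F)%:E)%E.
Proof.
have c40 : 0 < c4 by exact: c4_gt0.
have pp : 0 < p := p_gt0 n0 d0 dp.
pose a (i : int) (w : W) : \bar R := if `[< big_balls i w >] then (zpow 2 i `^ p * (5 * n%:R * r w) `^ delta')%:E else 0%E.
have a0 i w : (0 <= a i w)%E by rewrite /a; case: ifP => // _; rewrite lee_fin mulr_ge0 ?powR_ge0.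
apply: (@le_trans _ _ (\esum_(i in setT) \esum_(w in setT) a i w)%E).
  apply: le_esum => i _; rewrite -esumZ ?powR_gt0 ?zpow_gt0//; last by move=> w; rewrite lee_fin powR_ge0.
  by rewrite esum_mkcond; apply: le_esum => w _; rewrite /a /in_mem/= /mem/=/in_set; case: asboolP.
apply: (le_trans (esum_swap_le a0)).
pose K := (5 * n%:R) `^ delta' * ((1 - 2 `^ (- p))^-1 * c4^-1 `^ p).
have K0 : 0 <= K.
  by rewrite !mulr_ge0 ?powR_ge0// invr_ge0 subr_ge0 ltW// geom_const.
apply: (@le_trans _ _ (\esum_(w in setT) (K%:E * (wt w)%:E))%E); last first.
  apply: le_trans (esumZ_le _ K0 _) _; first by move=> w; rewrite lee_fin; exact: weight_ge0.
  by rewrite [X in (_ <= X)%E]EFinM; apply: lee_wpmul2l; rewrite ?lee_fin.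
apply: le_esum => w _.
pose t := zpow 2 w.1 * r w `^ kappa / c4.
have t0 : 0 <= t by rewrite divr_ge0 ?mulr_ge0 ?powR_ge0// ltW.
have c50 : 0 <= (5 * n%:R * r w) `^ delta' by exact: powR_ge0.
apply: (@le_trans _ _ (((5 * n%:R * r w) `^ delta')%:E * \esum_(i in [set i | big_balls i w]) (zpow 2 i `^ p)%:E)%E).
  rewrite [X in (X <= _)%E](_ : _ = \esum_(i in [set i | big_balls i w]) (((5 * n%:R * r w) `^ delta')%:E * (zpow 2 i `^ p)%:E)%E); last first.
    rewrite [RHS]esum_mkcond; apply: eq_esum => i _; rewrite /a -EFinM mulrC.
    by rewrite /in_mem/= /mem/=/in_set; case: asboolP => h; rewrite ?EFinM.
  by apply: esumZ_le => // i; rewrite lee_fin powR_ge0.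
apply: (@le_trans _ _ (((5 * n%:R * r w) `^ delta')%:E * ((1 - 2 `^ (- p))^-1 * t `^ p)%:E)%E).
  apply: lee_wpmul2l; first by rewrite lee_fin.
  apply: esum_indic_geom => // [i|i j].
    by rewrite /big_balls/= => h; rewrite zpow_gt0/= /t ler_pdivlMr// mulrC ltW.
  move=> _ _; rewrite neq_lt => /orP[ij|ij]; [left|right]; exact: zpow_half.
rewrite -!EFinM lee_fin /K /t /wt /cover_weight.
have rk : (r w) `^ delta = r w `^ delta' * (r w `^ kappa) `^ p.
  by rewrite -powRrM -powRD; [congr (_ `^ _); rewrite /delta'; ring|apply/implyP => /eqP h; move: d0; rewrite /delta' subrK in h *; rewrite h ltxx].
rewrite powRM ?mulr_ge0// [(zpow 2 w.1 * _ / c4) `^ p]powRM ?mulr_ge0 ?invr_ge0 ?powR_ge0 ?(ltW c40) ?(ltW (zpow_gt0 _))//.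
rewrite [(zpow 2 w.1 * _) `^ p]powRM ?powR_ge0 ?(ltW (zpow_gt0 _))// rk.
by rewrite le_eqVlt; apply/orP; left; apply/eqP; ring.
Qed.

Let yv (k : int * (nat * Z)) : R := zpow 2 k.1 * side D k.2.1 `^ (- kappa).
(** The pairs of a level and a maximal heavy cube at that level whose heaviness uses the mass of
    [w]; [yv] is the threshold for averages on that cube. *)
Let Q (w : W) : set (int * (nat * Z)) :=
  [set k | [/\ MX (zpow 2 k.1) k.2, idx D k.2.1 (c w) = k.2.2 & c4 * yv k < zpow 2 w.1]].

Lemma yv_gt0 k : 0 < yv k.
Proof. by rewrite mulr_gt0 ?zpow_gt0// powR_gt0// side_gt0. Qed.

(* Maximal heavy cubes around a fixed point shrink as the level grows, so the numbers
   [yv] double with the level and sum like a geometric series. *)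
Lemma Q_sep w k k' : Q w k -> Q w k' -> k.1 < k'.1 -> yv k <= yv k' / 2.
Proof.
move=> [M1 I1 _] [M2 I2 _] kk; have p1 : zpow 2 k.1 <= zpow 2 k'.1 / 2 :> R by exact: zpow_half.
have le : (k.2.1 <= k'.2.1)%N.
  rewrite leqNgt; apply/negP => lt; have [b1 m1] := M1; have [b2 _] := M2.
  apply: (m1 _ I1 _ lt); apply: (heavy_mono n0 d0 (ltW (zpow_gt0 _)) _ _ (l := zpow 2 k'.1)).
    by apply: (le_trans p1); rewrite ler_pdivrMr// ler_peMr ?(ltW (zpow_gt0 _))// ler1n.
  by rewrite I2.
have sk : side D k.2.1 `^ (- kappa) <= side D k'.2.1 `^ (- kappa).
  have s1 := side_gt0 k.2.1 D0; have s2 := side_gt0 k'.2.1 D0.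
  rewrite !powRN lef_pV2 ?posrE ?powR_gt0//; apply: ge0_ler_powR; rewrite ?nnegrE ?(ltW s1) ?(ltW s2)//.
  exact: side_le.
have -> : yv k' / 2 = zpow 2 k'.1 / 2 * side D k'.2.1 `^ (- kappa) by rewrite /yv; ring.
by apply: ler_pM => //; [exact/ltW/zpow_gt0|exact: powR_ge0].
Qed.

(** Two maximal heavy cubes of one level that contain the same centre are nested, hence equal. *)
Lemma Q_inj w k k' : Q w k -> Q w k' -> k.1 = k'.1 -> k = k'.
Proof.
move: k k' => [i [j a]] [i' [j' a']] [/= M1 I1 _] [/= M2 I2 _] ii; rewrite -ii in M2 *.
have jj : j = j'.
  have [lt|lt|//] := ltngtP j j'; exfalso.
    by have [_ m2] := M2; have [b1 _] := M1; apply: (m2 _ I2 _ lt); rewrite I1.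
  by have [_ m1] := M1; have [b2 _] := M2; apply: (m1 _ I1 _ lt); rewrite I2.
by rewrite jj -I1 -I2 jj.
Qed.

(** Heaviness bounds the cost of a cube by a multiple of [y ^ e] times its critical mass, [y] being
    its threshold. After the exchange, the thresholds charging a ball [w] sum geometrically to order
    [zpow 2 w.1 ^ e], which raises the exponent [p0] of its weight to [p]. *)
Lemma sum_max_heavy : (\esum_(i in [set: int]) ((zpow 2 i `^ p)%:E * \esum_(q in MX (zpow 2 i)) ((6 * n%:R * side D q.1) `^ delta')%:E) <=
   ((6 * n%:R) `^ delta' * c3^-1 * ((1 - 2 `^ (- e))^-1 * c4^-1 `^ e) * F)%:E)%E.
Proof.
have c40 : 0 < c4 by exact: c4_gt0.
have c30 : 0 < c3 by exact: c3_gt0.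
have pp : 0 < p := p_gt0 n0 d0 dp.
have e0 := e_gt0.
pose C := (6 * n%:R) `^ delta' * c3^-1.
have C0 : 0 <= C by rewrite mulr_ge0 ?powR_ge0// invr_ge0 ltW.
pose a (k : int * (nat * Z)) (w : W) : \bar R := if `[< Q w k >] then (C * (yv k `^ e * wt0 w))%:E else 0%E.
have w00 w : 0 <= wt0 w by exact: weight0_ge0.
have a0 k w : (0 <= a k w)%E.
  by rewrite /a; case: ifP => // _; rewrite lee_fin; apply: mulr_ge0 => //; apply: mulr_ge0 => //; exact: powR_ge0.
apply: (@le_trans _ _ (\esum_(i in setT) \esum_(q in setT) \esum_(w in setT) a (i, q) w)%E).
  apply: le_esum => i _; rewrite -esumZ ?powR_gt0 ?zpow_gt0//; last by move=> w; rewrite lee_fin powR_ge0.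
  rewrite esum_mkcond; apply: le_esum => q _; case: ifP => [|_]; last by apply: esum_ge0 => w _; exact: a0.
  move=> /set_mem Mq; have [bq _] := Mq.
  set y := yv (i, q); have y0 : 0 < y by exact: yv_gt0.
  have sq := side_gt0 q.1 D0.
  pose B := [set w | idx D q.1 (c w) = q.2 /\ c4 * y < zpow 2 w.1].
  rewrite -EFinM.
  (* By [zpow 2 i = y * side ^ kappa] the powers of the side combine to [side ^ delta]; the last
     factor is exactly the lower bound in [heavy]. *)
  have E1 : zpow 2 i `^ p * (6 * n%:R * side D q.1) `^ delta' = (C * y `^ e) * (c3 * y `^ p0 * side D q.1 `^ delta).
    have yE : zpow 2 i = y * side D q.1 `^ kappa by rewrite /y /yv/= powRN mulfVK// gt_eqF// powR_gt0.
    have sd : side D q.1 `^ delta = side D q.1 `^ delta' * (side D q.1 `^ kappa) `^ p.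
      rewrite -powRrM -powRD; last by apply/implyP => _; rewrite gt_eqF.
      by congr (_ `^ _); rewrite /delta'; ring.
    have yp : y `^ p = y `^ e * y `^ p0.
      rewrite -powRD; last by apply/implyP => _; rewrite gt_eqF.
      by congr (_ `^ _); rewrite /e; ring.
    have n6 : 0 <= 6 * n%:R :> R by rewrite mulr_ge0.
    rewrite yE (powRM _ (ltW y0) (powR_ge0 _ _)) yp sd (powRM _ n6 (ltW sq)) /C.
    by move: c3 c30 => x x0; field; rewrite gt_eqF.
  rewrite E1 EFinM; apply: (@le_trans _ _ ((C * y `^ e)%:E * \esum_(w in B) (wt0 w)%:E)%E).
    apply: lee_wpmul2l; first by rewrite lee_fin; apply: mulr_ge0 => //; exact: powR_ge0.
    exact: ltW bq.
  have Cy : 0 <= C * y `^ e by apply: mulr_ge0 => //; exact: powR_ge0.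
  have [Cy0|Cy0] := eqVneq (C * y `^ e) 0.
    by rewrite Cy0 mul0e; apply: esum_ge0 => w _; exact: a0.
  rewrite -esumZ; [|by rewrite lt_neqAle eq_sym Cy0 Cy|by move=> w; rewrite lee_fin].
  rewrite esum_mkcond; apply: le_esum => w _; rewrite /a; case: ifP => [/set_mem Bw|_].
    by rewrite (_ : `[< _ >] = true) -?EFinM ?mulrA//; apply/asboolP; case: Bw.
  by case: ifP => // _; rewrite lee_fin; apply: mulr_ge0 => //; apply: mulr_ge0 => //; exact: powR_ge0.
pose b i q := (\esum_(w in setT) a (i, q) w)%E.
have b0 i q : (0 <= b i q)%E by apply: esum_ge0 => w _; exact: a0.
rewrite (esum_pair b0).
rewrite (eq_esum (b := fun k => (\esum_(w in setT) a k w)%E)); last by move=> [i q].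
apply: (le_trans (esum_swap_le a0)).
pose K := C * ((1 - 2 `^ (- e))^-1 * c4^-1 `^ e).
have g0 : 0 <= (1 - 2 `^ (- e))^-1 :> R by rewrite invr_ge0 subr_ge0 ltW// geom_const.
have K0 : 0 <= K by apply: mulr_ge0 => //; apply: mulr_ge0 => //; exact: powR_ge0.
apply: (@le_trans _ _ (\esum_(w in setT) (K%:E * (wt w)%:E))%E); last first.
  apply: le_trans (esumZ_le _ K0 _) _; first by move=> w; rewrite lee_fin; exact: weight_ge0.
  by rewrite [X in (_ <= X)%E]EFinM; apply: lee_wpmul2l; rewrite ?lee_fin.
apply: le_esum => w _.
have t0 : 0 <= zpow 2 w.1 / c4 by rewrite divr_ge0 ?(ltW (zpow_gt0 _)) ?(ltW c40).
have CW : 0 <= C * wt0 w by exact: mulr_ge0.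
apply: (@le_trans _ _ ((C * wt0 w)%:E * \esum_(k in Q w) (yv k `^ e)%:E)%E).
  rewrite [X in (X <= _)%E](_ : _ = \esum_(k in Q w) ((C * wt0 w)%:E * (yv k `^ e)%:E)%E); last first.
    rewrite [RHS]esum_mkcond; apply: eq_esum => k _; rewrite /a -EFinM.
    rewrite /in_mem/= /mem/=/in_set; case: asboolP => h //.
    by congr EFin; ring.
  by apply: esumZ_le => // k; rewrite lee_fin powR_ge0.
apply: (@le_trans _ _ ((C * wt0 w)%:E * ((1 - 2 `^ (- e))^-1 * (zpow 2 w.1 / c4) `^ e)%:E)%E).
  apply: lee_wpmul2l; first by rewrite lee_fin.
  apply: esum_indic_geom => // [k [_ _ h]|k k' Qk Qk' kk].
    by rewrite yv_gt0/= ler_pdivlMr// mulrC ltW.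
  have [lt|lt|eq] := ltgtP k.1 k'.1; [left|right|].
  - exact: Q_sep Qk Qk' lt.
  - exact: Q_sep Qk' Qk lt.
  - by move: kk; rewrite (Q_inj Qk Qk' eq) eqxx.
rewrite -!EFinM lee_fin /K /wt /cover_weight /wt0 /cover_weight0.
have x0' : 0 < zpow 2 w.1 :> R by exact: zpow_gt0.
move: (zpow 2 w.1) x0' => x x0.
have -> : x `^ p = x `^ p0 * x `^ e.
  rewrite -powRD; last by apply/implyP => _; rewrite gt_eqF.
  by congr (_ `^ _); rewrite /e; ring.
rewrite powRM ?invr_ge0 ?(ltW c40) ?(ltW x0)//.
by rewrite le_eqVlt; apply/orP; left; apply/eqP; rewrite /p0; ring.
Qed.

Lemma strong_type : (\esum_(i in [set: int]) ((zpow 2 i `^ p)%:E * hcontent delta' (large_avg_set i)) <=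
  (((5 * n%:R) `^ delta' * ((1 - 2 `^ (- p))^-1 * c4^-1 `^ p) +
    (6 * n%:R) `^ delta' * c3^-1 * ((1 - 2 `^ (- e))^-1 * c4^-1 `^ e)) * F)%:E)%E.
Proof.
rewrite mulrDl EFinD; apply: le_trans (leeD sum_big_balls sum_max_heavy).
rewrite -esumD; last 2 first.
- by move=> i _; rewrite mule_ge0// ?lee_fin ?powR_ge0//; apply: esum_ge0 => w _; rewrite lee_fin powR_ge0.
- by move=> i _; rewrite mule_ge0// ?lee_fin ?powR_ge0//; apply: esum_ge0 => w _; rewrite lee_fin powR_ge0.
apply: le_esum => i _; rewrite -ge0_muleDr; last 2 first.
- by apply: esum_ge0 => w _; rewrite lee_fin powR_ge0.
- by apply: esum_ge0 => w _; rewrite lee_fin powR_ge0.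
by apply: lee_wpmul2l; [rewrite lee_fin powR_ge0|exact: hcontent_large_avg_set].
Qed.

End Strong.

(** * Choquet integrals and dyadic sums *)

Section Choquet.
Context {R : realType}.
Local Notation mu := (@lebesgue_measure R).

(** Preimages of upper rays under a monotone function are intervals. *)
Lemma noninc_measurable (phi : R -> \bar R) (D : set R) : measurable D ->
  (forall s t, s <= t -> (phi t <= phi s)%E) -> measurable_fun D phi.
Proof.
move=> mD H; apply: (@measurable_funS _ _ _ _ setT) => //.
apply: (measurability _ (ErealGenOInfty.measurableE R)) => // _ [_ [x ->] <-].
rewrite setTI; apply: is_interval_measurable => s t /=; rewrite !in_itv/= !andbT => xs xt y /andP[sy yt].
by rewrite in_itv/= andbT; apply: lt_le_trans xt _; exact: H.
Qed.

Variables (phi : R -> \bar R) (A p : R).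
Hypotheses (phi_mono : forall s t, s <= t -> (phi t <= phi s)%E) (phi0 : forall t, (0 <= phi t)%E).
Hypotheses (A0 : 0 < A) (p0 : 0 < p).

(** The free factor [A] lets the blocks follow a pointwise bound of the form [A * zpow 2 k ^ p] for
    the function to be integrated. *)
Let dyad (k : int) : R := A * zpow 2 k `^ p.
Let I (k : int) : set R := `[dyad k, dyad (k + 1)[%classic.
Let F (j : nat) : set R := if pickle_inv j is Some k then I k else set0.

Lemma dyad_gt0 k : 0 < dyad k. Proof. by rewrite mulr_gt0// powR_gt0// zpow_gt0. Qed.

Lemma dyadS k : dyad (k + 1) = 2 `^ p * dyad k.
Proof.
rewrite /dyad /zpow intrD powRD; last by apply/implyP => _; rewrite pnatr_eq0.
by rewrite powRr1// powRM ?powR_ge0//; ring.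
Qed.

Lemma two_p : 1 < 2 `^ p :> R.
Proof. by rewrite -invf_lt1 ?powR_gt0// -powRN; exact: geom_const. Qed.

Lemma dyad_mono k l : k <= l -> dyad k <= dyad l.
Proof.
move=> kl; rewrite /dyad ler_pM2l//; apply: ge0_ler_powR; rewrite ?nnegrE ?(ltW p0) ?(ltW (zpow_gt0 _))//.
by apply: ler_powR; rewrite ?ler1n// ler_int.
Qed.

Lemma int_dyadic_block k : ((dyad k * (2 `^ p - 1))%:E * phi (dyad (k + 1)) <= \int[mu]_(t in I k) phi t)%E /\
  (\int[mu]_(t in I k) phi t <= (dyad k * (2 `^ p - 1))%:E * phi (dyad k))%E.
Proof.
have mI : measurable (I k) by exact: measurable_itv.
have mphi := noninc_measurable mI phi_mono.
have muI : mu (I k) = (dyad k * (2 `^ p - 1))%:E.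
  rewrite lebesgue_measure_itv/= lte_fin dyadS.
  have lt : dyad k < 2 `^ p * dyad k by rewrite ltr_pMl ?dyad_gt0// two_p.
  by rewrite lt -EFinD; congr EFin; ring.
rewrite -muI; split; rewrite muleC -integral_cst//; apply: ge0_le_integral => //.
- by move=> t _; exact: phi0.
- by move=> t; rewrite /I/= in_itv/= => /andP[_ h]; apply: phi_mono; exact: ltW.
- by move=> t; rewrite /I/= in_itv/= => /andP[h _]; exact: phi_mono.
Qed.

Lemma cover_dyadic_blocks t : 0 < t -> exists k, I k t.
Proof.
move=> t0; have y0 : 0 < (t / A) `^ p^-1 by rewrite powR_gt0// divr_gt0.
have [k /andP[k1 k2]] := dyadic_between y0.
have S (l : int) : zpow 2 (l + 1) = 2 * zpow 2 l :> R.
  by rewrite /zpow intrD powRD ?powRr1 1?mulrC//; apply/implyP => _; rewrite pnatr_eq0.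
have yp : ((t / A) `^ p^-1) `^ p = t / A.
  by rewrite -powRrM mulVf ?gt_eqF// powRr1// divr_ge0 ?ltW.
have cmp (a b : R) : 0 <= a -> a <= b -> a `^ p <= b `^ p.
  by move=> a0 ab; apply: ge0_ler_powR; rewrite ?nnegrE ?(ltW p0)//; apply: le_trans ab.
exists (k + 1); rewrite /I/= in_itv/= /dyad; apply/andP; split.
  rewrite mulrC -ler_pdivlMr// -yp S; apply: cmp => //.
  by rewrite mulr_ge0// ltW// zpow_gt0.
rewrite mulrC -ltr_pdivrMr// -yp !S ltNge; apply/negP => h.
have : (2 * (2 * zpow 2 k)) `^ p `^ p^-1 <= (t / A) `^ p^-1 `^ p `^ p^-1.
  by apply: ge0_ler_powR; rewrite ?nnegrE ?powR_ge0// invr_ge0 ltW.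
have k0 : 0 < zpow 2 k :> R by exact: zpow_gt0.
rewrite !powRK ?powR_ge0 ?gt_eqF// ?mulr_ge0 ?(ltW k0)//; move: k2; lra.
Qed.

Lemma block_bounds k t : I k t -> dyad k <= t < dyad (k + 1).
Proof. by rewrite /I/= in_itv. Qed.

Lemma trivIset_blocks : trivIset setT F.
Proof.
apply/trivIsetP => i j _ _ ij; apply/seteqP; split => // t []; rewrite /F.
have Ki (T : countType) l (k : T) : pickle_inv l = Some k -> pickle k = l.
  by move=> h; have := @pickle_invK T l; rewrite h.
case Ei : (pickle_inv i) => [k|//]; case Ej : (pickle_inv j) => [l|//].
have kl : k != l by apply/eqP => kl; move: ij; rewrite -(Ki _ _ _ Ei) -(Ki _ _ _ Ej) kl eqxx.
move=> /block_bounds/andP[a1 a2] /block_bounds/andP[b1 b2].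
have sep (x y : int) : x < y -> dyad (x + 1) <= dyad y.
  by move=> xy; apply: dyad_mono; rewrite lezD1.
move: kl; rewrite neq_lt => /orP[/sep h|/sep h].
  by have := le_lt_trans (le_trans h b1) a2; rewrite ltxx.
by have := le_lt_trans (le_trans h a1) b2; rewrite ltxx.
Qed.

Lemma measurable_blocks j : measurable (F j).
Proof. by rewrite /F; case: (pickle_inv j) => [k|//]; exact: measurable_itv. Qed.

Lemma bigcup_blocks : \bigcup_j F j = `]0, +oo[%classic.
Proof.
apply/seteqP; split => t.
  move=> [j _]; rewrite /F; case: (pickle_inv j) => [k|//] /block_bounds/andP[h _].
  by rewrite /= in_itv/= andbT; apply: lt_le_trans h; exact: dyad_gt0.
rewrite /= in_itv/= andbT => /cover_dyadic_blocks[k Ik]; exists (pickle k) => //.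
by rewrite /F pickleK_inv.
Qed.

Lemma choquet_int_decomp : (\int[mu]_(t in `[0%R, +oo[%classic) phi t = \esum_(j in [set: nat]) \int[mu]_(t in F j) phi t)%E.
Proof.
rewrite -integral_itv_obnd_cbnd; last by apply: noninc_measurable => //; exact: measurable_itv.
rewrite -bigcup_blocks ge0_integral_bigcup//.
- by rewrite nneseries_esumT// => j; apply: integral_ge0 => t _; exact: phi0.
- exact: measurable_blocks.
- by apply: noninc_measurable => //; rewrite bigcup_blocks; exact: measurable_itv.
- exact: trivIset_blocks.
Qed.

Lemma choquet_int_upper : (\int[mu]_(t in `[0%R, +oo[%classic) phi t <=
  ((2 `^ p - 1) * A)%:E * \esum_(k in [set: int]) ((zpow 2 k `^ p)%:E * phi (dyad k)))%E.
Proof.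
have p1 : 0 < (2 `^ p - 1) * A by rewrite mulr_gt0// subr_gt0 two_p.
rewrite choquet_int_decomp -esumZ//; last by move=> k; rewrite mule_ge0// lee_fin powR_ge0.
apply: esum_le_seq => s us _; have [ut E] := pickle_seq (fun k => \int[mu]_(t in I k) phi t)%E us.
rewrite (eq_bigr (fun i => if pickle_inv i is Some x then \int[mu]_(t in I x) phi t else 0)%E); last first.
  by move=> i _; rewrite /F; case: (pickle_inv i) => // ; rewrite integral_set0.
rewrite E; apply: (le_trans _ (seq_le_esum _ ut _)) => //; apply: lee_sum => k _.
have [_ h] := int_dyadic_block k; apply: (le_trans h); rewrite muleA -EFinM.
suff -> : dyad k * (2 `^ p - 1) = (2 `^ p - 1) * A * zpow 2 k `^ p by [].
by rewrite /dyad; ring.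
Qed.

(** A lower bound uses right endpoints, so [phi (dyad k)] is compared with the block [k - 1]; this
    shift turns the factor 2^p - 1 into 1 - 2^(-p). *)
Lemma choquet_int_lower : (((1 - 2 `^ (- p)) * A)%:E * (\esum_(k in [set: int]) ((zpow 2 k `^ p)%:E * phi (dyad k))) <=
   \int[mu]_(t in `[0%R, +oo[%classic) phi t)%E.
Proof.
have p1 : 0 < (1 - 2 `^ (- p)) * A by rewrite mulr_gt0// subr_gt0 geom_const.
rewrite choquet_int_decomp -esumZ//; last by move=> k; rewrite mule_ge0// lee_fin powR_ge0.
apply: esum_le_seq => s us _.
pose s' := [seq pickle (k - 1) | k <- s].
have us' : uniq s'.
  by rewrite map_inj_uniq// => x y /(pcan_inj pickleK_inv) /addIr.
apply: (le_trans _ (seq_le_esum _ us' _)) => //; rewrite big_map; apply: lee_sum => k _.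
rewrite /F pickleK_inv; have [h _] := int_dyadic_block (k - 1); apply: le_trans h.
rewrite subrK muleA -EFinM; apply: lee_wpmul2r => //; rewrite lee_fin le_eqVlt; apply/orP; left; apply/eqP.
have E : dyad k = 2 `^ p * dyad (k - 1) by rewrite -dyadS subrK.
have -> : (1 - 2 `^ (- p)) * A * zpow 2 k `^ p = (1 - 2 `^ (- p)) * dyad k by rewrite /dyad; ring.
rewrite E powRN; have := two_p; move: (2 `^ p) => x x1; field; lra.
Qed.

End Choquet.

(** * Hedberg's inequality and the theorem *)

Section Hedberg.
Context {R : realType}.

Lemma side_sep (D rho : R) (j k : nat) : 0 < D -> 0 < rho -> j != k ->
  side D j / rho <= side D k / rho / 2 \/ side D k / rho <= side D j / rho / 2.
Proof.
move=> D0 rho0; have key i l : (i < l)%N -> side D l / rho <= side D i / rho / 2.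
  move=> il; have := side_le D0 il; have := sideS D i => E le.
  have x0 : 0 < rho^-1 by rewrite invr_gt0.
  move: (side D l) (side D i) (side D i.+1) (rho^-1) x0 E le => x y z t t0 -> xz.
  have := ler_wpM2r (ltW t0) xz; lra.
by rewrite neq_ltn => /orP[/key|/key]; [right|left].
Qed.

(** On either side of the crossover scale one term of the minimum is geometric with its largest
    value [M] at the crossover, so the bound does not depend on the number of scales. *)
Lemma hedberg_sum (D a1 a2 : R) : 0 < D -> 0 < a1 -> 0 < a2 ->
  forall (l Y : R) (J : nat), 0 < l -> 0 < Y ->
  \sum_(j < J) Num.min (l * side D j `^ a1) (Y * side D j `^ (- a2)) <=
  ((1 - 2 `^ (- a1))^-1 + (1 - 2 `^ (- a2))^-1) * (l `^ (a2 / (a1 + a2)) * Y `^ (a1 / (a1 + a2))).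
Proof.
move=> D0 a10 a20 l Y J l0 Y0; have a0 : 0 < a1 + a2 by rewrite addr_gt0.
have an : a1 + a2 != 0 by rewrite gt_eqF.
(* the scale at which the two terms of the minimum agree *)
pose rho := (Y / l) `^ (a1 + a2)^-1.
have rho0 : 0 < rho by rewrite powR_gt0// divr_gt0.
pose M := l `^ (a2 / (a1 + a2)) * Y `^ (a1 / (a1 + a2)).
have s0 j := side_gt0 j D0.
have M0 : 0 < M by rewrite mulr_gt0// powR_gt0.
have R1 (z : R) : rho `^ z = Y `^ (z / (a1 + a2)) * l `^ (- (z / (a1 + a2))).
  have li : l^-1 = l `^ (-1) by rewrite powR_inv1// ltW.
  rewrite /rho -powRrM (powRM _ (ltW Y0)) ?invr_ge0 ?(ltW l0)// li -powRrM.
  by congr (_ `^ _ * _ `^ _); field.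
have powD (x y z : R) : 0 < x -> x `^ y * x `^ z = x `^ (y + z).
  by move=> x0; rewrite -powRD//; apply/implyP => _; rewrite gt_eqF.
have pow1 (x z : R) : 0 < x -> x * x `^ z = x `^ (1 + z).
  by move=> x0; rewrite -powD// powRr1// ltW.
have lM : l * rho `^ a1 = M.
  by rewrite R1 mulrCA pow1// mulrC /M; congr (_ `^ _ * _ `^ _); field.
have YM : Y * rho `^ (- a2) = M.
  by rewrite R1 mulrA pow1// mulrC /M; congr (_ `^ _ * _ `^ _); field.
have T1 j : l * side D j `^ a1 = M * (side D j / rho) `^ a1.
  rewrite -lM powRM ?invr_ge0 ?(ltW rho0) ?(ltW (s0 j))//.
  have -> : rho^-1 `^ a1 = (rho `^ a1)^-1.
    by rewrite -powR_inv1 ?(ltW rho0)// -powRrM mulN1r powRN.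
  have rn : rho `^ a1 != 0 by rewrite gt_eqF// powR_gt0.
  by field.
have T2 j : Y * side D j `^ (- a2) = M * (rho / side D j) `^ a2.
  rewrite -YM powRM ?invr_ge0 ?(ltW rho0) ?(ltW (s0 j))//.
  have -> : (side D j)^-1 `^ a2 = side D j `^ (- a2).
    by rewrite -powR_inv1 ?(ltW (s0 j))// -powRrM mulN1r.
  have rn : rho `^ a2 != 0 by rewrite gt_eqF// powR_gt0.
  by rewrite [rho `^ (- a2)]powRN; field.
rewrite -/M (bigID (fun j : 'I_J => side D j <= rho))/= mulrDl; apply: lerD.
  apply: (@le_trans _ _ (M * \sum_(j < J | side D j <= rho) (side D j / rho) `^ a1)).
    by rewrite mulr_sumr; apply: ler_sum => j _; rewrite -T1 ge_min lexx.
  rewrite mulrC ler_pM2r// -big_filter.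
  have := @geom_sep R _ [seq j <- index_enum _ | side D (j : 'I_J) <= rho] (fun j => side D j / rho) a1 1 a10 ler01.
  rewrite powR1 mulr1; apply.
  - by rewrite filter_uniq// index_enum_uniq.
  - by move=> j; rewrite mem_filter => /andP[h _]; rewrite divr_gt0//= ler_pdivrMr// mul1r.
  - by move=> j k _ _ jk; apply: side_sep.
apply: (@le_trans _ _ (M * \sum_(j < J | ~~ (side D j <= rho)) (rho / side D j) `^ a2)).
  by rewrite mulr_sumr; apply: ler_sum => j _; rewrite -T2 ge_min lexx orbT.
rewrite mulrC ler_pM2r// -big_filter.
have := @geom_sep R _ [seq j <- index_enum _ | ~~ (side D (j : 'I_J) <= rho)] (fun j => rho / side D j) a2 1 a20 ler01.
rewrite powR1 mulr1; apply.
- by rewrite filter_uniq// index_enum_uniq.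
- move=> j; rewrite mem_filter -ltNge => /andP[h _]; rewrite divr_gt0//= ler_pdivrMr// mul1r; exact: ltW.
- move=> j k _ _ jk.
  have inv (x y : R) : 0 < x -> 0 < y -> x / rho <= y / rho / 2 -> rho / y <= rho / x / 2.
    move=> x0 y0 h0; have rn : rho != 0 by rewrite gt_eqF.
    have h : x <= y / 2.
      have := ler_wpM2r (ltW rho0) h0; rewrite divfK//.
      by have -> : y / rho / 2 * rho = y / 2 by field.
    rewrite ler_pdivrMr//; have -> : rho / x / 2 * y = rho * (y / 2 / x) by field; rewrite gt_eqF.
    by rewrite ler_peMr ?(ltW rho0)// ler_pdivlMr// mul1r.
  by have [h|h] := side_sep D0 rho0 jk; [right|left]; exact: inv.
Qed.

End Hedberg.

(** * Near-optimal coverings of the gradient level sets *)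

Section GoodCover.
Context {R : realType} {n : nat}.
Local Notation V := 'rV[R]_n.
Local Notation W := (int * nat)%type.

Lemma hcontent_ge0 (b : R) (E : set V) : (0 <= hcontent b E)%E.
Proof.
apply: le_ereal_inf_tmp => _ [c [r [_ [_ ->]]]]; apply: nneseries_ge0 => i _ _.
by rewrite lee_fin powR_ge0.
Qed.

Lemma hcontent_mono (b : R) (E E' : set V) : E `<=` E' -> (hcontent b E <= hcontent b E')%E.
Proof.
move=> EE; apply: le_ereal_inf => _ [c [r [r0 [E'r ->]]]]; exists c, r; split => //.
by split => // x /EE /E'r.
Qed.

(** Codes are distinct naturals, so the terms are pairwise separated by a factor 2 and the geometric
    bound applies with [e = t = 1]. *)
Lemma pickle_sum : (\esum_(k in [set: int]) (((2 ^+ (pickle k))^-1 : R)%:E) <= 2%:E)%E.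
Proof.
have := @esum_indic_geom R _ [set: int] (fun k => (2 ^+ (pickle k))^-1) 1 1 ltr01 ler01.
rewrite powR1 mulr1; have -> : (1 - 2 `^ (-1))^-1 = 2 :> R.
  by rewrite powR_inv1//; field.
have E : (fun k : int => (((2 ^+ pickle k)^-1 : R) `^ 1)%:E) = (fun k => ((2 ^+ pickle k)^-1)%:E).
  by apply/funext => k; rewrite powRr1// invr_ge0 exprn_ge0.
rewrite E; apply.
  move=> k _; rewrite invr_gt0 exprn_gt0//= invf_le1 ?exprn_gt0//.
  by apply: exprn_ege1; rewrite ler1n.
move=> k l _ _ kl.
have : pickle k != pickle l by apply: contra kl => /eqP /(pcan_inj pickleK) ->.
have := @side_sep R 1 1 (pickle k) (pickle l) ltr01 ltr01.
by rewrite /side !mul1r !divr1 => h /h [|]; [left|right].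
Qed.

(* The factor [2 ^- pickle k] distributes the slack [H - G] over all levels [k]. *)
Lemma good_cover (Omega : set V) (u : V -> R) (delta p G H : R) : (0 < n)%N -> 0 < p ->
  choquet delta Omega (fun x => (grad_norm u x `^ p)%:E) = G%:E -> G < H ->
  exists (c : W -> V) (r : W -> R), [/\ forall w, 0 <= r w,
    forall k x, Omega x -> zpow 2 k < mean_partial u x -> exists i, eball (c (k, i)) (r (k, i)) x &
    (\esum_(w in [set: W]) (cover_weight r delta p w)%:E <= (((1 - 2 `^ (- p))^-1 + 2) * H)%:E)%E].
Proof.
move=> n0 p0 EG GH.
pose phi (t : R) := hcontent delta [set x | Omega x /\ (t%:E < (grad_norm u x `^ p)%:E)%E].
pose E k : set V := [set x | Omega x /\ zpow 2 k < mean_partial u x].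
have phi_mono s t : s <= t -> (phi t <= phi s)%E.
  move=> st; apply: hcontent_mono => x [Ox tx]; split => //.
  by apply: le_lt_trans tx; rewrite lee_fin.
have phi0 t : (0 <= phi t)%E by exact: hcontent_ge0.
have : (((1 - 2 `^ (- p)) * 1)%:E * (\esum_(k in [set: int]) ((zpow 2 k `^ p)%:E * phi (1 * zpow 2 k `^ p)%R)) <= G%:E)%E.
  by rewrite -EG; exact: (choquet_int_lower phi_mono phi0 ltr01 p0).
have g0 : 0 < 1 - 2 `^ (- p) :> R by rewrite subr_gt0 geom_const.
have gi0 : 0 <= (1 - 2 `^ (- p))^-1 :> R by rewrite invr_ge0 ltW.
have G0 : 0 <= G by rewrite -lee_fin -EG; apply: integral_ge0 => t _; exact: phi0.
rewrite mulr1; have gi0' : (0 <= ((1 - 2 `^ (- p))^-1 : R)%:E)%E by rewrite lee_fin.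
move=> /(lee_wpmul2l gi0'); rewrite muleA -EFinM mulVf ?gt_eqF// mul1e -EFinM => hS.
have EP k : (hcontent delta (E k) <= phi (1 * zpow 2 k `^ p)%R)%E.
  apply: hcontent_mono => x [Ox kx]; split => //; rewrite lte_fin mul1r.
  have k0 : 0 < zpow 2 k :> R by exact: zpow_gt0.
  have kg : zpow 2 k < grad_norm u x by apply: lt_le_trans kx _; exact: mean_partial_le_grad.
  by apply: gt0_ltr_powR; rewrite ?nnegrE ?(ltW k0)//; apply: ltW; apply: lt_trans kg.
(* An approximate minimiser exists only for a finite infimum; finiteness at every level follows from
   that of the Choquet integral. *)
have Efin k : hcontent delta (E k) \is a fin_num.
  rewrite ge0_fin_numE ?hcontent_ge0//; apply: le_lt_trans (EP k) _.
  have k0 : 0 < zpow 2 k `^ p :> R by rewrite powR_gt0// zpow_gt0.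
  have : ((zpow 2 k `^ p)%:E * phi (1 * zpow 2 k `^ p)%R <= ((1 - 2 `^ (- p))^-1 * G)%:E)%E.
    apply: le_trans hS; have := @seq_le_esum R int setT (fun k => ((zpow 2 k `^ p)%:E * phi (1 * zpow 2 k `^ p)%R)%E) [:: k] isT (fun _ _ => I).
    by rewrite big_seq1.
  move: (phi _) (phi0 (1 * zpow 2 k `^ p)%R) => [x| |] //= _; first by rewrite ltry.
  by rewrite gt0_muley ?lte_fin// leye_eq.
(* The inverse of [zpow 2 k ^ p] cancels the weight with which level [k] enters the sum. *)
pose ek (k : int) : R := (H - G) * (zpow 2 k `^ p)^-1 * (2 ^+ pickle k)^-1.
have ek0 k : 0 < ek k.
  by rewrite !mulr_gt0 ?invr_gt0 ?exprn_gt0 ?subr_gt0// powR_gt0// zpow_gt0.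
have /choice[f Hf] : forall k, exists cr : (nat -> V) * (nat -> R),
   [/\ forall i, 0 <= cr.2 i, E k `<=` \bigcup_i eball (cr.1 i) (cr.2 i) &
    (\sum_(0 <= i <oo) ((cr.2 i) `^ delta)%:E <= hcontent delta (E k) + (ek k)%:E)%E].
  move=> k; have [_ [c [r [r0 [Er ->]]]] lt] := lb_ereal_inf_adherent (ek0 k) (Efin k).
  by exists (c, r); split => //; exact: ltW.
exists (fun w => (f w.1).1 w.2), (fun w => (f w.1).2 w.2); split.
- by move=> [k i]; have [h _ _] := Hf k; exact: h.
- move=> k x Ox kx; have [_ h _] := Hf k.
  by have [i _ xi] := h x (conj Ox kx); exists i.
pose a (k : int) (i : nat) : \bar R := (zpow 2 k `^ p * (f k).2 i `^ delta)%:E.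
have a0 k i : (0 <= a k i)%E by rewrite lee_fin mulr_ge0 ?powR_ge0.
have -> : (\esum_(w in [set: W]) (cover_weight (fun w => (f w.1).2 w.2) delta p w)%:E = \esum_(k in setT) \esum_(i in setT) a k i)%E.
  by rewrite (esum_pair a0).
apply: (@le_trans _ _ (\esum_(k in [set: int]) ((zpow 2 k `^ p)%:E * phi (1 * zpow 2 k `^ p)%R + (H - G)%:E * ((2 ^+ (pickle k))^-1)%:E))%E).
  apply: le_esum => k _; have [_ _ hk] := Hf k.
  have k0 : 0 < zpow 2 k `^ p :> R by rewrite powR_gt0// zpow_gt0.
  rewrite (eq_esum (b := fun i => ((zpow 2 k `^ p)%:E * ((f k).2 i `^ delta)%:E)%E)); last by move=> i _; rewrite /a EFinM.
  rewrite esumZ//; last by move=> i; rewrite lee_fin powR_ge0.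
  rewrite -nneseries_esumT; last by move=> i; rewrite lee_fin powR_ge0.
  apply: (@le_trans _ _ ((zpow 2 k `^ p)%:E * (phi (1 * zpow 2 k `^ p)%R + (ek k)%:E))%E).
    apply: lee_wpmul2l; first by rewrite lee_fin ltW.
    by apply: (le_trans hk); apply: leeD2r.
  rewrite ge0_muleDr ?lee_fin ?(ltW (ek0 k))//; apply: leeD2l; rewrite -!EFinM lee_fin /ek.
  rewrite le_eqVlt; apply/orP; left; apply/eqP.
  move: (2 ^+ pickle k)^-1 (zpow 2 k `^ p) k0 => y x x0; field; rewrite gt_eqF//.
rewrite esumD; last 2 first.
- by move=> k _; rewrite mule_ge0// lee_fin powR_ge0.
- by move=> k _; rewrite mule_ge0// lee_fin ?subr_ge0 ?invr_ge0 ?exprn_ge0// ltW.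
apply: (@le_trans _ _ (((1 - 2 `^ (- p))^-1 * G)%:E + (H - G)%:E * 2%:E)%E).
  have HG : 0 <= H - G by rewrite subr_ge0 ltW.
  have y0 (k : int) : (0 <= (((2 ^+ (pickle k))^-1 : R)%:E))%E by rewrite lee_fin invr_ge0 exprn_ge0.
  apply: leeD => //; apply: le_trans (esumZ_le _ HG y0) _.
  by apply: lee_wpmul2l; [rewrite lee_fin|exact: pickle_sum].
rewrite -EFinM -EFinD lee_fin [leRHS]mulrDl; apply: lerD; first by rewrite ler_wpM2l// ltW.
by lra.
Qed.

End GoodCover.

(** * Assembly of the two estimates *)

Section Main.
Context {R : realType} {n : nat}.
Local Notation V := 'rV[R]_n.
Local Notation W := (int * nat)%type.

Lemma le_infinitesimal (x y k : R) : 0 <= k -> (forall e, 0 < e -> x <= e + k * y) -> x <= k * y.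
Proof. by move=> k0 H; apply/ler_addgt0Pr => e /H; rewrite addrC. Qed.

Lemma avg_bound_min D (Omega : set V) u j x X Y : avg_bound D Omega u j x X -> avg_bound D Omega u j x Y ->
  avg_bound D Omega u j x (Num.min X Y).
Proof. by move=> HX HY; rewrite /Num.min; case: ifP. Qed.

(** The slack [G < H] is what the coverings need, since the infimum in the content may not be
    attained; it also keeps [F] positive when the gradient integral vanishes. *)
Lemma choquet_bound (Omega : set V) (s delta p kappa : R) : (0 < n)%N -> 1 <= s -> s_john s Omega ->
  0 < delta -> delta <= n%:R -> delta / n%:R < p -> 0 <= kappa ->
  let alpha := n%:R + s * (1 - n%:R) in kappa < alpha -> p * alpha < delta ->
  let q := (delta - kappa * p) * p / (delta - p * alpha) in
  exists (K : R) (b : (V -> R) -> R), 0 < K /\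
   forall u, C1_on Omega u -> forall G H,
     choquet delta Omega (fun x => (grad_norm u x `^ p)%:E) = G%:E -> 0 <= G -> G < H ->
     (choquet (delta - kappa * p) Omega (fun x => ((`|u x - b u|) `^ q)%:E) <= (K * H `^ (q / p))%:E)%E.
Proof.
move=> n0 s1 HJ d0 dn dp k0 alpha ka pa q.
have Oopen : eopen Omega by case: HJ => -[].
have nR : 0 < n%:R :> R by rewrite ltr0n.
have p0 : 0 < p by apply: lt_trans dp; rewrite divr_gt0.
have kd : kappa * p < delta.
  by apply: lt_trans pa; rewrite mulrC ltr_pM2l.
have a10 : 0 < alpha - kappa by rewrite subr_gt0.
have a20 : 0 < delta / p - alpha by rewrite subr_gt0 ltr_pdivlMr// mulrC.
have A0 : 0 < delta - kappa * p by rewrite subr_gt0.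
have B0 : 0 < delta - p * alpha by rewrite subr_gt0.
have q0 : 0 < q by rewrite divr_gt0// mulr_gt0.
have pq : p < q.
  rewrite /q ltr_pdivlMr// [_ * p]mulrC ltr_pM2l//.
  by rewrite ltrD2l ltrN2 mulrC ltr_pM2l.
have [D [K [b [D0 K0 PW]]]] := pointwise n0 s1 HJ.
pose CH := (1 - 2 `^ (- (alpha - kappa)))^-1 + (1 - 2 `^ (- (delta / p - alpha)))^-1 : R.
have CH0 : 0 < CH by rewrite addr_gt0// invr_gt0 subr_gt0 geom_const.
pose CF : R := (1 - 2 `^ (- p))^-1 + 2.
have CF0 : 0 < CF by rewrite addr_gt0// invr_gt0 subr_gt0 geom_const.
pose c4 : R := (2 * 12 ^+ n)^-1 / 4.
pose e := p - delta / n%:R.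
pose c3 : R := (8 * 4 ^+ n)^-1 `^ (delta / n%:R) / 11 ^+ n.
pose delta' := delta - kappa * p.
pose CS : R := ((5 * n%:R) `^ delta' * ((1 - 2 `^ (- p))^-1 * c4^-1 `^ p) +
    (6 * n%:R) `^ delta' * c3^-1 * ((1 - 2 `^ (- e))^-1 * c4^-1 `^ e)).
have CS0 : 0 < CS.
  have c40 : 0 < c4 by exact: c4_gt0.
  have c30 : 0 < c3 by exact: c3_gt0.
  have e0 : 0 < e by rewrite subr_gt0.
  by rewrite addr_gt0// !mulr_gt0// ?invr_gt0 ?subr_gt0 ?geom_const// powR_gt0// ?invr_gt0// mulr_gt0.
have C1 : 0 < (@avg_const R n) :> R by rewrite addr_gt0// mulr_gt0// exprn_gt0.
pose KK := (2 `^ p - 1) * (K * CH) `^ q * (@avg_const R n) `^ (q - p) * CS * CF `^ (q / p).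
exists KK, b; split.
  by rewrite !mulr_gt0 ?powR_gt0 ?mulr_gt0// subr_gt0 two_p.
move=> u uC1 G H EG G0 GH.
have H0 : 0 < H by apply: le_lt_trans GH.
have [c [r [r0 cov hF]]] := good_cover n0 p0 EG GH.
set F := (_ * H) in hF; have F0 : 0 < F by rewrite mulr_gt0.
pose Y := (@avg_const R n) * F `^ p^-1.
have Y0 : 0 < Y by rewrite mulr_gt0// powR_gt0.
(* Chosen so that [|u - b u| ^ q <= A * zpow 2 i ^ p] off [large_avg_set i]; the blocks of the
   Choquet integral use the same [A]. *)
pose A := (K * CH) `^ q * Y `^ (q - p).
have AA0 : 0 < A by rewrite mulr_gt0// powR_gt0// mulr_gt0.
pose psi (t : R) := hcontent delta' [set x | Omega x /\ (t%:E < ((`|u x - b u|) `^ q)%:E)%E].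
have psi_mono t t' : t <= t' -> (psi t' <= psi t)%E.
  move=> st; apply: hcontent_mono => x [Ox tx]; split => //.
  by apply: le_lt_trans tx; rewrite lee_fin.
have psi0 t : (0 <= psi t)%E by exact: hcontent_ge0.
have ptw i x : Omega x -> ~ large_avg_set D Omega u kappa i x -> `|u x - b u| `^ q <= A * zpow 2 i `^ p.
  move=> Ox nW; have l0 : 0 < zpow 2 i :> R by exact: zpow_gt0.
  have X1 j : avg_bound D Omega u j x (zpow 2 i * side D j `^ (- kappa)).
    by apply: contrapT => h; apply: nW; split => //; exists j.
  have X2 j : avg_bound D Omega u j x (@avg_const R n * (F / side D j `^ delta) `^ p^-1).
    exact: (avg_bound_global D0 n0 Oopen uC1 cov r0 d0 dn dp F0 hF).
  pose X j := Num.min (zpow 2 i * side D j `^ (- kappa)) ((@avg_const R n) * (F / side D j `^ delta) `^ p^-1).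
  have X0 j : 0 <= X j.
    by rewrite le_min mulr_ge0 ?powR_ge0 ?(ltW l0)//= mulr_ge0 ?powR_ge0// ltW.
  have XX j : avg_bound D Omega u j x (X j) by exact: avg_bound_min.
  have s0 j := side_gt0 j D0.
  have powD (y z w : R) : 0 < y -> y `^ z * y `^ w = y `^ (z + w).
    by move=> y0; rewrite -powRD//; apply/implyP => _; rewrite gt_eqF.
  have EX j : side D j `^ alpha * X j = Num.min (zpow 2 i * side D j `^ (alpha - kappa)) (Y * side D j `^ (- (delta / p - alpha))).
    rewrite /X minr_pMr ?powR_ge0//; congr Num.min.
      by rewrite mulrCA powD.
    rewrite mulrCA /Y -mulrA; congr (_ * _).
    have si0 : 0 <= (side D j `^ delta)^-1 by rewrite invr_ge0 powR_ge0.
    rewrite (powRM p^-1 (ltW F0) si0) mulrCA; congr (_ * _).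
    rewrite -powRN -powRrM powD//; congr (_ `^ _); field.
    by rewrite gt_eqF.
  pose Z := CH * (zpow 2 i `^ ((delta / p - alpha) / ((alpha - kappa) + (delta / p - alpha))) *
      Y `^ ((alpha - kappa) / ((alpha - kappa) + (delta / p - alpha)))).
  have le1 : `|u x - b u| <= K * Z.
    apply: le_infinitesimal; first exact: ltW.
    move=> ep ep0; have [J HJ'] := PW u uC1 x X Ox X0 XX ep ep0.
    apply: (le_trans HJ'); rewrite lerD2l ler_pM2l//.
    under eq_bigr do rewrite -/alpha EX.
    exact: hedberg_sum.
  have Z0 : 0 <= K * Z by apply: le_trans le1.
  apply: (@le_trans _ _ ((K * Z) `^ q)); first by apply: ge0_ler_powR; rewrite ?nnegrE// ltW.
  have KC0 : 0 <= K * CH by rewrite mulr_ge0 ?(ltW K0) ?(ltW CH0).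
  rewrite /Z mulrA (powRM q KC0 (mulr_ge0 (powR_ge0 _ _) (powR_ge0 _ _))).
  rewrite (powRM q (powR_ge0 _ _) (powR_ge0 _ _)) -[(zpow 2 i `^ _) `^ q]powRrM -[(Y `^ _) `^ q]powRrM.
  have nzp : p != 0 by rewrite gt_eqF.
  have nzA : delta - kappa * p != 0 by rewrite gt_eqF.
  have nzB : delta - p * alpha != 0 by rewrite gt_eqF.
  (* The value of [q] is dictated by this identity: the level must appear with the exponent [p] of
     the strong type estimate. *)
  have -> : (delta / p - alpha) / (alpha - kappa + (delta / p - alpha)) * q = p.
    have -> : alpha - kappa + (delta / p - alpha) = (delta - kappa * p) / p by field.
    by rewrite /q; field; rewrite nzp nzA nzB.
  have -> : (alpha - kappa) / (alpha - kappa + (delta / p - alpha)) * q = q - p.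
    have -> : alpha - kappa + (delta / p - alpha) = (delta - kappa * p) / p by field.
    by rewrite /q; field; rewrite nzp nzA nzB.
  by rewrite /A le_eqVlt; apply/orP; left; apply/eqP; ring.
have psiW i : (psi (A * zpow 2 i `^ p)%R <= hcontent delta' (large_avg_set D Omega u kappa i))%E.
  apply: hcontent_mono => x [Ox tx]; apply: contrapT => nW.
  by move: tx; rewrite lte_fin ltNge => /negP; apply; exact: ptw.
apply: (le_trans (choquet_int_upper psi_mono psi0 AA0 p0)).
have ST := strong_type D0 n0 Oopen uC1 cov r0 d0 dn dp k0 kd hF.
apply: (@le_trans _ _ (((2 `^ p - 1) * A)%:E * (CS * F)%:E)%E).
  apply: lee_wpmul2l; first by rewrite lee_fin mulr_ge0 ?(ltW AA0)// subr_ge0 ltW// two_p.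
  apply: le_trans ST; apply: le_esum => i _.
  by apply: lee_wpmul2l; rewrite ?lee_fin ?powR_ge0.
rewrite -EFinM lee_fin /KK /A /Y.
have EF : ((@avg_const R n) * F `^ p^-1) `^ (q - p) * F = (@avg_const R n) `^ (q - p) * F `^ (q / p).
  rewrite powRM ?powR_ge0 ?(ltW C1)// -mulrA; congr (_ * _).
  rewrite -powRrM -{2}[F]powRr1 ?(ltW F0)// -powRD; last by apply/implyP => _; rewrite gt_eqF.
  by congr (_ `^ _); field; rewrite gt_eqF.
have FH : F `^ (q / p) = CF `^ (q / p) * H `^ (q / p) by rewrite powRM// ltW.
rewrite le_eqVlt; apply/orP; left; apply/eqP.
transitivity ((2 `^ p - 1) * (K * CH) `^ q * CS * (((@avg_const R n) * F `^ p^-1) `^ (q - p) * F)); first by ring.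
by rewrite EF FH; ring.
Qed.

End Main.

Theorem theorem4p7 (R : realType) (n : nat) (Omega : set 'rV[R]_n)
  (s delta p kappa : R) :
  (2 <= n)%N ->
  1 <= s -> s < n%:R / (n%:R - 1) ->
  s_john s Omega ->
  0 < delta -> delta <= n%:R ->
  delta / n%:R < p -> p < delta / (n%:R + s * (1 - n%:R)) ->
  0 <= kappa -> kappa < n%:R + s * (1 - n%:R) ->
  let q := (delta - kappa * p) * p / (delta - p * (n%:R + s * (1 - n%:R))) in
  exists c : R, 0 < c /\
    forall u : 'rV[R]_n -> R, C1_on Omega u ->
      (ereal_inf [set poweR (choquet (delta - kappa * p) Omega
                      (fun x => ((`|u x - b|) `^ q)%:E)) (q^-1) | b in [set: R]]
       <= c%:E * poweR (choquet delta Omega (fun x => (grad_norm u x `^ p)%:E)) (p^-1))%E.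
Proof.
move=> n2 s1 sn HJ d0 dn dp pd k0 ka q.
have n0 : (0 < n)%N by exact: ltnW.
have p0 : 0 < p by apply: lt_trans dp; rewrite divr_gt0// ltr0n.
have al0 : 0 < n%:R + s * (1 - n%:R) by exact: le_lt_trans ka.
have pa : p * (n%:R + s * (1 - n%:R)) < delta by rewrite -ltr_pdivlMr.
have [K [b [K0 HK]]] := choquet_bound n0 s1 HJ d0 dn dp k0 ka pa.
have A0 : 0 < delta - kappa * p.
  by rewrite subr_gt0; apply: lt_trans pa; rewrite mulrC ltr_pM2l.
have q0 : 0 < q by rewrite divr_gt0 ?mulr_gt0// subr_gt0.
have pn : p^-1 != 0 by rewrite invr_eq0 gt_eqF.
have c0 : 0 < K `^ q^-1 by rewrite powR_gt0.
exists (K `^ q^-1); split => // u uC1.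
set L := ereal_inf _.
have ch0 d f : (0 <= choquet d Omega f)%E.
  by apply: integral_ge0 => t _; exact: hcontent_ge0.
have := ch0 delta (fun x => (grad_norm u x `^ p)%:E).
(* If the gradient integral is infinite, so is the right-hand side, since its constant is
   positive. *)
case EG : (choquet delta Omega _) => [G| |] // G0; last first.
  by rewrite poweRyr// gt0_muley ?lte_fin// leey.
rewrite lee_fin in G0; rewrite poweR_EFin -EFinM.
apply/lee_addgt0Pr => e e0.
(* With [H = g ^ p] and [g = G ^ (1/p) + eta], taking the root of order [q] leaves [K ^ (1/q) * g],
   which exceeds the desired bound by exactly [e]. *)
pose eta := e / K `^ q^-1; have eta0 : 0 < eta by rewrite divr_gt0.
pose g := G `^ p^-1 + eta; have g0 : 0 < g by rewrite ltr_wpDl// powR_ge0.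
have GE : G = (G `^ p^-1) `^ p by rewrite -powRrM mulVf ?powRr1// gt_eqF.
have GH : G < g `^ p.
  rewrite {1}GE; apply: gt0_ltr_powR; rewrite ?nnegrE ?powR_ge0 ?(ltW g0)//.
  by rewrite /g ltrDl.
have := HK u uC1 G (g `^ p) EG G0 GH; rewrite -/q => le.
apply: (@le_trans _ _ (poweR (choquet (delta - kappa * p) Omega (fun x => ((`|u x - b u|) `^ q)%:E)) q^-1)).
  by apply: ereal_inf_lbound; exists (b u).
apply: (@le_trans _ _ (poweR (K * g `^ p `^ (q / p))%:E q^-1)).
  by apply: gt0_ler_poweR; rewrite ?invr_ge0 ?(ltW q0)//; rewrite in_itv/= ?andbT ?leey ?ch0// lee_fin mulr_ge0 ?powR_ge0// ltW.
rewrite poweR_EFin -EFinD lee_fin powRM ?powR_ge0 ?(ltW K0)//.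
have -> : ((g `^ p) `^ (q / p)) `^ q^-1 = g.
  transitivity (g `^ 1); last by rewrite powRr1// ltW.
  by rewrite -!powRrM; congr (_ `^ _); field; rewrite !gt_eqF.
by rewrite /g mulrDr /eta lerD2l mulrCA mulfV ?mulr1// gt_eqF.
Qed.
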